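(* Let the family of holes in a regular domain $\Omega$ be uniformly locally finite. Suppose that, for some $S<+\infty$, the graph $G(\Omega,S)$ is connected and that the distance in $G(\Omega,S)$ from $B_j$ to $\mathbb D^{(c)}$ is at most $M$ for every hole $B_j$, with some $M\in\mathbb N$ not depending on $j$. Then $\Omega$ has the interpolation property; moreover, $C_I(\Omega)$ can be estimated from above in terms of only $S$, $M$ and $N(\Omega)$.
   Context: $\mathbb D=\{z\in\mathbb C:|z|<1\}$, $E^{(c)}=\mathbb C\setminus E$; $\mathrm{dist}$ and $\mathrm{diam}$ are Euclidean. Regular domain: $\Omega=\mathbb D\setminus\bigcup_j B_j$, where $\{B_j\}$ is a countable (infinite or finite) family of pairwise disjoint compact subsets of $\mathbb D$, called holes, such that each $B_j$ is connected, does not separate the plane, and is the closure of a domain with smooth boundary, and the $B_j$ accumulate only to $\partial\mathbb D$ (every compact subset of $\mathbb D$ meets only finitely many $B_j$). $L^{2,1}_c(\Omega)$ is the Hilbert space of real differential $1$-forms $\omega=\omega_x dx+\omega_y dy$ on $\Omega$ with $\omega_x,\omega_y\in L^2(\Omega)$ that are closed, $d\omega=0$ in the sense of distributions; $\|\omega\|^2=\int_\Omega(\omega_x^2+\omega_y^2)\,d\lambda_2$. For each $j$ let $\gamma_j\subset\Omega$ be a smooth closed curve winding once in the positive direction around $B_j$ and not winding around the other holes; $\mathrm{Per}_j(\omega)=\int_{\gamma_j}\omega$ for smooth closed $L^2$-forms, extended by continuity to $L^{2,1}_c(\Omega)$. $\mathrm{Per}\,\omega=\{\mathrm{Per}_j\omega\}_j$.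 Interpolation property: there is $C<+\infty$ such that for every real $a\in\ell^2$ there is $\omega\in L^{2,1}_c(\Omega)$ with $\mathrm{Per}\,\omega=a$, $\|\omega\|\le C\|a\|_{\ell^2}$; $C_I(\Omega)$ is the least such $C$. Hyperbolic distance in $\mathbb D$: $\mathrm{dist}_H(z_1,z_2)=\operatorname{arctanh}\left|\frac{z_1-z_2}{1-z_1\bar z_2}\right|$. The family of holes is uniformly locally finite if there is $N\in\mathbb N$ such that every disk of radius $1$ in the hyperbolic metric intersects no more than $N$ of the holes; $N(\Omega)$ is the least such $N$. Graph $G(\Omega,S)$, $S\in(0,+\infty)$: non-oriented graph whose vertices are all the holes $B_j$ and the set $\mathbb D^{(c)}$. Two distinct holes $B_j,B_k$ are joined by an edge iff $\mathrm{dist}(B_j,B_k)\le S\min\{\mathrm{diam}\,B_j,\mathrm{diam}\,B_k\}$; $B_j$ and $\mathbb D^{(c)}$ are joined by an edge iff $\mathrm{dist}(B_j,\mathbb D^{(c)})\le S\,\mathrm{diam}\,B_j$. The distance between two vertices is the number of edges of a shortest path (infinity if there is none). *)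

(* Defs.v *)
From HB Require Import structures.
From mathcomp Require Import all_boot all_order all_algebra.
From mathcomp Require Import all_classical all_reals all_analysis.
From mathcomp Require Import complex.

Set Implicit Arguments.
Unset Strict Implicit.
Unset Printing Implicit Defensive.

Import Order.TTheory GRing.Theory Num.Theory.
Import numFieldNormedType.Exports.

Local Open Scope card_scope.
Local Open Scope classical_set_scope.
Local Open Scope ring_scope.

(* The plane is R * R.  The library norm on R * R is the sup norm; it is only
   used through its topology and its notion of differentiability.  All
   distances below are computed with [eucl_dist]. *)
Notation plane R := (R * R)%type.

Section PlaneGeometry.
Context {R : realType}.
Implicit Types (A B : set (plane R)) (z w : plane R).

Definition eucl_dist z w : R :=
  Num.sqrt ((z.1 - w.1) ^+ 2 + (z.2 - w.2) ^+ 2).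

Definition set_dist A B : R := inf [set eucl_dist z w | z in A & w in B].

Definition diam A : R := sup [set eucl_dist z w | z in A & w in A].

Definition disk : set (plane R) := [set z | eucl_dist z (0, 0) < 1].

Definition to_complex z : R[i] := Complex z.1 z.2.

Definition artanh (t : R) : R := ln ((1 + t) / (1 - t)) / 2.

Definition hdist z w : R :=
  let a := to_complex z in let b := to_complex w in
  artanh (Normc.normc ((a - b) / (1 - a * b^*)%C)).

Definition hdisk z (r : R) : set (plane R) := [set w | disk w /\ hdist z w < r].

End PlaneGeometry.

Section Smoothness.
Context {R : realType}.

Definition partial_x (f : plane R -> R) : plane R -> R := 'D_((1, 0) : plane R) f.
Definition partial_y (f : plane R -> R) : plane R -> R := 'D_((0, 1) : plane R) f.

Definition iter_partial (s : seq bool) (f : plane R -> R) : plane R -> R :=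
  foldr (fun b g => if b then partial_y g else partial_x g) f s.

(* C^oo on an open set V: all iterated partial derivatives exist and are
   differentiable (hence continuous) at every point of V.  Values of f outside
   V are irrelevant. *)
Definition smooth_on (V : set (plane R)) (f : plane R -> R) : Prop :=
  forall s z, V z -> differentiable (iter_partial s f) z.

(* A domain (nonempty connected open set) with C^oo boundary: locally at each
   boundary point it is a strict sublevel set of a C^oo function with nonzero
   gradient. *)
Definition smooth_domain (U : set (plane R)) : Prop :=
  [/\ U !=set0, open U, connected U &
    forall p, (closure U `\` U) p ->
      exists V : set (plane R), exists rho : plane R -> R,
        [/\ open V, V p, smooth_on V rho,
            (partial_x rho p, partial_y rho p) <> (0, 0) &
            U `&` V = [set z | V z /\ rho z < 0]]].

Definition test_function (Omega : set (plane R)) (phi : plane R -> R) : Prop :=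
  [/\ smooth_on setT phi,
      compact (closure [set z | phi z != 0]) &
      closure [set z | phi z != 0] `<=` Omega].

End Smoothness.

Section RegularDomain.
Context {R : realType} {J : countType}.
Variable B : J -> set (plane R).

Definition regular_domain : set (plane R) :=
  disk `\` \bigcup_(j in [set: J]) B j.

Definition regular_holes : Prop :=
  [/\ forall j, [/\ compact (B j), B j `<=` disk, connected (B j),
                    connected (~` B j) &
                    exists U, smooth_domain U /\ B j = closure U],
      forall j k, j <> k -> B j `&` B k = set0 &
      forall K : set (plane R), compact K -> K `<=` disk ->
        finite_set [set j | B j `&` K !=set0]].

Definition hyp_disks_meet_at_most (N : nat) : Prop :=
  forall z, disk z -> [set j | B j `&` hdisk z 1 !=set0] #<= `I_N.

Definition uniformly_locally_finite : Prop :=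
  exists N, hyp_disks_meet_at_most N.

(* The least admissible N; it exists whenever the family of holes is uniformly
   locally finite, and the value is irrelevant otherwise. *)
Definition N_holes : nat :=
  xget 0%N [set N | hyp_disks_meet_at_most N /\
    forall N', hyp_disks_meet_at_most N' -> (N <= N')%N].

(* The graph G(Omega, S): [Some j] is the hole B j, [None] is the complement of
   the unit disk. *)
Definition adjacent (S : R) (u v : option J) : Prop :=
  match u, v with
  | Some j, Some k =>
      j <> k /\ set_dist (B j) (B k) <= S * Num.min (diam (B j)) (diam (B k))
  | Some j, None | None, Some j => set_dist (B j) (~` disk) <= S * diam (B j)
  | None, None => False
  end.

Definition edge (S : R) : rel (option J) := fun u v => `[< adjacent S u v >].

Definition walks (S : R) (u v : option J) : set (seq (option J)) :=
  [set p | path (edge S) u p /\ last u p = v].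

Definition graph_connected (S : R) : Prop := forall u v, walks S u v !=set0.

(* Minimal number of edges of a walk from u to v; +oo if there is none. *)
Definition graph_dist (S : R) (u v : option J) : \bar R :=
  ereal_inf [set (size p)%:R%:E | p in walks S u v].

End RegularDomain.

(* A real 1-form omega_x dx + omega_y dy is given by z |-> (omega_x z, omega_y z);
   only its values on Omega matter. *)
Notation one_form R := (plane R -> plane R).

(* The plane with its Borel sigma-algebra, as used by [lebesgue_measure]. *)
Notation mplane R := (measurableTypeR R * measurableTypeR R)%type.

Notation lambda2 R := (@lebesgue_measure R \x @lebesgue_measure R)%E.

Section Forms.
Context {R : realType}.
Implicit Types (Omega : set (plane R)) (omega : one_form R).

Definition form_sqnorm Omega omega : \bar R :=
  (\int[lambda2 R]_(z in Omega) ((omega z).1 ^+ 2 + (omega z).2 ^+ 2)%:E)%E.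

Definition form_norm Omega omega : R := Num.sqrt (fine (form_sqnorm Omega omega)).

(* d omega = 0 in the sense of distributions. *)
Definition weakly_closed Omega omega : Prop :=
  forall phi, test_function Omega phi ->
    (\int[lambda2 R]_(z in Omega)
      ((omega z).1 * partial_y phi z - (omega z).2 * partial_x phi z)%:E = 0)%E.

Definition L21c Omega omega : Prop :=
  [/\ measurable_fun (Omega : set (mplane R)) (fun z : mplane R => (omega z).1),
      measurable_fun (Omega : set (mplane R)) (fun z : mplane R => (omega z).2),
      (form_sqnorm Omega omega < +oo)%E &
      weakly_closed Omega omega].

Definition smooth_form Omega omega : Prop :=
  smooth_on Omega (fun z => (omega z).1) /\
  smooth_on Omega (fun z => (omega z).2).

(* A C^oo closed curve, parametrized by [0, 1] and extended 1-periodically. *)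
Definition smooth_closed_curve (gamma : R -> plane R) : Prop :=
  [/\ forall n t, derivable (derive1n n (fun s => (gamma s).1)) t 1,
      forall n t, derivable (derive1n n (fun s => (gamma s).2)) t 1 &
      forall t, gamma (t + 1) = gamma t].

Definition line_integral (gamma : R -> plane R) omega : R :=
  \int[lebesgue_measure]_(t in `[0, 1])
    ((omega (gamma t)).1 * derive1 (fun s => (gamma s).1) t +
     (omega (gamma t)).2 * derive1 (fun s => (gamma s).2) t).

(* The form d arg (z - p) / (2 pi). *)
Definition angular_form (p : plane R) : one_form R := fun z =>
  let x := z.1 - p.1 in let y := z.2 - p.2 in
  (- y / (2 * pi * (x ^+ 2 + y ^+ 2)), x / (2 * pi * (x ^+ 2 + y ^+ 2))).

Definition winding_number (gamma : R -> plane R) (p : plane R) : R :=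
  line_integral gamma (angular_form p).

End Forms.

Section Interpolation.
Context {R : realType} {J : countType}.
Variables (B : J -> set (plane R)) (gamma : J -> R -> plane R).

Definition period_curves : Prop :=
  forall j, [/\ smooth_closed_curve (gamma j),
    forall t, regular_domain B (gamma j t),
    forall p, B j p -> winding_number (gamma j) p = 1 &
    forall k p, k <> j -> B k p -> winding_number (gamma j) p = 0].

(* [period j omega c] says that c = Per_j omega, where Per_j is the extension by
   continuity to L^{2,1}_c(Omega) of the curve integral over gamma j on smooth
   forms: its graph is the closure of the graph of the latter. *)
Definition period (j : J) (omega : one_form R) (c : R) : Prop :=
  exists W : nat -> one_form R,
    [/\ forall n, L21c (regular_domain B) (W n) /\
                  smooth_form (regular_domain B) (W n),
        form_norm (regular_domain B) (W n \- omega) @[n --> \oo] --> (0 : R) &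
        line_integral (gamma j) (W n) @[n --> \oo] --> c].

Definition l2_sqnorm (a : J -> R) : \bar R := \esum_(j in [set: J]) (a j ^+ 2)%:E.

Definition l2_norm (a : J -> R) : R := Num.sqrt (fine (l2_sqnorm a)).

Definition interpolation_constant (C : R) : Prop :=
  0 <= C /\
  forall a : J -> R, (l2_sqnorm a < +oo)%E ->
    exists omega, [/\ L21c (regular_domain B) omega,
      forall j, period j omega (a j) &
      form_norm (regular_domain B) omega <= C * l2_norm a].

Definition interpolation_property : Prop := exists C, interpolation_constant C.

(* The least interpolation constant (the infimum is attained as soon as the
   interpolation property holds); irrelevant otherwise. *)
Definition C_I : R := inf [set C | interpolation_constant C].

End Interpolation.

(* Main.v *)
Require Import Defs.
From mathcomp Require Import all_boot all_order all_algebra.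
From mathcomp Require Import all_classical all_reals all_analysis.
From mathcomp Require Import complex measurable_realfun ring lra.
Set Implicit Arguments.
Unset Strict Implicit.
Unset Printing Implicit Defensive.
Import Order.TTheory GRing.Theory Num.Theory.
Import numFieldNormedType.Exports.
Local Open Scope classical_set_scope.
Local Open Scope ring_scope.

(* For points p and q, the form (d arg (z - p) - d arg (z - q)) / (2 pi) becomes compactly
   supported after subtracting the differential of its cut-off primitive, and it is
   O(1 / |z - p| + 1 / |z - q|).  Averaging p and q over equally spread points of two
   neighbouring holes B j and B k gives a closed form with periods 1 around B j and -1 around
   B k; its energy is controlled by S, because the averages of 1 / |z - p| are square
   integrable although their terms are not.  For a hole comparable in size with its distance
   to the circle, one takes q outside the disk instead.

   Sum these forms along a path of the graph from B j until a hole is met whose diameter is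
   comparable with gap(c j), the distance of c j in B j to the circle; the path stays near c j
   until then.  This gives tau j with periods delta_(jk), supported in |z - c j| <= 24 gap(c j),
   with energy at most E / sqrt(gap(c j)) for the weight gap^(-1/2).  Local finiteness bounds
   the sum of gap(c j)^(-1/2) over the tau j alive at z by const gap(z)^(-1/2), and
   Cauchy-Schwarz gives
   |sum_j a j tau j|^2 <= const gap^(-1/2) sum_j (a j)^2 gap(c j)^(1/2) |tau j|^2. *)

(** The obstacle is the overlap of scales. The forms alive at z come from all scales between a
    fraction of gap(z) and 1, boundedly many for each scale, so their number may grow like log(1 /
    gap(z)), and plain Cauchy-Schwarz would lose this factor. The weight turns the sum over scales
    into a geometric one. Its exponent 1/2 is one choice in (0, 1): positive for the geometric
    decay, below 1 for integrability up to the circle, which the support of a form with a pole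
    outside the disk may reach. Holes have arbitrary shapes. What spreads the poles is
    connectedness: a hole has points at every distance from one of its points up to a fraction of
    its diameter. Weighted Cauchy-Schwarz then trades |z - p|^(-2), not integrable in the plane, for
    |z - p|^(-3/2), the other factor being a Riemann sum of |t|^(-1/2). The bound depends only on
    the ratio of support size to hole size; it is free of the scale and of the number of poles, over
    which there is no control. Singular integrands are shifted by a positive parameter to stay
    continuous, with bounds uniform in it; for the weight this is (gap + eta)^(-1/2). *)

(** * Differentiability of finite order on a set of the plane *)

Section Calculus.
Context {R : realType}.
Implicit Types (V : set (plane R)) (f g : plane R -> R) (z : plane R).

Lemma near_eq_differentiable f g z : {near z, f =1 g} ->
  differentiable f z -> differentiable g z.
Proof.
move=> fg.
have fgz := nbhs_singleton fg.
move=> /diff_locallyP[cdf dfE].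
have fg0 : \forall h \near (0 : plane R), f (h + z) = g (h + z).
  move: fg; rewrite (near_shift (0 : plane R)) => fg.
  by apply: filterS fg => h /=; rewrite subr0.
have gE : g \o shift z = cst (g z) + 'd f z +o_ (0 : plane R) id.
  apply/eqaddoP => _/posnumP[e].
  move/eqaddoP: dfE => /(_ _ (gt0 e)) dfE.
  near=> h.
  have -> : (g \o shift z - (cst (g z) + 'd f z)) h =
            (f \o shift z - (cst (f z) + 'd f z)) h.
    rewrite !fctE /= fgz; congr (_ - _).
    by apply/esym; near: h.
  by near: h.
apply/diff_locallyP; have dE := diff_unique cdf gE.
by rewrite dE.
Unshelve. all: by end_near. Qed.

Lemma derive_comp1 (phi : R -> R) f z (v : plane R) :
  differentiable f z -> derivable phi (f z) 1 ->
  'D_v (phi \o f) z = derive1 phi (f z) * 'D_v f z.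
Proof.
move=> df dphi; have dphi' := (derivable1_diffP _ _).1 dphi.
rewrite deriveE; last exact: differentiable_comp.
by rewrite diff_comp//= deriv1E//= deriveE// mulrC.
Qed.

Lemma partial_ext f g V z : open V -> V z -> (forall w, V w -> f w = g w) ->
  (partial_x f z = partial_x g z) * (partial_y f z = partial_y g z).
Proof.
move=> oV Vz fg; have nfg : {near z, f =1 g}.
  by apply: filterS (open_nbhs_nbhs (conj oV Vz)) => w; exact: fg.
by split; apply: near_eq_derive => //; rewrite xpair_eqE oner_eq0 ?andbF.
Qed.

(** The recursion strips the innermost derivative, whereas a list in [iter_partial] has the
    outermost one at its head. In this form, products and compositions are handled by induction on
    the order. Order 0 means differentiable, not merely continuous. *)
Fixpoint Ck n V f : Prop := (forall z, V z -> differentiable f z) /\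
  (if n is n'.+1 then Ck n' V (partial_x f) /\ Ck n' V (partial_y f) else True).

Lemma iter_partial_rcons (s : seq bool) b f :
  iter_partial (rcons s b) f = iter_partial s (if b then partial_y f else partial_x f).
Proof. by rewrite /iter_partial -cats1 foldr_cat. Qed.

Lemma CkP V f : smooth_on V f <-> forall n, Ck n V f.
Proof.
split=> [sf n|Cf s].
  elim: n f sf => [|n IH] f sf /=; first by split => // z Vz; exact: (sf [::]).
  split; first by move=> z Vz; exact: (sf [::]).
  split; apply: IH => s z Vz.
    by have := sf (rcons s false) z Vz; rewrite iter_partial_rcons.
  by have := sf (rcons s true) z Vz; rewrite iter_partial_rcons.
move: (Cf (size s)).
elim/last_ind: s f {Cf} => [|s b IH] f /=; first by move=> [+ _] z Vz; apply.
rewrite size_rcons /= => -[_ [Cx Cy]] z Vz.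
by rewrite iter_partial_rcons; apply: IH => //; case: b.
Qed.

Lemma Ck_diff n V f z : Ck n V f -> V z -> differentiable f z.
Proof. by case: n => [|n] [+ _]; apply. Qed.

Lemma Ck_pred n V f : Ck n.+1 V f -> Ck n V f.
Proof.
elim: n f => [|n IH] f [df [Cx Cy]]; first exact: (conj df I).
exact: (conj df (conj (IH _ Cx) (IH _ Cy))).
Qed.

Lemma Ck_ext n V f g : open V -> (forall z, V z -> f z = g z) -> Ck n V f -> Ck n V g.
Proof.
move=> oV; elim: n f g => [|n IH] f g fg.
  move=> [df _]; split => // z Vz; apply: near_eq_differentiable (df _ Vz).
  by apply: filterS (open_nbhs_nbhs (conj oV Vz)) => w; exact: fg.
move=> [df [Cx Cy]]; split.
  move=> z Vz; apply: near_eq_differentiable (df _ Vz).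
  by apply: filterS (open_nbhs_nbhs (conj oV Vz)) => w; exact: fg.
split; [apply: IH Cx|apply: IH Cy] => z Vz; by rewrite (partial_ext oV Vz fg).
Qed.

Lemma Ck_sub n V V' f : V `<=` V' -> Ck n V' f -> Ck n V f.
Proof.
move=> VV'; move=> Cf; have dV (h : plane R -> R) : (forall z, V' z -> differentiable h z) ->
  forall z, V z -> differentiable h z by move=> dh z /VV'; exact: dh.
elim: n f Cf => [|n IH] f [df Cf]; first exact: (conj (dV _ df) I).
case: Cf => Cx Cy; exact: (conj (dV _ df) (conj (IH _ Cx) (IH _ Cy))).
Qed.

(** [Ck] is a conjunction of conditions at single points, so a different set may be used around each
    point. This glues functions given by different formulas on different regions. *)
Lemma Ck_cover n V (A : plane R -> set (plane R)) f :
  (forall z, V z -> A z z /\ Ck n (A z) f) -> Ck n V f.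
Proof.
elim: n f => [|n IH] f VA.
  by split => // z /VA[Az [+ _]]; exact.
split; first by move=> z /VA[Az [+ _]]; exact.
by split; apply: IH => z /VA[Az [_ []]].
Qed.

Lemma partialD f g z : differentiable f z -> differentiable g z ->
  (partial_x (f \+ g) z = partial_x f z + partial_x g z) *
  (partial_y (f \+ g) z = partial_y f z + partial_y g z).
Proof. by move=> df dg; split; apply: deriveD; exact: diff_derivable. Qed.

Lemma partialM f g z : differentiable f z -> differentiable g z ->
  (partial_x (f \* g) z = f z * partial_x g z + g z * partial_x f z) *
  (partial_y (f \* g) z = f z * partial_y g z + g z * partial_y f z).
Proof. by move=> df dg; split; apply: deriveM; exact: diff_derivable. Qed.

Lemma Ck_cst n V (c : R) : Ck n V (fun=> c).
Proof.
elim: n c => [|n IH] c /=; first by split => // z _; exact: differentiable_cst.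
split; first by move=> z _; exact: differentiable_cst.
have p0 v : 'D_v (fun=> c : R) = (fun=> 0) :> (plane R -> R).
  by apply/funext => z; exact: derive_cst.
by rewrite /partial_x /partial_y !p0; split; exact: IH.
Qed.

Lemma CkD n V f g : open V -> Ck n V f -> Ck n V g -> Ck n V (f \+ g).
Proof.
move=> oV; elim: n f g => [|n IH] f g [df Cf] [dg Cg];
  (split; first by move=> z Vz; apply: differentiableD; [exact: df|exact: dg]) => //.
have [fx fy] := Cf; have [gx gy] := Cg.
split; [apply: Ck_ext (IH _ _ fx gx)|apply: Ck_ext (IH _ _ fy gy)] => // z Vz;
  by rewrite partialD//; [exact: df|exact: dg].
Qed.

Lemma CkM n V f g : open V -> Ck n V f -> Ck n V g -> Ck n V (f \* g).
Proof.
move=> oV; elim: n f g => [|n IH] f g.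
  by move=> [df _] [dg _]; split => // z Vz; apply: differentiableM; [exact: df|exact: dg].
move=> Cf Cg; have [df [fx fy]] := Cf; have [dg [gx gy]] := Cg.
have [Cf' Cg'] := (Ck_pred Cf, Ck_pred Cg).
split; first by move=> z Vz; apply: differentiableM; [exact: df|exact: dg].
split.
  apply: Ck_ext (CkD oV (IH _ _ Cf' gx) (IH _ _ Cg' fx)) => // z Vz.
  by rewrite partialM//; [exact: df|exact: dg].
apply: Ck_ext (CkD oV (IH _ _ Cf' gy) (IH _ _ Cg' fy)) => // z Vz.
by rewrite partialM//; [exact: df|exact: dg].
Qed.

Lemma CkN n V f : open V -> Ck n V f -> Ck n V (fun z => - f z).
Proof.
move=> oV Cf; apply: Ck_ext (CkM oV (Ck_cst n V (-1)) Cf) => // z _.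
by rewrite /= mulN1r.
Qed.

Lemma CkB n V f g : open V -> Ck n V f -> Ck n V g -> Ck n V (f \- g).
Proof. by move=> oV Cf Cg; apply: CkD => //; exact: CkN. Qed.

Lemma CkZ n V c f : open V -> Ck n V f -> Ck n V (fun z => c * f z).
Proof. by move=> oV Cf; exact: (CkM oV (Ck_cst n V c) Cf). Qed.

Lemma plane_linear (L : {linear plane R -> R}) z (v : plane R) : continuous L ->
  is_derive z v L (L v) /\ differentiable L z.
Proof.
move=> cL; have dL : differentiable L z by exact: linear_differentiable.
split => //; apply: DeriveDef; first exact: diff_derivable.
by rewrite deriveE// diff_lin.
Qed.

Lemma derive_fst z (v : plane R) : is_derive z v (fst : plane R -> R) v.1.
Proof. by apply: (plane_linear (L := fst) z v _).1 => w; exact: cvg_fst. Qed.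

Lemma derive_snd z (v : plane R) : is_derive z v (snd : plane R -> R) v.2.
Proof. by apply: (plane_linear (L := snd) z v _).1 => w; exact: cvg_snd. Qed.

Lemma differentiable_fst z : differentiable (fst : plane R -> R) z.
Proof. by apply: (plane_linear (L := fst) z 0 _).2 => w; exact: cvg_fst. Qed.

Lemma differentiable_snd z : differentiable (snd : plane R -> R) z.
Proof. by apply: (plane_linear (L := snd) z 0 _).2 => w; exact: cvg_snd. Qed.

Lemma Ck_fst n V : open V -> Ck n V fst.
Proof.
move=> oV; case: n => [|n]; split=> //; try by move=> z _; exact: differentiable_fst.
split; [apply: Ck_ext (Ck_cst n V 1)|apply: Ck_ext (Ck_cst n V 0)] => // z _;
 by rewrite /partial_x /partial_y; apply/esym; apply: (@derive_val _ _ _ _ _ _ _ (derive_fst _ _)).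
Qed.

Lemma Ck_snd n V : open V -> Ck n V snd.
Proof.
move=> oV; case: n => [|n]; split=> //; try by move=> z _; exact: differentiable_snd.
split; [apply: Ck_ext (Ck_cst n V 0)|apply: Ck_ext (Ck_cst n V 1)] => // z _;
 by rewrite /partial_x /partial_y; apply/esym; apply: (@derive_val _ _ _ _ _ _ _ (derive_snd _ _)).
Qed.

(** By the chain rule the partials of [phi \o f] are those of [f] times [dphi \o f]. One order is
    gained once [dphi \o f] is known at order [n], which closes the induction when [dphi] is built
    from [phi] itself or from simpler functions. *)
Lemma Ck_comp_step n V f (phi dphi : R -> R) : open V ->
  (forall z, V z -> is_derive (f z) 1 phi (dphi (f z))) ->
  Ck n.+1 V f -> Ck n V (dphi \o f) -> Ck n.+1 V (phi \o f).
Proof.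
move=> oV dp Cf Cd; have [df [fx fy]] := Cf; split.
  move=> z Vz; apply: differentiable_comp; first exact: df.
  by apply/derivable1_diffP; case: (dp z Vz).
split; [apply: Ck_ext (CkM oV Cd fx)|apply: Ck_ext (CkM oV Cd fy)] => // z Vz;
  have [dpz dpE] := dp z Vz;
  by rewrite /= /partial_x /partial_y derive_comp1 ?derive1E ?dpE//; exact: df.
Qed.

Lemma Ck_comp0 V f (phi dphi : R -> R) :
  (forall z, V z -> is_derive (f z) 1 phi (dphi (f z))) ->
  Ck 0 V f -> Ck 0 V (phi \o f).
Proof.
move=> dp [df _]; split=> // z Vz; apply: differentiable_comp; first exact: df.
by apply/derivable1_diffP; case: (dp z Vz).
Qed.

Lemma CkV n V f : open V -> (forall z, V z -> f z != 0) -> Ck n V f ->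
  Ck n V (fun z => (f z)^-1).
Proof.
move=> oV f0.
have dp z : V z -> is_derive (f z) 1 GRing.inv ((fun x => - (x^-1 * x^-1)) (f z) : R).
  move=> Vz; have d1 := is_derive_id (f z) (1 : R).
  apply: DeriveDef; first exact/derivable1_diffP/differentiable_Rinv/f0.
  by rewrite (@deriveV _ _ id) ?f0// derive_id /= -exprVn expr2 scaleNr -[X in - X]mulrA mulr1.
elim: n f f0 dp => [|n IH] f f0 dp Cf; first exact: (@Ck_comp0 V f _ (fun x => - (x^-1 * x^-1)) dp).
apply: (@Ck_comp_step n V f _ (fun x => - (x^-1 * x^-1)) oV dp Cf).
have CI : Ck n V (fun z => (f z)^-1) by apply: IH => //; exact: Ck_pred.
have CN := CkN oV (CkM oV CI CI).
exact: CN.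
Qed.

Lemma Ck_atan n V f : open V -> Ck n V f -> Ck n V (fun z => atan (f z)).
Proof.
move=> oV; have dp z : V z -> is_derive (f z) 1 atan ((fun x => (1 + x ^+ 2)^-1) (f z) : R).
  by move=> _; exact: is_derive1_atan.
case: n => [|n] Cf; first exact: (@Ck_comp0 V f _ (fun x => (1 + x ^+ 2)^-1) dp).
apply: (@Ck_comp_step n V f _ (fun x => (1 + x ^+ 2)^-1) oV dp Cf).
have Cf' := Ck_pred Cf.
apply: (CkV oV _ (CkD oV (Ck_cst n V 1) (CkM oV Cf' Cf'))) => z _.
by rewrite gt_eqF// ltr_pwDl// sqr_ge0.
Qed.

End Calculus.

(** * A family of flat functions that is closed under differentiation *)

Section Bump.
Context {R : realType}.
Implicit Types (V : set (plane R)) (f g : plane R -> R) (z : plane R) (x : R).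

(** The classical flat function is the case [k = 0]. The negative powers are included because the
    derivative of [flat k] combines [flat k.+1] and [flat k.+2]. *)
Definition flat k x : R := if 0 < x then x ^- k * expR (- x^-1) else 0.

Lemma flat_ge0 k x : 0 <= flat k x.
Proof.
rewrite /flat; case: ifPn => // x0.
by rewrite mulr_ge0 ?expR_ge0// invr_ge0 exprn_ge0// ltW.
Qed.

(** This is the [k]-th power of [y / k <= expR (y / k)]. *)
Lemma expR_pow_le (k : nat) (y : R) : 0 <= y -> y ^+ k * expR (- y) <= k%:R ^+ k.
Proof.
move=> y0; case: k => [|k]; first by rewrite !expr0 mul1r -expR0 ler_expR oppr_le0.
rewrite expRN ler_pdivrMr ?expR_gt0//.
have -> : expR y = expR (y / k.+1%:R) ^+ k.+1.
  by rewrite -expRM_natl; congr expR; rewrite mulrCA divff ?mulr1// pnatr_eq0.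
rewrite -exprMn lerXn2r ?nnegrE ?mulr_ge0 ?expR_ge0//.
rewrite mulrC -ler_pdivrMr ?ltr0n//.
by apply: le_trans (expR_ge1Dx _); rewrite lerDr.
Qed.

Lemma flat_le k x : flat k x <= k%:R ^+ k.
Proof.
rewrite /flat; case: ifPn => x0; last by rewrite exprn_ge0.
by rewrite -exprVn; apply: expR_pow_le; rewrite invr_ge0 ltW.
Qed.

Lemma flat_lin k x : `|flat k x| <= k.+1%:R ^+ k.+1 * `|x|.
Proof.
rewrite ger0_norm ?flat_ge0//; rewrite /flat; case: ifPn => x0.
  rewrite gtr0_norm// -ler_pdivrMr// mulrC mulrA -invfM -exprS -exprVn.
  by apply: expR_pow_le; rewrite invr_ge0 ltW.
by rewrite mulr_ge0// exprn_ge0.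
Qed.

Lemma flat_derive k x : is_derive x 1 (flat k) (- k%:R * flat k.+1 x + flat k.+2 x).
Proof.
have [x0|x0|->] := ltgtP x 0.
- apply: (@near_eq_is_derive _ _ _ (fun=> 0)).
    near=> y; rewrite /flat ltNge ltW//; near: y.
    exact: lt_nbhsl.
  by rewrite /flat ltNge ltW//= mulr0 addr0; exact: is_derive_cst.
- apply: (@near_eq_is_derive R R R (fun y : R => y ^- k * expR (- y^-1))).
    near=> y; rewrite /flat ifT//; near: y.
    exact: lt_nbhsr.
  rewrite /flat x0.
  have dV : is_derive x 1 (fun y : R => y^-1) (- x ^- 2).
    apply: DeriveDef; first exact/derivable1_diffP/differentiable_Rinv/lt0r_neq0.
    by rewrite (@deriveV _ _ id) ?lt0r_neq0// derive_id scaler1.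
  have dk : is_derive x 1 (fun y : R => y ^- k) (k%:R * x^-1 ^+ k.-1 * (- x ^- 2)).
    have := is_deriveX k dV; rewrite (_ : (fun y : R => y^-1) ^+ k = (fun y => y ^- k)).
      by move/is_derive_eq; apply.
    by apply/funext => y; rewrite exprfctE exprVn.
  have de : is_derive x 1 (fun y => expR (- y^-1)) (expR (- x^-1) * x ^- 2).
    have dN : is_derive x 1 (fun y : R => - y^-1) (x ^- 2).
      by have := is_deriveN dV; rewrite opprK.
    exact: (@is_derive1_comp _ expR (fun y : R => - y^-1)).
  have := is_deriveM dk de; move/is_derive_eq; apply.
  rewrite /GRing.scale/= -!exprVn; set y := x^-1; set e := expR _.
  by case: k {dk} => [|k] /=; rewrite ?exprS; ring.
(* At 0 the difference quotient equals [flat k.+1 h], which tends to 0 by [flat_lin]. *)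
- have E : (fun h : R => h^-1 *: ((flat k \o shift 0) (h *: 1) - flat k 0)) @ 0^' --> 0.
    have F : (fun h : R => flat k.+1 h) @ 0^' --> 0.
      apply/cvgrPdist_le => e e0; near=> h; rewrite sub0r normrN.
      apply: le_trans (flat_lin _ _) _; rewrite mulrC -ler_pdivlMr ?exprn_gt0//.
      near: h; apply: dnbhs0_le; rewrite divr_gt0// exprn_gt0//.
    apply: cvg_trans F; apply: near_eq_cvg; near=> h.
    rewrite /= addr0 /flat ltxx subr0 /GRing.scale/= mulr1; case: ifPn => h0; last by rewrite mulr0.
    by rewrite mulrA -invfM -exprS.
  apply: DeriveDef; first by apply/cvg_ex; exists 0.
  by rewrite {2 3}/flat ltxx mulr0 addr0; apply: cvg_lim E.
Unshelve. all: by end_near. Qed.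

Lemma Ck_flat n k V f : open V -> Ck n V f -> Ck n V (fun z => flat k (f z)).
Proof.
move=> oV; elim: n k f => [|n IH] k f Cf.
  apply: (@Ck_comp0 R V f (flat k) (fun x => - k%:R * flat k.+1 x + flat k.+2 x)) => // z _.
  exact: flat_derive.
apply: (@Ck_comp_step R n V f (flat k) (fun x => - k%:R * flat k.+1 x + flat k.+2 x)) => //.
  by move=> z _; exact: flat_derive.
have Cf' := Ck_pred Cf.
exact: (CkD oV (CkZ (- k%:R) oV (IH _ _ Cf')) (IH _ _ Cf')).
Qed.

End Bump.

(** * Partial derivatives along lines and symmetry of mixed partials *)

Section Slices.
Context {R : realType}.
Implicit Types (f g : plane R -> R).

Lemma slice_x f (x y : R) : differentiable f (x, y) ->
  is_derive x 1 (fun s => f (s, y)) (partial_x f (x, y)).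
Proof.
move=> df.
have E : (fun h : R => h^-1 *: (((fun s => f (s, y)) \o shift x) (h *: 1) - f (x, y))) =
  (fun h : R => h^-1 *: ((f \o shift (x, y)) (h *: (1, 0)) - f (x, y))).
  by apply/funext => h /=; congr (_ *: (f _ - _)); congr pair; rewrite /= ?scaler0 ?add0r.
apply: DeriveDef; first by rewrite /derivable E; exact: diff_derivable.
by rewrite /derive E.
Qed.

Lemma slice_y f (x y : R) : differentiable f (x, y) ->
  is_derive y 1 (fun s => f (x, s)) (partial_y f (x, y)).
Proof.
move=> df.
have E : (fun h : R => h^-1 *: (((fun s => f (x, s)) \o shift y) (h *: 1) - f (x, y))) =
  (fun h : R => h^-1 *: ((f \o shift (x, y)) (h *: (0, 1)) - f (x, y))).
  by apply/funext => h /=; congr (_ *: (f _ - _)); congr pair; rewrite /= ?scaler0 ?add0r.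
apply: DeriveDef; first by rewrite /derivable E; exact: diff_derivable.
by rewrite /derive E.
Qed.

Lemma diff_partials f z (v : plane R) : differentiable f z ->
  'd f z v = v.1 * partial_x f z + v.2 * partial_y f z.
Proof.
move=> df; rewrite /partial_x /partial_y !deriveE//.
have -> : v = v.1 *: (1, 0) + v.2 *: (0, 1).
  by case: v => v1 v2; congr pair; rewrite /= ?scaler0 ?addr0 ?add0r /GRing.scale/= mulr1.
by rewrite linearD !linearZ /= /GRing.scale/= !(mulr0, mulr1, addr0, add0r).
Qed.

Lemma diff_eps f z (e : R) : differentiable f z -> 0 < e ->
  exists2 d, 0 < d & forall h : plane R, `|h| < d ->
   `|f (h + z) - f z - (h.1 * partial_x f z + h.2 * partial_y f z)| <= e * `|h|.
Proof.
move=> df e0; have /diff_locallyP[_ /eqaddoP/(_ _ e0)] := df.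
move=> /nbhs_ballP[d /= d0 hd]; exists d => // h hh.
rewrite -diff_partials//; have := hd h; rewrite -ball_normE /= sub0r normrN => /(_ hh).
by rewrite !fctE /= opprD addrA.
Qed.

(** The mean value theorem for [F x (b + h) - F x b] in [x] reduces the second difference to a
    difference of two values of [G]. Expanding both to first order at [(a, b)] cancels the [al]
    terms and leaves [h * be]. *)
Lemma second_diff (F G : R -> R -> R) (a b al be r e : R) :
  0 < r -> 0 < e ->
  (forall x y, `|x - a| < r -> `|y - b| < r -> is_derive x 1 (F ^~ y) (G x y)) ->
  (forall x y m, `|x - a| < r -> `|y - b| < r -> `|x - a| <= m -> `|y - b| <= m ->
    `|G x y - G a b - ((x - a) * al + (y - b) * be)| <= e * m) ->
  forall h, 0 < h < r ->
    `|F (a + h) (b + h) - F (a + h) b - F a (b + h) + F a b - h ^+ 2 * be| <= e * 2 * h ^+ 2.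
Proof.
move=> r0 e0 dF GE h /andP[h0 hr].
pose phi x := F x (b + h) - F x b.
have bh : `|b + h - b| < r by rewrite addrAC subrr add0r gtr0_norm.
have bb : `|b - b| < r by rewrite subrr normr0.
have xr x : x \in `[a, a + h] -> `|x - a| < r.
  rewrite in_itv /= => /andP[ax xh]; rewrite ger0_norm ?subr_ge0//; lra.
have dphi x : x \in `[a, a + h] -> is_derive x 1 phi (G x (b + h) - G x b).
  by move=> xi; apply: is_deriveB; apply: dF => //; exact: xr.
have aah : a < a + h by rewrite ltrDl.
have dphi' x : x \in `]a, a + h[ -> is_derive x 1 phi (G x (b + h) - G x b).
  by move=> xi; apply: dphi; exact: subset_itv_oo_cc.
have cphi : {within `[a, a + h], continuous phi}.
  by apply: derivable_within_continuous => y yi; apply: ex_derive; exact: dphi yi.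
have [x xi E] := MVT aah dphi' cphi.
have {}xi := subset_itv_oo_cc xi.
have -> : F (a + h) (b + h) - F (a + h) b - F a (b + h) + F a b = phi (a + h) - phi a.
  by rewrite /phi; ring.
have xh : `|x - a| <= h.
  by move: xi; rewrite in_itv /= => /andP[ax xh]; rewrite ger0_norm ?subr_ge0//; lra.
have bhE : b + h - b = h by ring.
have g1 : `|G x (b + h) - G a b - ((x - a) * al + h * be)| <= e * h.
  by have := GE x (b + h) h (xr _ xi) bh xh; rewrite bhE (gtr0_norm h0); apply.
have g2 : `|G x b - G a b - (x - a) * al| <= e * h.
  by have := GE x b h (xr _ xi) bb xh; rewrite subrr normr0 mul0r addr0; apply; exact: ltW.
rewrite E.
have -> : (G x (b + h) - G x b) * (a + h - a) - h ^+ 2 * be =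
  h * ((G x (b + h) - G a b - ((x - a) * al + h * be)) - (G x b - G a b - (x - a) * al)) by ring.
rewrite normrM (gtr0_norm h0) [leRHS](_ : _ = h * (e * h + e * h)); last by ring.
rewrite ler_pM2l//; apply: le_trans (ler_normB _ _) _; exact: lerD.
Qed.

(* Schwarz: both mixed derivatives are limits of the same second difference quotient. *)
Lemma mixed_partials V f z : open V -> V z -> (forall w, V w -> differentiable f w) ->
  differentiable (partial_x f) z -> differentiable (partial_y f) z ->
  partial_y (partial_x f) z = partial_x (partial_y f) z.
Proof.
move: z => [a b] oV Vz df dx dy; apply/eqP; rewrite -subr_eq0 -normr_le0.
apply/ler_addgt0Pl => e e0; rewrite addr0.
(* Each of the two second-difference estimates below has error [2 * e'] per unit of [h ^+ 2]. *)
pose e' := e / 4; have e'0 : 0 < e' by rewrite divr_gt0.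
have [r0 r00 Vr] : exists2 r, 0 < r & forall x y, `|x - a| < r -> `|y - b| < r -> V (x, y).
  have /nbhs_ballP[r /= r0 rV] := open_nbhs_nbhs (conj oV Vz).
  exists r => // x y xa yb; apply: rV; rewrite -ball_normE /= prod_normE /=.
  by rewrite gt_max /= ![`|_ - x|]distrC ![`|_ - y|]distrC xa yb.
have [d1 d10 D1] := diff_eps dx e'0; have [d2 d20 D2] := diff_eps dy e'0.
pose r := Num.min r0 (Num.min d1 d2).
have rP : 0 < r by rewrite !lt_min r00 d10.
have lr x : x < r -> [/\ x < r0, x < d1 & x < d2].
  by rewrite !lt_min => /and3P[].
have H1 := @second_diff (fun x y => f (x, y)) (fun x y => partial_x f (x, y))
  a b (partial_x (partial_x f) (a, b)) (partial_y (partial_x f) (a, b)) r e' rP e'0.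
(* With the roles of the variables exchanged, the same second difference approximates the other
   mixed derivative. *)
have H2 := @second_diff (fun y x => f (x, y)) (fun y x => partial_y f (x, y))
  b a (partial_y (partial_y f) (a, b)) (partial_x (partial_y f) (a, b)) r e' rP e'0.
have h0 : 0 < r / 2 < r by apply/andP; split; lra.
have sh x y : (x - a, y - b) + (a, b) = (x, y) :> plane R.
  by rewrite -[RHS](subrK (a, b)).
have L1 : `|f (a + r / 2, b + r / 2) - f (a + r / 2, b) - f (a, b + r / 2) + f (a, b) -
    (r / 2) ^+ 2 * partial_y (partial_x f) (a, b)| <= e' * 2 * (r / 2) ^+ 2.
  apply: H1 => // [x y /lr[xr xd1 xd2] /lr[yr yd1 yd2]|x y m].
    by apply: slice_x; apply: df; exact: Vr.
  move=> /lr[xr xd1 xd2] /lr[yr yd1 yd2] xm ym.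
  have hm : `|(x - a, y - b) : plane R| <= m by rewrite prod_normE /= ge_max xm ym.
  have hd : `|(x - a, y - b) : plane R| < d1 by rewrite prod_normE /= gt_max xd1 yd1.
  by have := D1 _ hd; rewrite sh => D; apply: le_trans D _; rewrite ler_pM2l.
have L2 : `|f (a + r / 2, b + r / 2) - f (a, b + r / 2) - f (a + r / 2, b) + f (a, b) -
    (r / 2) ^+ 2 * partial_x (partial_y f) (a, b)| <= e' * 2 * (r / 2) ^+ 2.
  apply: H2 => // [y x /lr[yr yd1 yd2] /lr[xr xd1 xd2]|y x m].
    by apply: slice_y; apply: df; exact: Vr.
  move=> /lr[yr yd1 yd2] /lr[xr xd1 xd2] ym xm.
  have hm : `|(x - a, y - b) : plane R| <= m by rewrite prod_normE /= ge_max xm ym.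
  have hd : `|(x - a, y - b) : plane R| < d2 by rewrite prod_normE /= gt_max xd2 yd2.
  have := D2 _ hd; rewrite sh /= => D.
  rewrite [(y - b) * _ + _]addrC; apply: le_trans D _.
  by rewrite ler_pM2l.
have h2 : 0 < (r / 2) ^+ 2 by rewrite exprn_gt0// divr_gt0.
have eE : e = e' * 2 + e' * 2 by rewrite /e'; field.
rewrite -(ler_pM2l h2) -[X in X * `|_|](gtr0_norm h2) -normrM eE.
move: L1 L2; set P := partial_y _ _; set Q := partial_x _ _.
set u1 := f (_ + _, _ + _); set u2 := f (_ + _, b); set u3 := f (a, _ + _); set u4 := f (a, b).
set H := (r / 2) ^+ 2; move: P Q u1 u2 u3 u4 H => P Q u1 u2 u3 u4 H L1 L2.
have -> : H * (P - Q) = (u1 - u3 - u2 + u4 - H * Q) - (u1 - u2 - u3 + u4 - H * P) by ring.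
have -> : H * (e' * 2 + e' * 2) = e' * 2 * H + e' * 2 * H by ring.
by apply: le_trans (ler_normB _ _) _; exact: lerD.
Qed.

End Slices.

(** * The angular form, and the angle between two poles as a local primitive *)

Section Kernel.
Context {R : realType}.
Implicit Types (V : set (plane R)) (f g : plane R -> R) (z p q c : plane R) (r : R).

(** The Euclidean square, while [|z|] is the sup norm of the library; the factors 2 in later
    estimates come from comparing them. *)
Definition nsq z : R := z.1 ^+ 2 + z.2 ^+ 2.

Lemma plane_norm z : `|z| = Num.max `|z.1| `|z.2|.
Proof. by rewrite prod_normE. Qed.

Lemma norm1_le z : `|z.1| <= `|z|.
Proof. by rewrite plane_norm le_max lexx. Qed.

Lemma norm2_le z : `|z.2| <= `|z|.
Proof. by rewrite plane_norm le_max lexx orbT. Qed.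

Lemma sqr_norm (x : R) : `|x| ^+ 2 = x ^+ 2.
Proof. by rewrite real_normK// num_real. Qed.

Lemma nsq_ge z : `|z| ^+ 2 <= nsq z.
Proof.
rewrite plane_norm /nsq; case: (leP `|z.1| `|z.2|) => _;
 by rewrite sqr_norm ?lerDl ?lerDr sqr_ge0.
Qed.

Lemma nsq_le z : nsq z <= 2 * `|z| ^+ 2.
Proof.
rewrite /nsq -[X in X + _]sqr_norm -[X in _ + X]sqr_norm.
have := norm1_le z; have := norm2_le z => h2 h1.
have : `|z.1| ^+ 2 <= `|z| ^+ 2 by rewrite lerXn2r ?nnegrE.
have : `|z.2| ^+ 2 <= `|z| ^+ 2 by rewrite lerXn2r ?nnegrE.
lra.
Qed.

Lemma nsq_gt0 z : z != 0 -> 0 < nsq z.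
Proof. by move=> z0; apply: lt_le_trans (nsq_ge z); rewrite exprn_gt0// normr_gt0. Qed.

Lemma open_gt0 f : continuous f -> open [set z | 0 < f z].
Proof. by move=> cf; apply: (@open_comp _ _ f [set x | 0 < x]) => [z _|]; [exact: cf|exact: open_gt]. Qed.

Lemma Ck_continuous n f : Ck n setT f -> continuous f.
Proof. by move=> Cf z; apply: differentiable_continuous; exact: (Ck_diff Cf). Qed.

Lemma Ck_nsq n c : Ck n setT (fun z => nsq (z - c)).
Proof.
have oT : open [set: plane R] by exact: openT.
have C1 := CkB oT (Ck_fst n oT) (Ck_cst n setT c.1).
have C2 := CkB oT (Ck_snd n oT) (Ck_cst n setT c.2).
exact: (CkD oT (CkM oT C1 C1) (CkM oT C2 C2)).
Qed.

Lemma is_deriveV' f z (v : plane R) df : f z != 0 -> is_derive z v f df ->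
  is_derive z v (fun w => (f w)^-1) (- (f z) ^- 2 * df).
Proof.
move=> fz [dvf <-]; apply: DeriveDef; first exact: derivableV.
by rewrite deriveV.
Qed.

Lemma is_derive_X z (v : plane R) (a : R) : is_derive z v (fun w => w.1 - a) v.1.
Proof.
have d1 := derive_fst z v.
by have := is_deriveB d1 (is_derive_cst a z v); rewrite subr0.
Qed.

Lemma is_derive_Y z (v : plane R) (a : R) : is_derive z v (fun w => w.2 - a) v.2.
Proof.
have d1 := derive_snd z v.
by have := is_deriveB d1 (is_derive_cst a z v); rewrite subr0.
Qed.

Lemma is_derive_mul f g z (v : plane R) df dg : is_derive z v f df -> is_derive z v g dg ->
  is_derive z v (fun w => f w * g w) (f z * dg + g z * df).
Proof. by move=> Df Dg; exact: is_deriveM. Qed.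

Lemma is_derive_opp f z (v : plane R) df : is_derive z v f df ->
  is_derive z v (fun w => - f w) (- df).
Proof. by move=> Df; exact: is_deriveN. Qed.

Lemma pi_neq0 : pi != 0 :> R. Proof. by rewrite gt_eqF ?pi_gt0. Qed.

Definition punct p : set (plane R) := [set z | 0 < nsq (z - p)].

Lemma open_punct p : open (punct p).
Proof. by apply: open_gt0; exact: (Ck_continuous (Ck_nsq 0 p)). Qed.

Lemma punctE p z : punct p z <-> z != p.
Proof.
split; last by move=> zp; apply: nsq_gt0; rewrite subr_eq0.
by apply: contraPneq => ->; rewrite /punct /nsq /= !subrr expr0n addr0 ltxx.
Qed.

Lemma Ck_angular n p : Ck n (punct p) (fun z => (angular_form p z).1) /\
  Ck n (punct p) (fun z => (angular_form p z).2).
Proof.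
have oV := @open_punct p; set V := punct p.
have C1 := CkB oV (Ck_fst n oV) (Ck_cst n V p.1).
have C2 := CkB oV (Ck_snd n oV) (Ck_cst n V p.2).
have CN := CkZ (2 * pi) oV (Ck_sub (@subsetT _ V) (Ck_nsq n p)).
have CI := CkV oV _ CN; split.
  by apply: (CkM oV (CkN oV C2)); apply: CI => z Vz; rewrite !mulf_neq0 ?pi_neq0 ?gt_eqF.
by apply: (CkM oV C1); apply: CI => z Vz; rewrite !mulf_neq0 ?pi_neq0 ?gt_eqF.
Qed.

Lemma angular_closed p z : punct p z ->
  partial_y (fun z => (angular_form p z).1) z = partial_x (fun z => (angular_form p z).2) z.
Proof.
move=> Vz; rewrite /partial_y /partial_x.
have dX v := is_derive_X z v p.1; have dY v := is_derive_Y z v p.2.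
have N0 : 2 * pi * ((z.1 - p.1) ^+ 2 + (z.2 - p.2) ^+ 2) != 0.
  by rewrite !mulf_neq0 ?pi_neq0 ?gt_eqF.
have dN v : is_derive z v (fun w => 2 * pi * ((w.1 - p.1) ^+ 2 + (w.2 - p.2) ^+ 2))
   (2 * pi * ((z.1 - p.1) * v.1 + (z.1 - p.1) * v.1 + ((z.2 - p.2) * v.2 + (z.2 - p.2) * v.2))).
  have := is_deriveZ (2 * pi) (is_deriveD (is_derive_mul (dX v) (dX v)) (is_derive_mul (dY v) (dY v))).
  by [].
have dI v := is_deriveV' N0 (dN v).
have [_ E1] := is_derive_mul (is_derive_opp (dY (0, 1))) (dI (0, 1)).
have [_ E2] := is_derive_mul (dX (1, 0)) (dI (1, 0)).
rewrite [LHS]E1 [RHS]E2 /= {E1 E2 dI dN dX dY}.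
move: N0 => /=; rewrite !mulf_eq0 !negb_or pnatr_eq0 pi_neq0 /=.
have := pi_neq0; move: (pi : R) (z.1 - p.1) (z.2 - p.2) => P x y P0 N0; field.
by rewrite N0 P0.
Qed.

Lemma angular_le p z : z != p ->
  `|(angular_form p z).1| <= `|z - p|^-1 /\ `|(angular_form p z).2| <= `|z - p|^-1.
Proof.
move=> zp; have n0 : 0 < nsq (z - p) by apply: nsq_gt0; rewrite subr_eq0.
have m0 : 0 < `|z - p| by rewrite normr_gt0 subr_eq0.
have pi1 : 1 <= 2 * pi :> R by have := pi_ge2 R; lra.
have den : 0 < 2 * pi * nsq (z - p) by rewrite !mulr_gt0 ?pi_gt0.
have key (x : R) : `|x| <= `|z - p| -> `|x| / (2 * pi * nsq (z - p)) <= `|z - p|^-1.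
  move=> xm; rewrite ler_pdivrMr// mulrC -ler_pdivrMr ?invr_gt0// invrK.
  apply: le_trans (_ : `|z - p| ^+ 2 <= _); first by rewrite expr2 ler_pM2r.
  apply: le_trans (nsq_ge _) _; rewrite ler_peMl// ltW//.
split; rewrite /angular_form /= -/(nsq (z - p)).
  by rewrite normrM normfV normrN (gtr0_norm den); apply: key; exact: (norm2_le (z - p)).
by rewrite normrM normfV (gtr0_norm den); apply: key; exact: (norm1_le (z - p)).
Qed.

(* The argument of (z - p) / (z - q), divided by 2 pi, where its real part is positive. *)
Definition dotp (u v : plane R) : R := u.1 * v.1 + u.2 * v.2.
Definition crossp (u v : plane R) : R := v.1 * u.2 - v.2 * u.1.
Definition angle2 p q z : R := atan (crossp (z - p) (z - q) / dotp (z - p) (z - q)) / (2 * pi).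

Lemma is_derive_atan f z (v : plane R) df : differentiable f z -> is_derive z v f df ->
  is_derive z v (fun w => atan (f w)) ((1 + f z ^+ 2)^-1 * df).
Proof.
move=> dff [_ dE]; have dz := is_derive1_atan (f z).
have at1 : derivable atan (f z) 1 by case: dz.
apply: DeriveDef.
  by apply: diff_derivable; apply: (differentiable_comp dff); exact/derivable1_diffP.
by have := derive_comp1 v dff at1; rewrite derive1E derive_val dE.
Qed.

Lemma is_derive_ratio f g z (v : plane R) df dg : differentiable f z -> differentiable g z ->
  g z != 0 -> is_derive z v f df -> is_derive z v g dg ->
  is_derive z v (fun w => atan (f w / g w) / (2 * pi))
   ((df * g z - f z * dg) / (f z ^+ 2 + g z ^+ 2) / (2 * pi)).
Proof.
move=> dff dfg g0 Df Dg.
have dI := is_derive_mul Df (is_deriveV' g0 Dg).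
have dfi : differentiable (fun w => f w / g w) z.
  by apply: differentiableM => //; exact: differentiableV.
have dA := is_derive_mul (is_derive_atan dfi dI) (is_derive_cst ((2 * pi)^-1) z v).
move: dA => /is_derive_eq; apply; rewrite mulr0 add0r /=.
have s0 : f z ^+ 2 + g z ^+ 2 != 0.
  by rewrite gt_eqF// ltr_wpDl ?sqr_ge0// lt0r sqr_ge0 sqrf_eq0 g0.
have := pi_neq0; move: (pi : R) (f z) (g z) s0 g0 => P a b s0 b0 P0; field.
by rewrite b0 P0 s0.
Qed.

Lemma Ck_sub1 n c : Ck n setT (fun z => (z - c).1).
Proof.
have oT : open [set: plane R] by exact: openT.
exact: (CkB oT (Ck_fst n oT) (Ck_cst n setT c.1)).
Qed.

Lemma Ck_sub2 n c : Ck n setT (fun z => (z - c).2).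
Proof.
have oT : open [set: plane R] by exact: openT.
exact: (CkB oT (Ck_snd n oT) (Ck_cst n setT c.2)).
Qed.

Lemma Ck_dotp n p q : Ck n setT (fun z => dotp (z - p) (z - q)).
Proof.
have oT : open [set: plane R] by exact: openT.
exact: (CkD oT (CkM oT (Ck_sub1 n p) (Ck_sub1 n q)) (CkM oT (Ck_sub2 n p) (Ck_sub2 n q))).
Qed.

Lemma Ck_crossp n p q : Ck n setT (fun z => crossp (z - p) (z - q)).
Proof.
have oT : open [set: plane R] by exact: openT.
exact: (CkB oT (CkM oT (Ck_sub1 n q) (Ck_sub2 n p)) (CkM oT (Ck_sub2 n q) (Ck_sub1 n p))).
Qed.

(** Where [z - p] and [z - q] form an acute angle, the principal arctangent is a smooth branch of
    the argument of their quotient. *)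
Definition dpos p q : set (plane R) := [set z | 0 < dotp (z - p) (z - q)].

Lemma open_dpos p q : open (dpos p q).
Proof. by apply: open_gt0; exact: (Ck_continuous (Ck_dotp 0 p q)). Qed.

Lemma dpos_neq p q z : dpos p q z -> z != p /\ z != q.
Proof.
by move=> D; split; apply/eqP => zE; move: D; rewrite /dpos /dotp /= zE !subrr !(mul0r, mulr0) addr0 ltxx.
Qed.

Lemma Ck_angle2 n p q : Ck n (dpos p q) (angle2 p q).
Proof.
have oV := @open_dpos p q; set V := dpos p q.
have S f : Ck n setT f -> Ck n V f by exact: Ck_sub.
have CI : Ck n V (fun z => (dotp (z - p) (z - q))^-1).
  by apply: CkV => //; [move=> z Vz; rewrite gt_eqF|exact: S (Ck_dotp n p q)].
exact: (CkM oV (Ck_atan oV (CkM oV (S _ (Ck_crossp n p q)) CI)) (Ck_cst n V (2 * pi)^-1)).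
Qed.

Lemma derive_angle2 p q z (v : plane R) : dpos p q z ->
  is_derive z v (angle2 p q)
   (v.1 * ((angular_form p z).1 - (angular_form q z).1) +
    v.2 * ((angular_form p z).2 - (angular_form q z).2)).
Proof.
move=> D; have [zp zq] := dpos_neq D.
have np : 0 < nsq (z - p) by apply: nsq_gt0; rewrite subr_eq0.
have nq : 0 < nsq (z - q) by apply: nsq_gt0; rewrite subr_eq0.
have dXp := is_derive_X z v p.1; have dYp := is_derive_Y z v p.2.
have dXq := is_derive_X z v q.1; have dYq := is_derive_Y z v q.2.
have dD := is_deriveD (is_derive_mul dXp dXq) (is_derive_mul dYp dYq).
have dC := is_deriveB (is_derive_mul dXq dYp) (is_derive_mul dYq dXp).
have ddD := Ck_diff (Ck_dotp 0 p q) (I : setT z).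
have ddC := Ck_diff (Ck_crossp 0 p q) (I : setT z).
have D0 : dotp (z - p) (z - q) != 0 by rewrite gt_eqF.
have := is_derive_ratio ddC ddD D0 dC dD; move/is_derive_eq; apply.
rewrite /angular_form /crossp /dotp /=.
move: D0 np nq; rewrite /dotp /nsq /=.
move: (z.1 - p.1) (z.2 - p.2) (z.1 - q.1) (z.2 - q.2) => a b c d D0 np nq.
(* Lagrange's identity: the denominator in the derivative of the arctangent factors into the
   denominators of the two angular forms. *)
have E : (c * b - d * a) ^+ 2 + (a * c + b * d) ^+ 2 = (a ^+ 2 + b ^+ 2) * (c ^+ 2 + d ^+ 2) by ring.
rewrite E; have := pi_neq0; move: (pi : R) => P P0; field.
by rewrite P0 !gt_eqF.
Qed.

Lemma partial_angle2 p q z : dpos p q z ->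
  (partial_x (angle2 p q) z = (angular_form p z).1 - (angular_form q z).1) *
  (partial_y (angle2 p q) z = (angular_form p z).2 - (angular_form q z).2).
Proof.
move=> D; have [_ E1] := derive_angle2 (1, 0) D; have [_ E2] := derive_angle2 (0, 1) D.
by rewrite /partial_x /partial_y E1 E2 /= !mul1r !mul0r addr0 add0r.
Qed.

Lemma angle2_le p q z : `|angle2 p q z| <= 1.
Proof.
rewrite /angle2 normrM normfV [`|2 * pi|]gtr0_norm ?mulr_gt0 ?pi_gt0//.
rewrite ler_pdivrMr ?mulr_gt0 ?pi_gt0// mul1r.
set x := _ / _; have := atan_gtNpi2 x; have := atan_ltpi2 x; have := pi_gt0 R => h1 h2 h3.
by rewrite ler_norml; apply/andP; split; lra.
Qed.

End Kernel.

(** * The compactly supported kernel with two poles *)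

Section CutKernel.
Context {R : realType}.
Implicit Types (V : set (plane R)) (f g : plane R -> R) (z p q c : plane R) (r : R).

(** Equal to 1 on the Euclidean circle of radius [4 * r] and to 2 on a circle of radius less than
    [6 * r]. Poles at sup distance at most [r] from [c] lie well inside the first circle. *)
Definition ring_coord c r z : R := nsq (z - c) / (16 * r ^+ 2).

(** A smooth step from 0 to 1 as [t] runs over [1, 2]. The denominator stays positive because one of
    [t - 1] and [2 - t] is at least 1/2. *)
Definition cutoff c r z : R :=
  let t := ring_coord c r z in flat 0 (t - 1) / (flat 0 (t - 1) + flat 0 (2 - t)).

Lemma flat0_gt0 (x : R) : 0 < x -> 0 < flat 0 x.
Proof. by move=> x0; rewrite /flat x0 expr0 invr1 mul1r expR_gt0. Qed.

Lemma flat_le0 k (x : R) : x <= 0 -> flat k x = 0.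
Proof. by move=> x0; rewrite /flat ltNge x0. Qed.

Lemma flat0_half (x : R) : 2^-1 <= x -> expR (- 2) <= flat 0 x.
Proof.
move=> x2; have x0 : 0 < x by apply: lt_le_trans x2; rewrite invr_gt0.
rewrite /flat x0 expr0 invr1 mul1r ler_expR lerN2 -[leRHS]invrK lef_pV2// posrE invr_gt0//.
Qed.

Lemma flat_sum_ge (t : R) : expR (- 2) <= flat 0 (t - 1) + flat 0 (2 - t).
Proof.
have [t1|t1] := leP (3 / 2) t.
  have h : 2^-1 <= t - 1 by lra.
  by apply: le_trans (flat0_half h) _; rewrite lerDl flat_ge0.
have h : 2^-1 <= 2 - t by lra.
by apply: le_trans (flat0_half h) _; rewrite lerDr flat_ge0.
Qed.

Lemma flat_sum_gt0 (t : R) : 0 < flat 0 (t - 1) + flat 0 (2 - t).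
Proof. exact: lt_le_trans (expR_gt0 _) (flat_sum_ge t). Qed.

Lemma Ck_ring_coord n c r : Ck n setT (ring_coord c r).
Proof.
have oT : open [set: plane R] by exact: openT.
exact: (CkM oT (Ck_nsq n c) (Ck_cst n setT (16 * r ^+ 2)^-1)).
Qed.

Lemma Ck_cutoff n c r : Ck n setT (cutoff c r).
Proof.
have oT : open [set: plane R] by exact: openT.
have Ct := Ck_ring_coord n c r.
have C1 := Ck_flat 0 oT (CkB oT Ct (Ck_cst n setT 1)).
have C2 := Ck_flat 0 oT (CkB oT (Ck_cst n setT 2) Ct).
apply: (CkM oT C1 (CkV oT _ (CkD oT C1 C2))) => z _.
by rewrite gt_eqF// flat_sum_gt0.
Qed.

Lemma cutoff_ge0 c r z : 0 <= cutoff c r z.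
Proof. by rewrite divr_ge0 ?flat_ge0// ltW// flat_sum_gt0. Qed.

Lemma cutoff_le1 c r z : cutoff c r z <= 1.
Proof. by rewrite ler_pdivrMr ?flat_sum_gt0// mul1r lerDl flat_ge0. Qed.

Lemma cutoff0 c r z : ring_coord c r z <= 1 -> cutoff c r z = 0.
Proof. by move=> t1; rewrite /cutoff flat_le0 ?mul0r// subr_le0. Qed.

Lemma cutoff1 c r z : 2 <= ring_coord c r z -> cutoff c r z = 1.
Proof.
move=> t2; rewrite /cutoff [flat 0 (2 - _)]flat_le0 ?subr_le0// addr0 divff// gt_eqF// flat0_gt0//.
lra.
Qed.

(** The derivative of the step in [t] is at most [4 * (a + b) / (a + b) ^+ 2], since [flat 2 <= 4],
    and [a + b] is at least [expR (- 2)]. The other factor bounds the derivative of [ring_coord]. *)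
Lemma derive_cutoff c r z (v : plane R) : 0 < r -> `|v| <= 1 ->
  `|'D_v (cutoff c r) z| <= 4 * expR 2 * (4 * `|z - c| / (16 * r ^+ 2)).
Proof.
move=> r0 v1; set t := ring_coord c r z.
have dX := is_derive_X z v c.1; have dY := is_derive_Y z v c.2.
set dn := (z.1 - c.1) * v.1 + (z.1 - c.1) * v.1 + ((z.2 - c.2) * v.2 + (z.2 - c.2) * v.2).
have dt : 'D_v (ring_coord c r) z = dn / (16 * r ^+ 2).
  have [_ E] := is_derive_mul (is_deriveD (is_derive_mul dX dX) (is_derive_mul dY dY))
   (is_derive_cst ((16 * r ^+ 2)^-1) z v).
  by rewrite [LHS]E mulr0 add0r mulrC.
have dft : differentiable (ring_coord c r) z by exact: (Ck_diff (Ck_ring_coord 0 c r)).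
pose phi (t : R) := flat 0 (t - 1) / (flat 0 (t - 1) + flat 0 (2 - t)).
set a := flat 0 (t - 1); set b := flat 0 (2 - t).
have ab0 : 0 < a + b by exact: flat_sum_gt0.
have dphi : is_derive t 1 phi ((flat 2 (t - 1) * b + a * flat 2 (2 - t)) / (a + b) ^+ 2).
  have d1 : is_derive t 1 (fun t => t - 1) (1 : R).
    by have := is_deriveB (is_derive_id t (1 : R)) (is_derive_cst (1 : R) t 1); rewrite subr0.
  have d2 : is_derive t 1 (fun t => 2 - t) (-1 : R).
    by have := is_deriveB (is_derive_cst (2 : R) t 1) (is_derive_id t (1 : R)); rewrite sub0r.
  have da : is_derive t 1 (fun t => flat 0 (t - 1)) (flat 2 (t - 1)).
    have := @is_derive1_comp _ (flat 0) (fun t => t - 1) t _ _ (flat_derive 0 (t - 1)) d1.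
    by rewrite oppr0 mul0r add0r mulr1.
  have db : is_derive t 1 (fun t => flat 0 (2 - t)) (- flat 2 (2 - t)).
    have := @is_derive1_comp _ (flat 0) (fun t => 2 - t) t _ _ (flat_derive 0 (2 - t)) d2.
    by rewrite oppr0 mul0r add0r mulrN1.
  have abn : (fun t => flat 0 (t - 1) + flat 0 (2 - t)) t != 0 by rewrite gt_eqF.
  have dsum := is_deriveD da db.
  have dinv : is_derive t 1 (fun t => (flat 0 (t - 1) + flat 0 (2 - t))^-1)
     (- (a + b) ^- 2 * (flat 2 (t - 1) - flat 2 (2 - t))).
    have [D1 E1] := dsum.
    apply: DeriveDef; first exact: derivableV.
    by rewrite deriveV//; congr (_ * _).
  have := is_deriveM da dinv; move/is_derive_eq; apply.
  by rewrite /GRing.scale/= -/a -/b; field; rewrite gt_eqF.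
have -> : 'D_v (cutoff c r) z = derive1 phi t * 'D_v (ring_coord c r) z.
  rewrite -(derive_comp1 v dft) //; by case: dphi.
have -> : derive1 phi t = (flat 2 (t - 1) * b + a * flat 2 (2 - t)) / (a + b) ^+ 2.
  by rewrite derive1E; case: dphi.
have a0 : 0 <= a by exact: flat_ge0.
have b0 : 0 <= b by exact: flat_ge0.
have f24 x : flat 2 x <= 4 :> R by apply: le_trans (flat_le _ _) _; rewrite -natrX ler_nat.
rewrite normrM dt; apply: ler_pM => //.
  rewrite ger0_norm; last by rewrite divr_ge0 ?exprn_ge0 ?(ltW ab0)// addr_ge0 ?mulr_ge0 ?flat_ge0.
  rewrite ler_pdivrMr ?exprn_gt0//.
  apply: (@le_trans _ _ (4 * (a + b))).
    rewrite mulrDr addrC; apply: lerD; first by rewrite mulrC ler_wpM2r.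
    by rewrite ler_wpM2r.
  rewrite -!mulrA ler_pM2l// expr2 mulrA ler_peMl ?(ltW ab0)//.
  have := flat_sum_ge t; rewrite -/a -/b expRN => h.
  by rewrite -(ler_pM2l (expR_gt0 (- 2))) mulr1 mulrA -expRD addNr expR0 mul1r expRN.
have r2 : 0 < 16 * r ^+ 2 by rewrite mulr_gt0// exprn_gt0.
rewrite normrM normfV (gtr0_norm r2) ler_pM2r ?invr_gt0//.
have h1 : `|(z.1 - c.1) * v.1| <= `|z - c|.
  rewrite normrM -[leRHS]mulr1; apply: ler_pM => //; first exact: (norm1_le (z - c)).
  exact: le_trans (norm1_le v) v1.
have h2 : `|(z.2 - c.2) * v.2| <= `|z - c|.
  rewrite normrM -[leRHS]mulr1; apply: ler_pM => //; first exact: (norm2_le (z - c)).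
  exact: le_trans (norm2_le v) v1.
rewrite /dn; apply: le_trans (ler_normD _ _) _.
have := ler_normD ((z.1 - c.1) * v.1) ((z.1 - c.1) * v.1).
have := ler_normD ((z.2 - c.2) * v.2) ((z.2 - c.2) * v.2).
lra.
Qed.

Definition cut_angle p q c r z : R := cutoff c r z * angle2 p q z.

(* Closed, with periods 1 around p and -1 around q; subtracting the cut-off of its
   primitive away from p and q makes the support compact. *)
Definition ker p q c r : one_form R := fun z =>
  ((angular_form p z).1 - (angular_form q z).1 - partial_x (cut_angle p q c r) z,
   (angular_form p z).2 - (angular_form q z).2 - partial_y (cut_angle p q c r) z).

Section Fixed.
Variables (p q c : plane R) (r : R).
Hypotheses (r0 : 0 < r) (pc : `|p - c| <= r) (qc : `|q - c| <= r).

Let H := cut_angle p q c r.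

Lemma ring_dpos z : 1 <= ring_coord c r z -> dpos p q z.
Proof.
have r2 : 0 < 16 * r ^+ 2 by rewrite mulr_gt0// exprn_gt0.
rewrite ler_pdivlMr// mul1r => zr.
have np : nsq (p - c) <= 2 * r ^+ 2.
  by apply: le_trans (nsq_le _) _; rewrite ler_pM2l// lerXn2r ?nnegrE// ltW.
have nq : nsq (q - c) <= 2 * r ^+ 2.
  by apply: le_trans (nsq_le _) _; rewrite ler_pM2l// lerXn2r ?nnegrE// ltW.
rewrite /dpos /dotp /=.
have -> : z.1 - p.1 = (z.1 - c.1) - (p.1 - c.1) by ring.
have -> : z.2 - p.2 = (z.2 - c.2) - (p.2 - c.2) by ring.
have -> : z.1 - q.1 = (z.1 - c.1) - (q.1 - c.1) by ring.
have -> : z.2 - q.2 = (z.2 - c.2) - (q.2 - c.2) by ring.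
move: zr np nq; rewrite /nsq /=; have : 0 < r ^+ 2 by rewrite exprn_gt0.
move: (r ^+ 2) (z.1 - c.1) (z.2 - c.2) (p.1 - c.1) (p.2 - c.2) (q.1 - c.1) (q.2 - c.2)
  => s x y a b a' b' s0 zr np nq.
(* Completing the square. The first term is at least [8 * s], and the two subtracted ones are at
   most [s] each. *)
rewrite [ltRHS](_ : _ = (x ^+ 2 + y ^+ 2) / 2 + (x - (a + a')) ^+ 2 / 2 + (y - (b + b')) ^+ 2 / 2
  - (a ^+ 2 + b ^+ 2) / 2 - (a' ^+ 2 + b' ^+ 2) / 2); last by field.
have := sqr_ge0 (x - (a + a')); have := sqr_ge0 (y - (b + b')); lra.
Qed.

(** The function vanishes where [ring_coord < 1], and elsewhere [ring_dpos] supplies a smooth branch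
    of the angle. The two open regions cover the plane, poles included. *)
Lemma cut_angle_smooth n : Ck n setT H.
Proof.
pose A1 := [set z | 0 < 1 - ring_coord c r z].
have oA1 : open A1.
  apply: open_gt0; apply: (@Ck_continuous R 0).
  exact: (CkB openT (Ck_cst 0 setT 1) (Ck_ring_coord 0 c r)).
have oA2 := @open_dpos R p q.
have C1 : Ck n A1 H.
  apply: (Ck_ext (f := fun=> 0) oA1 _ (Ck_cst n A1 0)) => z; rewrite /A1 /= subr_gt0 => z1.
  by rewrite /H /cut_angle cutoff0 ?mul0r// ltW.
have C2 : Ck n (dpos p q) H.
  apply: (CkM oA2 _ (Ck_angle2 n p q)).
  exact: Ck_sub (Ck_cutoff n c r).
apply: (Ck_cover (A := fun z => if ring_coord c r z < 1 then A1 else dpos p q)) => z _.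
case: ifPn => z1; first by split => //; rewrite /A1 /= subr_gt0.
by split => //; apply: ring_dpos; rewrite leNgt.
Qed.

Lemma partial_cut_angle z : ring_coord c r z < 1 ->
  (partial_x H z = 0) * (partial_y H z = 0).
Proof.
move=> z1; pose A1 := [set z | 0 < 1 - ring_coord c r z].
have oA1 : open A1.
  apply: open_gt0; apply: (@Ck_continuous R 0).
  exact: (CkB openT (Ck_cst 0 setT 1) (Ck_ring_coord 0 c r)).
have A1z : A1 z by rewrite /A1 /= subr_gt0.
have E w : A1 w -> H w = (fun=> 0) w.
  by rewrite /A1 /= subr_gt0 => w1; rewrite /H /cut_angle cutoff0 ?mul0r// ltW.
by rewrite !(partial_ext oA1 A1z E) /partial_x /partial_y !derive_cst.
Qed.

(** Where the cut-off is 1, the subtracted differential is exactly the difference of the angular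
    forms. The radius 6 works because [6 ^+ 2] exceeds [2 * 16]. *)
Lemma ker_support z : 6 * r < `|z - c| -> ker p q c r z = (0, 0).
Proof.
move=> zr; pose A := [set z | 0 < ring_coord c r z - 2].
have oA : open A.
  apply: open_gt0; apply: (@Ck_continuous R 0).
  exact: (CkB openT (Ck_ring_coord 0 c r) (Ck_cst 0 setT 2)).
have r2 : 0 < 16 * r ^+ 2 by rewrite mulr_gt0// exprn_gt0.
have t2 : 2 < ring_coord c r z.
  rewrite ltr_pdivlMr//; apply: lt_le_trans (nsq_ge _).
  apply: lt_trans (_ : (6 * r) ^+ 2 < _).
    by rewrite exprMn mulrA ltr_pM2r ?exprn_gt0//; lra.
  by rewrite ltrXn2r// ?nnegrE ?mulr_ge0 ?ltW.
have Az : A z by rewrite /A /= subr_gt0.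
have E w : A w -> H w = angle2 p q w.
  by rewrite /A /= subr_gt0 => w1; rewrite /H /cut_angle cutoff1 ?mul1r// ltW.
have Dz : dpos p q z by apply: ring_dpos; lra.
rewrite /ker -/H !(partial_ext oA Az E) !(partial_angle2 Dz).
by congr pair; rewrite subrr.
Qed.

Lemma ker_smooth n : let V := punct p `&` punct q in
  Ck n V (fun z => (ker p q c r z).1) /\ Ck n V (fun z => (ker p q c r z).2).
Proof.
move=> V; have oV : open V by apply: openI; exact: open_punct.
have [P1 P2] := Ck_angular n p; have [Q1 Q2] := Ck_angular n q.
have [_ [Hx Hy]] := cut_angle_smooth n.+1.
have S (A : set (plane R)) f : V `<=` A -> Ck n A f -> Ck n V f by exact: Ck_sub.
split; apply: (CkB oV (CkB oV _ _)).
- by apply: S P1 => z [].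
- by apply: S Q1 => z [].
- exact: S Hx.
- by apply: S P2 => z [].
- by apply: S Q2 => z [].
- exact: S Hy.
Qed.

Lemma ker_closed z : z != p -> z != q ->
  partial_y (fun z => (ker p q c r z).1) z = partial_x (fun z => (ker p q c r z).2) z.
Proof.
move=> /punctE zp /punctE zq.
have [P1 P2] := Ck_angular 0 p; have [Q1 Q2] := Ck_angular 0 q.
have [dH [Hx Hy]] := cut_angle_smooth 1.
have dP1 := Ck_diff P1 zp; have dP2 := Ck_diff P2 zp.
have dQ1 := Ck_diff Q1 zq; have dQ2 := Ck_diff Q2 zq.
have dHx := Hx.1 z I; have dHy := Hy.1 z I.
have B3 (f g h : plane R -> R) (v : plane R) :
    differentiable f z -> differentiable g z -> differentiable h z ->
    'D_v (fun z => f z - g z - h z) z = 'D_v f z - 'D_v g z - 'D_v h z.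
  move=> df dg dh; have dfg : differentiable (fun z => f z - g z) z by exact: differentiableB.
  transitivity ('D_v (fun z => f z - g z) z - 'D_v h z).
    by apply: deriveB; exact: diff_derivable.
  by congr (_ - _); apply: deriveB; exact: diff_derivable.
have E1 := B3 _ _ _ (0, 1) dP1 dQ1 dHx; have E2 := B3 _ _ _ (1, 0) dP2 dQ2 dHy.
have Eq := angular_closed zq; have Ep := angular_closed zp.
have EH := mixed_partials openT (I : setT z) dH dHx dHy.
transitivity (partial_y (fun z => (angular_form p z).1) z -
  partial_y (fun z => (angular_form q z).1) z - partial_y (partial_x H) z); first exact: E1.
by rewrite Ep Eq EH; exact/esym/E2.
Qed.

(** One unit bounds the angular forms and one the cut-off times the differential of the angle. In
    the last term [6 * expR 2 / r] bounds the derivative of the cut-off for [|z - c| <= 6 * r], and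
    7 comes from [|z - p| <= 7 * r] there. *)
Definition ker_cst : R := 2 + 7 * (6 * expR 2).

Lemma ker_le z : z != p -> z != q ->
  `|(ker p q c r z).1| <= ker_cst * (`|z - p|^-1 + `|z - q|^-1) /\
  `|(ker p q c r z).2| <= ker_cst * (`|z - p|^-1 + `|z - q|^-1).
Proof.
move=> zp zq.
have [P1 P2] := angular_le zp; have [Q1 Q2] := angular_le zq.
have mp : 0 < `|z - p| by rewrite normr_gt0 subr_eq0.
have mq : 0 < `|z - q| by rewrite normr_gt0 subr_eq0.
have ip : 0 < `|z - p|^-1 by rewrite invr_gt0.
have iq : 0 < `|z - q|^-1 by rewrite invr_gt0.
have e2 := expR_gt0 (2 : R).
have c0 : 0 <= ker_cst by rewrite /ker_cst; lra.
have [far|near] := ltP (6 * r) `|z - c|.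
  by rewrite ker_support//= normr0 mulr_ge0// addr_ge0// ltW.
have rp : r^-1 <= 7 * `|z - p|^-1.
  rewrite -[7]invrK -invfM lef_pV2 ?posrE ?mulr_gt0 ?invr_gt0//.
  rewrite mulrC ler_pdivrMr//.
  have -> : z - p = (z - c) - (p - c) by rewrite opprB addrA subrK.
  by apply: le_trans (ler_normB _ _) _; apply: le_trans (lerD near pc) _; lra.
have bound (v : plane R) (A B : R) : `|v| <= 1 -> `|A| <= `|z - p|^-1 -> `|B| <= `|z - q|^-1 ->
   (dpos p q z -> 'D_v (angle2 p q) z = A - B) ->
   `|A - B - 'D_v H z| <= ker_cst * (`|z - p|^-1 + `|z - q|^-1).
  move=> v1 Ap Bq DvE.
  have AB : `|A - B| <= `|z - p|^-1 + `|z - q|^-1.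
    by apply: le_trans (ler_normB _ _) _; exact: lerD.
  suff hH : `|'D_v H z| <= (1 + 7 * (6 * expR 2)) * (`|z - p|^-1 + `|z - q|^-1).
    apply: le_trans (ler_normB _ _) _.
    have -> : ker_cst = 1 + (1 + 7 * (6 * expR 2)) by rewrite /ker_cst; ring.
    by rewrite mulrDl mul1r; exact: lerD.
  have [z1|z1] := ltP (ring_coord c r z) 1.
    have -> : 'D_v H z = 0.
      have dH := Ck_diff (cut_angle_smooth 0) (I : setT z).
      by rewrite deriveE// diff_partials// !(partial_cut_angle z1) !mulr0 addr0.
    rewrite normr0 mulr_ge0 ?addr_ge0 ?(ltW ip) ?(ltW iq)//; lra.
  have Dz := ring_dpos z1.
  have dchi := Ck_diff (Ck_cutoff 0 c r) (I : setT z).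
  have dang := Ck_diff (Ck_angle2 0 p q) Dz.
  have -> : 'D_v H z = cutoff c r z * (A - B) + angle2 p q z * 'D_v (cutoff c r) z.
    by rewrite -DvE//; apply: deriveM; exact: diff_derivable.
  apply: le_trans (ler_normD _ _) _.
  rewrite [X in X + _ <= _]normrM [X in _ + X <= _]normrM.
  have h1 : `|cutoff c r z| * `|A - B| <= `|z - p|^-1 + `|z - q|^-1.
    rewrite -[leRHS]mul1r; apply: ler_pM => //.
    by rewrite ger0_norm ?cutoff_ge0 ?cutoff_le1.
  have h2 : `|'D_v (cutoff c r) z| <= 7 * (6 * expR 2) * `|z - p|^-1.
    apply: le_trans (derive_cutoff c z r0 v1) _.
    apply: (@le_trans _ _ (6 * expR 2 * r^-1)).
      have -> : 6 * expR 2 * r^-1 = 4 * expR 2 * (4 * (6 * r) / (16 * r ^+ 2)).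
        by field; rewrite gt_eqF.
      rewrite ler_pM2l ?mulr_gt0// ler_pM2r ?invr_gt0 ?mulr_gt0 ?exprn_gt0//.
      by rewrite ler_pM2l.
    have -> : 7 * (6 * expR 2) * `|z - p|^-1 = 6 * expR 2 * (7 * `|z - p|^-1) by ring.
    by rewrite ler_pM2l ?mulr_gt0.
  have h3 : `|angle2 p q z| * `|'D_v (cutoff c r) z| <= 7 * (6 * expR 2) * `|z - p|^-1.
    by rewrite -[leRHS]mul1r; apply: ler_pM => //; exact: angle2_le.
  rewrite [leRHS]mulrDl mul1r; apply: lerD => //; apply: le_trans h3 _.
  by rewrite ler_pM2l ?mulr_gt0// lerDl ltW.
have [n10 n01] : `|(1, 0) : plane R| <= 1 /\ `|(0, 1) : plane R| <= 1.
  by rewrite !plane_norm /= normr0 normr1 !ge_max lexx ler01.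
split; apply: bound => // Dz; have [E1 E2] := partial_angle2 Dz => //.
Qed.

End Fixed.

End CutKernel.

(** * Line integrals along closed curves and periods of the kernel *)

Section LineIntegrals.
Context {R : realType}.
Implicit Types (gamma : R -> plane R) (omega : one_form R) (G : plane R -> R).

Definition curve_cont gamma omega :=
  continuous (fun t => (omega (gamma t)).1) /\ continuous (fun t => (omega (gamma t)).2).

Lemma curve_cont_smooth gamma : smooth_closed_curve gamma -> continuous gamma.
Proof.
move=> [d1 d2 _] t.
have c1 : {for t, continuous (fun s => (gamma s).1)}.
  by apply: differentiable_continuous; apply/derivable1_diffP; exact: (d1 0%N).
have c2 : {for t, continuous (fun s => (gamma s).2)}.
  by apply: differentiable_continuous; apply/derivable1_diffP; exact: (d2 0%N).
have gE : gamma = fun s => ((gamma s).1, (gamma s).2).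
  by apply/funext => s; case: (gamma s).
by rewrite gE; exact: (cvg_pair c1 c2).
Qed.

Lemma curve_derive_cont gamma : smooth_closed_curve gamma ->
  continuous (derive1 (fun s => (gamma s).1)) /\ continuous (derive1 (fun s => (gamma s).2)).
Proof.
by move=> [d1 d2 _]; split => t; apply: differentiable_continuous; apply/derivable1_diffP;
 [exact: (d1 1%N)|exact: (d2 1%N)].
Qed.

Lemma curve_cont_diff gamma omega : smooth_closed_curve gamma ->
  (forall t, differentiable (fun z => (omega z).1) (gamma t)) ->
  (forall t, differentiable (fun z => (omega z).2) (gamma t)) -> curve_cont gamma omega.
Proof.
move=> /curve_cont_smooth cg d1 d2; split=> t.
  apply: (@continuous_comp _ _ _ gamma (fun z => (omega z).1)); first exact: cg.
  exact: differentiable_continuous.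
apply: (@continuous_comp _ _ _ gamma (fun z => (omega z).2)); first exact: cg.
exact: differentiable_continuous.
Qed.

Definition line_integrand gamma omega (t : R) : R :=
  (omega (gamma t)).1 * derive1 (fun s => (gamma s).1) t +
  (omega (gamma t)).2 * derive1 (fun s => (gamma s).2) t.

Lemma line_integrand_cont gamma omega : smooth_closed_curve gamma ->
  curve_cont gamma omega -> continuous (line_integrand gamma omega).
Proof.
move=> /curve_derive_cont[g1 g2] [c1 c2] t.
exact: (continuousD (continuousM (c1 t) (g1 t)) (continuousM (c2 t) (g2 t))).
Qed.

Lemma line_integrand_integrable gamma omega : smooth_closed_curve gamma ->
  curve_cont gamma omega ->
  (@lebesgue_measure R).-integrable `[0, 1] (EFin \o line_integrand gamma omega).
Proof.
move=> sg co; apply: continuous_compact_integrable; first exact: segment_compact.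
by apply: continuous_subspaceT; exact: line_integrand_cont.
Qed.

Lemma line_integralD gamma omega omega' : smooth_closed_curve gamma ->
  curve_cont gamma omega -> curve_cont gamma omega' ->
  line_integral gamma (fun z => ((omega z).1 + (omega' z).1, (omega z).2 + (omega' z).2)) =
  line_integral gamma omega + line_integral gamma omega'.
Proof.
move=> sg c c'; have I := line_integrand_integrable sg c; have I' := line_integrand_integrable sg c'.
rewrite /line_integral -[RHS]RintegralD//.
by apply: eq_Rintegral => t _ /=; ring.
Qed.

Lemma line_integralZ gamma omega (k : R) : smooth_closed_curve gamma ->
  curve_cont gamma omega ->
  line_integral gamma (fun z => (k * (omega z).1, k * (omega z).2)) =
  k * line_integral gamma omega.
Proof.
move=> sg c; have I := line_integrand_integrable sg c.
rewrite /line_integral -[RHS]RintegralZl//.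
by apply: eq_Rintegral => t _ /=; ring.
Qed.

Lemma curve_contD gamma omega omega' : curve_cont gamma omega -> curve_cont gamma omega' ->
  curve_cont gamma (fun z => ((omega z).1 + (omega' z).1, (omega z).2 + (omega' z).2)).
Proof.
move=> [c1 c2] [d1 d2]; split=> t.
  exact: (continuousD (c1 t) (d1 t)).
exact: (continuousD (c2 t) (d2 t)).
Qed.

Lemma curve_contZ gamma omega (k : R) : curve_cont gamma omega ->
  curve_cont gamma (fun z => (k * (omega z).1, k * (omega z).2)).
Proof.
have ck (t : R) : {for t, continuous (fun _ : R => k)} by exact: cvg_cst.
move=> [c1 c2]; split=> t.
  exact: (continuousM (ck t) (c1 t)).
exact: (continuousM (ck t) (c2 t)).
Qed.

Lemma line_integral0 gamma : line_integral gamma (fun=> (0, 0)) = 0.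
Proof.
rewrite /line_integral [X in _ = X](_ : 0 = \int[lebesgue_measure]_(t in `[0%R, 1%R]) (0 : R)).
  by apply: eq_Rintegral => t _ /=; rewrite !mul0r addr0.
by rewrite Rintegral_cst// mul0r.
Qed.

Lemma line_integral_sum gamma (I : Type) (r : seq I) (F : I -> one_form R) :
  smooth_closed_curve gamma -> (forall i, curve_cont gamma (F i)) ->
  curve_cont gamma (fun z => (\sum_(i <- r) (F i z).1, \sum_(i <- r) (F i z).2)) /\
  line_integral gamma (fun z => (\sum_(i <- r) (F i z).1, \sum_(i <- r) (F i z).2)) =
  \sum_(i <- r) line_integral gamma (F i).
Proof.
move=> sg cF; elim: r => [|i r [IHc IH]].
  rewrite big_nil (_ : (fun z => _) = fun=> (0, 0)); last first.
    by apply/funext => z; rewrite !big_nil.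
  by split; [split=> t; exact: cvg_cst|exact: line_integral0].
rewrite (_ : (fun z => _) = fun z => ((F i z).1 + \sum_(i <- r) (F i z).1,
   (F i z).2 + \sum_(i <- r) (F i z).2)); last by apply/funext => z; rewrite !big_cons.
split; first exact: (curve_contD (cF i) IHc).
by rewrite big_cons -IH; exact: (line_integralD sg (cF i) IHc).
Qed.

Lemma is_derive_curve gamma G t : smooth_closed_curve gamma -> differentiable G (gamma t) ->
  is_derive t 1 (G \o gamma)
    (partial_x G (gamma t) * derive1 (fun s => (gamma s).1) t +
     partial_y G (gamma t) * derive1 (fun s => (gamma s).2) t).
Proof.
move=> [d1 d2 _] dG.
have D1 : differentiable (fun s => (gamma s).1) t by apply/derivable1_diffP; exact: (d1 0%N).
have D2 : differentiable (fun s => (gamma s).2) t by apply/derivable1_diffP; exact: (d2 0%N).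
pose g' s := ((gamma s).1, (gamma s).2).
have gE : gamma = g' by apply/funext => s; rewrite /g'; case: (gamma s).
have Dg : differentiable g' t by exact: differentiable_pair.
have dG' : differentiable G (g' t) by rewrite -gE.
have gE' : (G \o gamma) = (G \o g') by rewrite gE.
rewrite gE'; apply: DeriveDef.
  by apply/derivable1_diffP; exact: differentiable_comp.
rewrite deriveE; last exact: differentiable_comp.
rewrite diff_comp//= diff_partials// diff_pair//= -gE.
by rewrite !deriv1E/= ?scale1r; [ring|exact: (d2 0%N)|exact: (d1 0%N)].
Qed.

(** The integrand is the derivative of [G \o gamma], which takes equal values at 0 and 1 because the
    curve is closed. *)
Lemma line_integral_exact gamma omega G : smooth_closed_curve gamma ->
  (forall t, differentiable G (gamma t)) ->
  (forall t, omega (gamma t) = (partial_x G (gamma t), partial_y G (gamma t))) ->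
  curve_cont gamma omega -> line_integral gamma omega = 0.
Proof.
move=> sg dG oE co.
have dGg t := is_derive_curve sg (dG t).
have ci := line_integrand_cont sg co.
have cG : continuous (G \o gamma).
  move=> t; apply: differentiable_continuous; apply/derivable1_diffP; by case: (dGg t).
rewrite /line_integral /Rintegral.
have -> : (\int[lebesgue_measure]_(t in `[0%R, 1%R]) (line_integrand gamma omega t)%:E =
    (G (gamma 1))%:E - (G (gamma 0))%:E)%E.
  apply: (@continuous_FTC2 _ (line_integrand gamma omega) (G \o gamma)).
  - exact: ltr01.
  - exact: continuous_subspaceT.
  - split.
    + by move=> t _; case: (dGg t).
    + by apply: cvg_at_right_filter; exact: cG.
    + by apply: cvg_at_left_filter; exact: cG.
  - by move=> t _; rewrite derive1E; have [_ ->] := dGg t; rewrite /line_integrand oE.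
have [_ _ per] := sg.
by rewrite -[1]add0r per subee.
Qed.

Lemma curve_cont_angular gamma (p : plane R) : smooth_closed_curve gamma ->
  (forall t, gamma t != p) -> curve_cont gamma (angular_form p).
Proof.
move=> sg gp; have [P1 P2] := Ck_angular 0 p.
by apply: curve_cont_diff => // t; [apply: Ck_diff P1 _|apply: Ck_diff P2 _]; apply/punctE.
Qed.

(** The subtracted differential has a primitive that is smooth on the whole plane, so only the two
    angular forms contribute. *)
Lemma ker_period gamma (p q c : plane R) (r : R) : 0 < r -> `|p - c| <= r -> `|q - c| <= r ->
  smooth_closed_curve gamma -> (forall t, gamma t != p) -> (forall t, gamma t != q) ->
  curve_cont gamma (ker p q c r) /\
  line_integral gamma (ker p q c r) = winding_number gamma p - winding_number gamma q.
Proof.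
move=> r0 pc qc sg gp gq.
have cp := curve_cont_angular sg gp; have cq := curve_cont_angular sg gq.
pose dH : one_form R := fun z =>
  (partial_x (cut_angle p q c r) z, partial_y (cut_angle p q c r) z).
have [dHd [Hx Hy]] := cut_angle_smooth r0 pc qc 1.
have cH : curve_cont gamma dH.
  by apply: curve_cont_diff => // t; [exact: Hx.1|exact: Hy.1].
have dH0 : line_integral gamma dH = 0.
  by apply: (line_integral_exact sg _ _ cH (G := cut_angle p q c r)) => t; [exact: dHd|].
have kE : ker p q c r = fun z => ((angular_form p z).1 +
   ((-1 * (angular_form q z).1) + (-1 * (dH z).1)),
   (angular_form p z).2 + ((-1 * (angular_form q z).2) + (-1 * (dH z).2))).
  by apply/funext => z; rewrite /ker /dH /=; congr pair; ring.
have cq' := curve_contZ (-1) cq; have cH' := curve_contZ (-1) cH.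
have cqH := curve_contD cq' cH'.
rewrite kE; split; first exact: (curve_contD cp cqH).
have -> := line_integralD sg cp cqH; congr (_ + _).
have -> := line_integralD sg cq' cH'.
have -> := line_integralZ (-1) sg cH; rewrite dH0 mulr0 addr0.
by have -> := line_integralZ (-1) sg cq; rewrite mulN1r.
Qed.

(* Seen from [q], the disk lies within a quarter turn of the direction [- q]. *)
Lemma winding_outside gamma (q : plane R) : smooth_closed_curve gamma ->
  (forall t, nsq (gamma t) < 1) -> 1 <= nsq q -> winding_number gamma q = 0.
Proof.
move=> sg gd q1.
pose C z := (- q.1) * (z.2 - q.2) - (- q.2) * (z.1 - q.1) : R.
pose D z := (- q.1) * (z.1 - q.1) + (- q.2) * (z.2 - q.2) : R.
pose G z := atan (C z / D z) / (2 * pi) : R.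
have Dpos t : 0 < D (gamma t).
  have := gd t; rewrite /D /nsq; move: (gamma t).1 (gamma t).2 => x y h.
  (* Polarization: the scalar product with [- q] is positive because [q] has norm at least 1 and the
     curve stays in the open disk. *)
  have -> : - q.1 * (x - q.1) + - q.2 * (y - q.2) =
    ((x - q.1) ^+ 2 + (y - q.2) ^+ 2 + (nsq q - (x ^+ 2 + y ^+ 2))) / 2.
    by rewrite /nsq; field.
  by rewrite divr_gt0// ltr_wpDl ?addr_ge0 ?sqr_ge0// subr_gt0; exact: lt_le_trans q1.
have gq t : gamma t != q by apply: contraTneq (gd t) => ->; rewrite -leNgt.
have oT : open [set: plane R] by exact: openT.
have X1 := Ck_sub1 0 q; have X2 := Ck_sub2 0 q.
have dC : forall z, differentiable C z.
  by move=> z; exact: (Ck_diff (CkB oT (CkZ (- q.1) oT X2) (CkZ (- q.2) oT X1))).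
have dD : forall z, differentiable D z.
  by move=> z; exact: (Ck_diff (CkD oT (CkZ (- q.1) oT X1) (CkZ (- q.2) oT X2))).
have dG t (v : plane R) : is_derive (gamma t) v G (v.1 * (angular_form q (gamma t)).1 +
    v.2 * (angular_form q (gamma t)).2).
  have dX := is_derive_X (gamma t) v q.1; have dY := is_derive_Y (gamma t) v q.2.
  have cst (a : R) := is_derive_cst a (gamma t) v.
  have E1 := is_deriveB (is_derive_mul (cst (- q.1)) dY) (is_derive_mul (cst (- q.2)) dX).
  have E2 := is_deriveD (is_derive_mul (cst (- q.1)) dX) (is_derive_mul (cst (- q.2)) dY).
  have D0 : D (gamma t) != 0 by rewrite gt_eqF.
  have := is_derive_ratio (dC (gamma t)) (dD (gamma t)) D0 E1 E2.
  move/is_derive_eq; apply; rewrite !mulr0 !addr0 /angular_form /=.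
  move: (D0); rewrite /C /D.
  have : nsq (gamma t - q) != 0 by rewrite gt_eqF// nsq_gt0// subr_eq0.
  have : nsq q != 0 by rewrite gt_eqF//; exact: lt_le_trans q1.
  rewrite /nsq /=; have := pi_neq0 (R := R).
  move: (pi : R) (gamma t).1 (gamma t).2 q.1 q.2 => P x y a b P0 ab xy Dn.
  have -> : (- a * (y - b) - - b * (x - a)) ^+ 2 + (- a * (x - a) + - b * (y - b)) ^+ 2 =
    (a ^+ 2 + b ^+ 2) * ((x - a) ^+ 2 + (y - b) ^+ 2) by ring.
  by field; rewrite P0 ab xy.
apply: (line_integral_exact (G := G)) => //.
- move=> t; have D0 : D (gamma t) != 0 by rewrite gt_eqF.
  apply: differentiableM; last exact: differentiable_cst.
  apply: (@differentiable_comp _ _ _ _ (fun z => C z / D z) atan).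
    by apply: differentiableM; [exact: dC|apply: differentiableV].
  by apply/derivable1_diffP; case: (is_derive1_atan (C (gamma t) / D (gamma t))).
- move=> t; have [_ E1] := dG t (1, 0); have [_ E2] := dG t (0, 1).
  by rewrite /partial_x /partial_y E1 E2 /= !mul1r !mul0r addr0 add0r.
- exact: curve_cont_angular.
Qed.

End LineIntegrals.

(** * Borel measurability in the plane and weak closedness of smooth closed forms *)

Section PlaneMeasure.
Context {R : realType}.
Implicit Types (V : set (plane R)) (f : plane R -> R) (omega : one_form R).

Local Notation mu := (@lebesgue_measure R).

(** An open set is a countable union of squares with rational centre and radius [n.+1%:R^-1].
    Squares that leave [V] are replaced by [set0], so that the index set stays countable without
    selection. *)
Lemma open_measurable_plane V : open V -> measurable (V : set (mplane R)).
Proof.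
move=> oV.
pose box (i : rat * rat * nat) : set (plane R) :=
  ball (ratr i.1.1 : R) i.2.+1%:R^-1 `*` ball (ratr i.1.2 : R) i.2.+1%:R^-1.
pose P (i : rat * rat * nat) := if `[< box i `<=` V >] then box i else set0.
have -> : V = \bigcup_i P i.
  apply/seteqP; split => [[x y] Vxy|z [i _]]; last first.
    by rewrite /P; case: asboolP => // sub /sub.
  have /nbhs_ballP[e /= e0 eV] := open_nbhs_nbhs (conj oV Vxy).
  have [n ne] : exists n, n.+1%:R^-1 < e / 2 :> R.
    have e20 : 0 < e / 2 by rewrite divr_gt0.
    by have [n _ /(_ n (leqnn n))] := near_infty_natSinv_lt (PosNum e20); exists n.
  have n0 : 0 < n.+1%:R^-1 :> R by rewrite invr_gt0.
  have dn (a : R) : exists q : rat, ball (ratr q : R) n.+1%:R^-1 a.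
    have bo : open (ball a n.+1%:R^-1) by apply: ball_open.
    have bx : ball a n.+1%:R^-1 !=set0 by exists a; exact: ballxx.
    have [ab [/= abE [q _ qE]]] := @dense_rat R _ bx bo.
    by exists q; apply: ball_sym; rewrite qE.
  have [[q1 h1] [q2 h2]] := (dn x, dn y).
  exists (q1, q2, n) => //; rewrite /P; case: asboolP => [_|[]]; first by split.
  move=> [a b] [/= h1' h2']; apply: eV; move: h1 h2 h1' h2'.
  rewrite -!ball_normE /= plane_norm gt_max /= => h1 h2 h1' h2'.
  have tri (u v w : R) : `|v - u| < n.+1%:R^-1 -> `|v - w| < n.+1%:R^-1 -> `|u - w| < e.
    move=> uv vw; have -> : u - w = (v - w) - (v - u) by ring.
    by apply: le_lt_trans (ler_normB _ _) _; rewrite [e]splitr; exact: ltrD (lt_trans vw ne) (lt_trans uv ne).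
  by apply/andP; split; [exact: tri h1 h1'|exact: tri h2 h2'].
apply: countable_bigcupT_measurable => [|i]; first exact: countableP.
rewrite /P; case: ifP => _; last exact: measurable0.
by rewrite /box !ball_itv; apply: measurableX; exact: measurable_itv.
Qed.

Lemma open_measurable_fun V f : open V -> (forall z, V z -> {for z, continuous f}) ->
  measurable_fun (V : set (mplane R)) (f : mplane R -> R).
Proof.
move=> oV cf; apply: (measurability _ (RGenOpens.measurableE R)).
move=> _ [_ [a [b ->] <-]]; apply: open_measurable_plane.
rewrite openE => z [Vz fz]; rewrite /interior.
apply: filterI; first exact: (open_nbhs_nbhs (conj oV Vz)).
apply: (cf z Vz); apply: open_nbhs_nbhs; split => //; exact: interval_open.
Qed.

Lemma Ck_measurable n V f : open V -> Ck n V f ->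
  measurable_fun (V : set (mplane R)) (f : mplane R -> R).
Proof.
move=> oV Cf; apply: open_measurable_fun => // z Vz.
by apply: differentiable_continuous; exact: (Ck_diff Cf).
Qed.

Definition square (L : R) : set (plane R) := `[- L, L]%classic `*` `[- L, L]%classic.

Lemma square_out (L : R) (z : plane R) : ~ square L z -> L < `|z|.
Proof.
move=> h; rewrite ltNge; apply/negP => zL; apply: h; split => /=; rewrite in_itv /= -ler_norml.
  exact: le_trans (norm1_le z) zL.
exact: le_trans (norm2_le z) zL.
Qed.

Lemma square_compact (L : R) : compact (square L).
Proof. by apply: compact_setX; exact: segment_compact. Qed.

Lemma square_finite (L : R) : (lambda2 R (square L) < +oo)%E.
Proof.
have mi : (mu `[(- L)%R, L%R]%classic < +oo)%E.
  by rewrite lebesgue_measure_itv/=; case: ifPn => _; rewrite ltry.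
rewrite /square product_measure1E; [|exact: measurable_itv..].
apply: lte_mul_pinfty => //.
rewrite ge0_fin_numE; [exact: mi|exact: measure_ge0].
Qed.

Lemma compact_support_integrable f (L : R) : continuous f ->
  (forall z, L < `|z| -> f z = 0) ->
  (lambda2 R).-integrable setT (EFin \o f).
Proof.
move=> cf f0.
have mS : measurable (square L : set (mplane R)) by exact: measurableX.
have mf : measurable_fun setT (f : mplane R -> R).
  by apply: open_measurable_fun => [|z _]; [exact: openT|exact: cf].
have -> : EFin \o f = (EFin \o f) \_ (square L : set (mplane R)).
  apply/funext => z; rewrite patchE; case: ifPn => // /negP zS /=.
  by rewrite f0//; apply: square_out => h; apply: zS; rewrite inE.
apply/(integrable_mkcond _ mS).
apply: measurable_bounded_integrable => //; first exact: square_finite.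
  exact: measurable_funTS.
have /compact_bounded[M [_ mrt]] : compact (f @` square L).
  by apply: continuous_compact (@square_compact L); exact: continuous_subspaceT.
by exists M; split; rewrite ?num_real// => ? ? ? ?; exact: mrt.
Qed.

Lemma derive_zero_integral (F : R -> R) (L : R) : 0 < L ->
  (forall x, derivable F x 1) -> continuous (derive1 F) ->
  (forall x, L < `|x| -> derive1 F x = 0) -> (forall x, L < `|x| -> F x = 0) ->
  (\int[mu]_x (derive1 F x)%:E = 0)%E.
Proof.
move=> L0 dF cF F'0 F0.
have -> : (\int[mu]_x (derive1 F x)%:E =
    \int[mu]_(x in `[(- (L + 1))%R, (L + 1)%R]) (derive1 F x)%:E)%E.
  rewrite [RHS]integral_mkcond; apply: eq_integral => x _; rewrite patchE.
  case: ifPn => // /negP xI; rewrite F'0// ltNge; apply/negP => xL; apply: xI.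
  by rewrite inE /= in_itv /= -ler_norml; lra.
have cFF : continuous F.
  by move=> x; apply: differentiable_continuous; exact/derivable1_diffP.
rewrite (@continuous_FTC2 _ _ F).
- by rewrite !F0 ?subrr ?sube0//; rewrite ?normrN gtr0_norm; lra.
- lra.
- exact: continuous_subspaceT.
- split.
  + by move=> x _; exact: dF.
  + by apply: cvg_at_right_filter; exact: cFF.
  + by apply: cvg_at_left_filter; exact: cFF.
- by [].
Qed.

Lemma norm_pair_gt (x y L : R) : L < `|x| \/ L < `|y| -> L < `|(x, y) : plane R|.
Proof.
move=> [h|h]; first exact: lt_le_trans h (norm1_le (x, y)).
exact: lt_le_trans h (norm2_le (x, y)).
Qed.

Lemma partial_zero f (L : R) z : (forall z, L < `|z| -> f z = 0) -> L < `|z| ->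
  (partial_x f z = 0) * (partial_y f z = 0).
Proof.
move=> f0 zL; pose A : set (plane R) := [set z | L < `|z|].
have oA : open A.
  apply: (@open_comp _ _ (fun z : plane R => `|z|) [set x | L < x]); last exact: open_gt.
  by move=> w _; exact: norm_continuous.
have E w : A w -> f w = (fun=> 0) w by move=> Aw; exact: f0.
by rewrite !(partial_ext oA zL E) /partial_x /partial_y !derive_cst.
Qed.

Lemma pair_contl (y : R) : continuous (fun x : R => (x, y) : plane R).
Proof. by move=> x; exact: (cvg_pair cvg_id (cvg_cst y)). Qed.

Lemma pair_contr (x : R) : continuous (fun y : R => (x, y) : plane R).
Proof. by move=> y; exact: (cvg_pair (cvg_cst x) cvg_id). Qed.

(** By Fubini the integral is computed on lines, where it is that of the derivative of a compactly
    supported function. *)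
Lemma integral_partial f (L : R) : 0 < L -> Ck 1 setT f -> (forall z, L < `|z| -> f z = 0) ->
  (\int[lambda2 R]_z (partial_x f z)%:E = 0)%E /\ (\int[lambda2 R]_z (partial_y f z)%:E = 0)%E.
Proof.
move=> L0 [df [fx fy]] f0.
have cfx : continuous (partial_x f) by exact: (Ck_continuous (n:=0) fx).
have cfy : continuous (partial_y f) by exact: (Ck_continuous (n:=0) fy).
have Ix := compact_support_integrable cfx (fun z h => (partial_zero f0 h).1).
have Iy := compact_support_integrable cfy (fun z h => (partial_zero f0 h).2).
have Ex (x y : R) : derive1 (fun s => f (s, y)) x = partial_x f (x, y).
  by have := @slice_x _ f x y (df _ I); rewrite derive1E => -[].
have Ey (x y : R) : derive1 (fun s => f (x, s)) y = partial_y f (x, y).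
  by have := @slice_y _ f x y (df _ I); rewrite derive1E => -[].
split.
  rewrite -integral21_prod_meas1//; apply: integral0_eq => y _.
  rewrite /fubini_G /=; under eq_integral do rewrite -Ex.
  apply: (derive_zero_integral L0).
  - by move=> x; have [] := @slice_x _ f x y (df _ I).
  - rewrite (_ : derive1 _ = fun x => partial_x f (x, y)); last by apply/funext => x; exact: Ex.
    by move=> x; apply: (@continuous_comp _ _ _ (fun x => (x, y)) (partial_x f));
      [exact: pair_contl|exact: cfx].
  - by move=> x xL; rewrite Ex (partial_zero f0)//; apply: norm_pair_gt; left.
  - by move=> x xL; apply: f0; apply: norm_pair_gt; left.
rewrite -integral12_prod_meas1//; apply: integral0_eq => x _.
rewrite /fubini_F /=; under eq_integral do rewrite -Ey.
apply: (derive_zero_integral L0).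
- by move=> y; have [] := @slice_y _ f x y (df _ I).
- rewrite (_ : derive1 _ = fun y => partial_y f (x, y)); last by apply/funext => y; exact: Ey.
  by move=> y; apply: (@continuous_comp _ _ _ (fun y => (x, y)) (partial_y f));
    [exact: pair_contr|exact: cfy].
- by move=> y yL; rewrite Ey (partial_zero f0)//; apply: norm_pair_gt; right.
- by move=> y yL; apply: f0; apply: norm_pair_gt; right.
Qed.

(** [V] and the complement of the support of [phi] cover the plane, and the extended product is
    smooth on each. Nothing is assumed on [f] near the boundary of [V]. *)
Lemma extend_by_zero n V f (phi : plane R -> R) : open V -> test_function V phi ->
  Ck n V f -> let F := fun z => if `[< V z >] then f z * phi z else 0 in
  Ck n setT F /\ (exists2 L, 0 < L & forall z, L < `|z| -> F z = 0).
Proof.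
move=> oV [sphi cK KV] Cf F; set K := closure _ in cK KV.
have Cphi : Ck n setT phi by exact: ((CkP _ _).1 sphi n).
have phi0 z : ~ K z -> phi z = 0.
  move=> Kz; apply/eqP; apply: contrapT => /negP h; apply: Kz; exact: subset_closure.
have F0 z : ~ K z -> F z = 0 by move=> Kz; rewrite /F phi0// mulr0 if_same.
split; last first.
  have [L0 [_ hL]] := compact_bounded cK.
  exists (Num.max 1 (L0 + 1)); first by rewrite lt_max ltr01.
  move=> z; rewrite gt_max => /andP[z1 zL]; apply: F0 => Kz.
  have : L0 < `|z| by apply: lt_trans zL; rewrite ltrDl.
  have L01 : L0 < (L0 + `|z|) / 2 by move: zL; lra.
  by have := hL _ L01 z Kz; rewrite /= => h zL'; move: zL; lra.
have oK : open (~` K) by apply: closed_openC; exact: closed_closure.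
have CV : Ck n V F.
  apply: (Ck_ext oV (f := fun z => f z * phi z)); first by move=> z Vz; rewrite /F; case: asboolP.
  by apply: CkM => //; exact: Ck_sub Cphi.
have CK : Ck n (~` K) F.
  apply: (Ck_ext oK (f := fun=> 0)); first by move=> z Kz; rewrite F0.
  exact: Ck_cst.
apply: (Ck_cover (A := fun z => if `[< V z >] then V else ~` K)) => z _.
by case: asboolP => Vz; split => // /KV.
Qed.

(** Integration by parts: for a closed form the tested integrand is the y-partial of [omega.1 * phi]
    minus the x-partial of [omega.2 * phi], and both integrate to 0 after extension by zero. *)
Lemma smooth_weakly_closed V omega : open V ->
  Ck 1 V (fun z => (omega z).1) -> Ck 1 V (fun z => (omega z).2) ->
  (forall z, V z -> partial_y (fun z => (omega z).1) z = partial_x (fun z => (omega z).2) z) ->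
  weakly_closed V omega.
Proof.
move=> oV C1 C2 cl phi tphi.
have [CF [L L0 F0]] := extend_by_zero oV tphi C1.
have [CG [L' L0' G0]] := extend_by_zero oV tphi C2.
set F := (fun z => _) in CF F0; set G := (fun z => _) in CG G0.
have [_ IF] := integral_partial L0 CF F0; have [IG _] := integral_partial L0' CG G0.
have [dF [Fx Fy]] := CF; have [dG [Gx Gy]] := CG.
have cFy : continuous (partial_y F) by exact: (Ck_continuous (n:=0) Fy).
have cGx : continuous (partial_x G) by exact: (Ck_continuous (n:=0) Gx).
have If := compact_support_integrable cFy (fun z h => (partial_zero F0 h).2).
have Ig := compact_support_integrable cGx (fun z h => (partial_zero G0 h).1).
have [sphi cK KV] := tphi; set K := closure _ in cK KV.
have phi0 z : ~ K z -> phi z = 0.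
  move=> Kz; apply/eqP; apply: contrapT => /negP h; apply: Kz; exact: subset_closure.
have oK : open (~` K) by apply: closed_openC; exact: closed_closure.
have dphi z : differentiable phi z by exact: (sphi [::] z I).
rewrite integral_mkcond.
transitivity (\int[lambda2 R]_z ((EFin \o partial_y F) z - (EFin \o partial_x G) z))%E.
  apply: eq_integral => z _; rewrite patchE /= -EFinB; case: ifPn => [|/negP] Vz.
    have {}Vz : V z by rewrite inE in Vz.
    have EF w : V w -> F w = ((fun z => (omega z).1) \* phi) w by rewrite /F; case: asboolP.
    have EG w : V w -> G w = ((fun z => (omega z).2) \* phi) w by rewrite /G; case: asboolP.
    rewrite (partial_ext oV Vz EF) (partial_ext oV Vz EG).
    have d1 := Ck_diff C1 Vz; have d2 := Ck_diff C2 Vz.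
    by rewrite !partialM// cl//; congr EFin; ring.
  have Kz : (~` K) z by move=> /KV Vz'; apply: Vz; rewrite inE.
  have EF w : (~` K) w -> F w = (fun=> 0) w by move=> Kw; rewrite /F phi0// mulr0 if_same.
  have EG w : (~` K) w -> G w = (fun=> 0) w by move=> Kw; rewrite /G phi0// mulr0 if_same.
  rewrite (partial_ext oK Kz EF) (partial_ext oK Kz EG) /partial_x /partial_y !derive_cst.
  by rewrite subrr.
by rewrite integralB// IF IG subee.
Qed.

End PlaneMeasure.

(** * Integrals of [|z - p|^(-3/2)] and of the inverse square root of the gap *)

Section SingularIntegrals.
Context {R : realType}.
Local Notation mu := (@lebesgue_measure R).

Section Radial.
Variables (h H : R -> R) (D K : R).
Hypotheses (h0 : forall t : R, 0 <= t -> 0 <= h t)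
  (dH : forall t : R, 0 <= t -> is_derive t 1 H (h t))
  (ch : forall t : R, 0 <= t -> {for t, continuous h})
  (HK : forall s t : R, 0 <= s -> s <= t -> t - s <= D -> H t - H s <= K).

Lemma radial_cont (b : R) : continuous (fun y => h `|y - b|).
Proof.
move=> y; apply: (@continuous_comp _ _ _ (fun y => `|y - b|) h); last exact: ch.
apply: (@continuous_comp _ _ _ (fun y => y - b) (fun x => `|x|)); last exact: norm_continuous.
by apply: (@continuousB _ _ _ id (cst b)) => //; exact: cvg_cst.
Qed.

Lemma radial_right (b u v : R) : b <= u -> u <= v -> v - u <= D ->
  (\int[mu]_(y in `[u, v]) (h `|y - b|)%:E <= K%:E)%E.
Proof.
move=> bu; rewrite le_eqVlt => /predU1P[->|uv] vD.
  rewrite set_itv1 integral_set1 lee_fin -(subrr (H 0)).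
  by apply: HK => //; rewrite ?subrr//; move: vD; rewrite subrr.
have d1 (y : R) : is_derive y 1 (fun y => y - b) (1 : R).
  by have := is_deriveB (is_derive_id y (1 : R)) (is_derive_cst b y 1); rewrite subr0.
have dF y : u <= y -> is_derive y 1 (fun y => H (y - b)) (h `|y - b|).
  move=> uy; have yb : 0 <= y - b by rewrite subr_ge0; exact: le_trans uy.
  have := @is_derive1_comp _ H (fun y => y - b) y _ _ (dH yb) (d1 y).
  by rewrite mulr1 ger0_norm.
have cF y : u <= y -> {for y, continuous (fun y => H (y - b))}.
  move=> uy; apply: differentiable_continuous; apply/derivable1_diffP.
  by case: (dF y uy).
rewrite (@continuous_FTC2 _ _ (fun y => H (y - b))) //.
- rewrite -EFinB lee_fin; apply: HK; rewrite ?subr_ge0// ?lerB// ?(ltW uv)//.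
  by rewrite opprB addrA subrK.
- by apply: continuous_subspaceT; exact: radial_cont.
- split.
  + by move=> y /[!in_itv]/= /andP[uy _]; case: (dF y (ltW uy)).
  + by apply: cvg_at_right_filter; exact: cF.
  + by apply: cvg_at_left_filter; apply: cF; exact: ltW.
- move=> y /[!in_itv]/= /andP[uy _]; rewrite derive1E.
  by case: (dF y (ltW uy)).
Qed.

Lemma radial_left (b u v : R) : v <= b -> u <= v -> v - u <= D ->
  (\int[mu]_(y in `[u, v]) (h `|y - b|)%:E <= K%:E)%E.
Proof.
move=> vb uv vD.
have E := integration_by_substitution_oppr uv (continuous_subspaceT (@radial_cont (- b))).
have -> : (\int[mu]_(y in `[u, v]) (h `|y - b|)%:E =
    \int[mu]_(y in `[(- v)%R, (- u)%R]) (h `|(y - - b)%R|)%:E)%E.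
  by rewrite E; apply: eq_integral => y _; rewrite /= opprK [(- y + b)%R]addrC distrC.
by apply: radial_right; rewrite ?lerN2// opprK addrC.
Qed.

(** If [b] lies inside the interval, it is cut at [b]; each half contributes at most [K], hence the
    factor 2. *)
Lemma radial_integral (b u v : R) : u <= v -> v - u <= D ->
  (\int[mu]_(y in `[u, v]) (h `|y - b|)%:E <= (2 * K)%:E)%E.
Proof.
move=> uv vD.
have K0 : 0 <= K.
  have := HK (lexx 0) (lexx 0); rewrite !subrr; apply; apply: le_trans vD; by rewrite subr_ge0.
have K2 : K <= 2 * K by rewrite mulrDl mul1r lerDl.
have [bu|ub] := leP b u; first by apply: le_trans (radial_right bu uv vD) _; rewrite lee_fin.
have [vb|bv] := leP v b; first by apply: le_trans (radial_left vb uv vD) _; rewrite lee_fin.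
have mf (A : set R) : measurable A -> measurable_fun A (fun y => (h `|y - b|)%:E).
  move=> mA; apply/measurable_EFinP; apply: measurable_funTS.
  by apply: continuous_measurable_fun; exact: radial_cont.
rewrite (@itv_bndbnd_setU _ _ (BLeft u) (BRight b)) ?bnd_simp ?(ltW ub) ?(ltW bv)//.
rewrite ge0_integral_setU//=; last 3 first.
- by apply: mf; apply: measurableU; exact: measurable_itv.
- by move=> y _; rewrite lee_fin h0.
- rewrite disj_set2E; apply/eqP/seteqP; split => // y [] /=; rewrite !in_itv/= => /andP[_ yb] /andP[by_ _].
  by move: (le_lt_trans yb by_); rewrite ltxx.
rewrite integral_itv_obnd_cbnd; last exact: mf.
rewrite mulrDl mul1r EFinD; apply: leeD.
  by apply: radial_left; rewrite ?lexx ?ltW//; move: vD; lra.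
by apply: radial_right; rewrite ?lexx ?ltW//; move: vD; lra.
Qed.

End Radial.

Lemma sqrt_shift_derive (a t : R) : 0 < a -> 0 <= t ->
  is_derive t 1 (fun t => Num.sqrt (t + a)) ((2 * Num.sqrt (t + a))^-1).
Proof.
move=> a0 t0.
have d1 : is_derive t 1 (fun t => t + a) (1 : R).
  by have := is_deriveD (is_derive_id t (1 : R)) (is_derive_cst a t 1); rewrite addr0.
have ta : 0 < t + a by rewrite ltr_wpDl.
have := @is_derive1_comp _ Num.sqrt (fun t => t + a) t _ _ (is_derive1_sqrt ta) d1.
by rewrite mulr1.
Qed.

Lemma sqrt_shift_cont (a t : R) : {for t, continuous (fun t => Num.sqrt (t + a))}.
Proof.
apply: (@continuous_comp _ _ _ (fun t => t + a) Num.sqrt); last exact: sqrt_continuous.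
by apply: (@continuousD _ _ _ id (cst a)) => //; exact: cvg_cst.
Qed.

(** The primitive is twice a square root, whose increments are at most the square root of the
    length. The bound is free of [a] and [b], so the shift costs nothing. *)
Lemma integral_inv_sqrt (a b u v : R) : 0 < a -> u <= v ->
  (\int[mu]_(y in `[u, v]) ((Num.sqrt (`|y - b| + a))^-1)%:E <= (4 * Num.sqrt (v - u))%:E)%E.
Proof.
move=> a0 uv.
have s0 t : 0 <= t -> 0 < Num.sqrt (t + a) by move=> t0; rewrite sqrtr_gt0 ltr_wpDl.
have -> : 4 * Num.sqrt (v - u) = 2 * (2 * Num.sqrt (v - u)) by ring.
apply: (@radial_integral (fun t => (Num.sqrt (t + a))^-1) (fun t => 2 * Num.sqrt (t + a)) (v - u)) => //.
- move=> t t0; have := is_deriveZ 2 (sqrt_shift_derive a0 t0).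
  move/is_derive_eq; apply; rewrite /GRing.scale/= invfM mulrA divff ?mul1r ?pnatr_eq0//.
- by move=> t t0; apply: cvgV; [rewrite gt_eqF ?s0|exact: sqrt_shift_cont].
- move=> s t s_0 st tD; rewrite -mulrBr ler_pM2l// lerBlDr.
  rewrite -(ler_pXn2r (_ : (0 < 2)%N)) ?nnegrE ?addr_ge0 ?sqrtr_ge0// sqrrD.
  rewrite !sqr_sqrtr ?subr_ge0 ?addr_ge0 ?(le_trans s_0 st) ?(ltW a0)//.
  have := mulr_ge0 (sqrtr_ge0 (v - u)) (sqrtr_ge0 (s + a)); lra.
Qed.

Definition inv32 (t : R) : R := (t * Num.sqrt t)^-1.

(** The primitive [- 2 / Num.sqrt (t + a)] is bounded, so the length of the interval does not enter.
    With [a] a distance in the other variable, the result is an inverse square root, integrable once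
    more. *)
Lemma integral_inv32 (a b u v : R) : 0 < a -> u <= v ->
  (\int[mu]_(y in `[u, v]) (inv32 (`|y - b| + a))%:E <= (4 * (Num.sqrt a)^-1)%:E)%E.
Proof.
move=> a0 uv.
have s0 t : 0 <= t -> 0 < Num.sqrt (t + a) by move=> t0; rewrite sqrtr_gt0 ltr_wpDl.
have t_a t : 0 <= t -> 0 < t + a by move=> t0; rewrite ltr_wpDl.
have -> : 4 * (Num.sqrt a)^-1 = 2 * (2 * (Num.sqrt a)^-1) by ring.
apply: (@radial_integral (fun t => inv32 (t + a)) (fun t => - 2 * (Num.sqrt (t + a))^-1) (v - u)) => //.
- by move=> t t0 /=; rewrite invr_ge0 mulr_ge0 ?sqrtr_ge0 ?ltW ?t_a.
- move=> t t0.
  have sn : Num.sqrt (t + a) != 0 by rewrite gt_eqF ?s0.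
  have [D1 E1] := sqrt_shift_derive a0 t0.
  have dV : is_derive t 1 (fun t => (Num.sqrt (t + a))^-1)
      (- (Num.sqrt (t + a)) ^- 2 * (2 * Num.sqrt (t + a))^-1).
    apply: DeriveDef; first exact: derivableV.
    by rewrite deriveV// E1.
  have := is_deriveZ (- 2) dV; move/is_derive_eq; apply.
  rewrite /GRing.scale/= sqr_sqrtr ?(ltW (t_a _ t0))// /inv32.
  have wn : t + a != 0 by rewrite gt_eqF ?t_a.
  by field; rewrite sn wn.
- move=> t t0; apply: cvgV; first by rewrite mulf_neq0 ?gt_eqF ?s0 ?t_a.
  apply: (@continuousM _ _ (fun t => t + a) (fun t => Num.sqrt (t + a))); last exact: sqrt_shift_cont.
  by apply: (@continuousD _ _ _ id (cst a)) => //; exact: cvg_cst.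
- move=> s t s_0 st tD; have t0 := le_trans s_0 st.
  have h1 : 0 <= (Num.sqrt (t + a))^-1 by rewrite invr_ge0 sqrtr_ge0.
  have h2 : (Num.sqrt (s + a))^-1 <= (Num.sqrt a)^-1.
    by rewrite lef_pV2 ?posrE ?s0 ?sqrtr_gt0// ler_wsqrtr// lerDr.
  lra.
Qed.

Section Tonelli.
Variables (f : plane R -> R) (g : R -> R) (A B : set R).
Hypotheses (mA : measurable A) (mB : measurable B)
  (mf : measurable_fun setT (f : mplane R -> R)) (f0 : forall z, 0 <= f z)
  (mg : measurable_fun setT g).

Let F : mplane R -> \bar R := (EFin \o f) \_ (A `*` B).

Let mF : measurable_fun setT F.
Proof.
apply: (measurable_restrictT _ (measurableX mA mB)).1.
by apply/measurable_EFinP; exact: measurable_funTS.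
Qed.

Let F0 z : (0 <= F z)%E.
Proof. by rewrite /F patchE; case: ifP => // _; rewrite lee_fin. Qed.

Lemma tonelli_le : (forall x, A x -> (\int[mu]_(y in B) (f (x, y))%:E <= (g x)%:E)%E) ->
  (\int[lambda2 R]_(z in A `*` B) (f z)%:E <= \int[mu]_(x in A) (g x)%:E)%E.
Proof.
move=> fg; rewrite integral_mkcond -/F fubini_tonelli1// [leRHS]integral_mkcond.
apply: ge0_le_integral => //.
- by move=> x _; apply: integral_ge0.
- exact: measurable_fun_fubini_tonelli_F.
- by apply: (measurable_restrictT _ _).1 => //; apply/measurable_EFinP; exact: measurable_funTS.
- move=> x _; rewrite /fubini_F patchE; case: ifPn => xA; last first.
    by rewrite integral0_eq// => y _; rewrite /F patchE in_setX /= (negbTE xA).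
  rewrite inE in xA; apply: le_trans (fg x xA); rewrite [leRHS]integral_mkcond.
  by under eq_integral do rewrite /F patchE in_setX /= mem_set//.
Qed.

Lemma tonelli_le2 : (forall y, B y -> (\int[mu]_(x in A) (f (x, y))%:E <= (g y)%:E)%E) ->
  (\int[lambda2 R]_(z in A `*` B) (f z)%:E <= \int[mu]_(y in B) (g y)%:E)%E.
Proof.
move=> fg; rewrite integral_mkcond -/F fubini_tonelli2// [leRHS]integral_mkcond.
apply: ge0_le_integral => //.
- by move=> y _; apply: integral_ge0.
- exact: measurable_fun_fubini_tonelli_G.
- by apply: (measurable_restrictT _ _).1 => //; apply/measurable_EFinP; exact: measurable_funTS.
- move=> y _; rewrite /fubini_G patchE; case: ifPn => yB; last first.
    by rewrite integral0_eq// => x _; rewrite /F patchE in_setX /= (negbTE yB) andbF.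
  rewrite inE in yB; apply: le_trans (fg y yB); rewrite [leRHS]integral_mkcond.
  by under eq_integral do rewrite /F patchE in_setX /= (mem_set yB) andbT.
Qed.

End Tonelli.

Definition box (c : plane R) (L : R) : set (plane R) :=
  `[c.1 - L, c.1 + L]%classic `*` `[c.2 - L, c.2 + L]%classic.

Lemma boxP c L z : box c L z <-> `|z - c| <= L.
Proof.
rewrite plane_norm ge_max /box /= !in_itv /= -!ler_distl.
by split => [[-> ->]|/andP].
Qed.

Lemma measurable_box c L : measurable (box c L : set (mplane R)).
Proof. exact: measurableX. Qed.

Lemma continuous_norm_sub (p : plane R) : continuous (fun z : plane R => `|z - p|).
Proof.
move=> z; have h : {for z, continuous (fun w : plane R => w - p)}.
  by apply: (@continuousB _ _ _ id (cst p)) => //; exact: cvg_cst.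
exact: (continuous_comp h (@norm_continuous _ _ (z - p))).
Qed.

Lemma measurable_plane_fun (f : plane R -> R) : continuous f ->
  measurable_fun setT (f : mplane R -> R).
Proof. by move=> cf; apply: open_measurable_fun => [|z _]; [exact: openT|exact: cf]. Qed.

Lemma inv32_gt0 (t : R) : 0 < t -> 0 < inv32 t.
Proof. by move=> t0; rewrite invr_gt0 mulr_gt0// sqrtr_gt0. Qed.

Lemma inv32_le (s t : R) : 0 < s -> s <= t -> inv32 t <= inv32 s.
Proof.
move=> s0 st; have t0 := lt_le_trans s0 st.
rewrite lef_pV2 ?posrE ?mulr_gt0 ?sqrtr_gt0//.
by apply: ler_pM => //; rewrite ?(ltW s0) ?sqrtr_ge0// ler_wsqrtr.
Qed.

Lemma continuous_inv32 (f : plane R -> R) (a : R) : 0 < a -> continuous f ->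
  (forall z, 0 <= f z) -> continuous (fun z => inv32 (f z + a)).
Proof.
move=> a0 cf f0 z.
have fa : 0 < f z + a by rewrite ltr_wpDl.
apply: cvgV; first by rewrite mulf_neq0 ?gt_eqF ?sqrtr_gt0.
have c1 : {for z, continuous (fun z => f z + a)}.
  by apply: (@continuousD _ _ _ f (cst a)); [exact: cf|exact: cvg_cst].
apply: (@continuousM _ _ (fun z => f z + a) (fun z => Num.sqrt (f z + a))) => //.
by apply: (@continuous_comp _ _ _ (fun z => f z + a) Num.sqrt) => //; exact: sqrt_continuous.
Qed.

Lemma inv32_quarter (t : R) : 0 < t -> inv32 (t / 4) = 8 * inv32 t.
Proof.
move=> t0; have s4 : Num.sqrt (t / 4) = Num.sqrt t / 2.
  rewrite sqrtrM ?(ltW t0)//; congr (_ * _).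
  by rewrite (_ : 4^-1 = 2^-1 ^+ 2) ?sqrtr_sqr ?gtr0_norm ?invr_gt0//; field.
have sn : Num.sqrt t != 0 by rewrite gt_eqF ?sqrtr_gt0.
by rewrite /inv32 s4; field; rewrite sn gt_eqF.
Qed.

Lemma sqrt2_le2 : Num.sqrt 2 <= 2 :> R.
Proof.
rewrite -(ler_pXn2r (_ : (0 < 2)%N)) ?nnegrE ?sqrtr_ge0// sqr_sqrtr//.
by rewrite -natrX ler_nat.
Qed.

(** Integrating over [y] leaves [8 * 4 = 32] times an inverse square root in [x]. Integrating over
    [x] gives [32 * 4 * Num.sqrt (2 * L)], and the square root of 2 is rounded up to 2. *)
Lemma integral_box_inv32 (c p : plane R) (L a : R) : 0 < L -> 0 < a ->
  (\int[lambda2 R]_(z in box c L) (inv32 (`|z - p| + a))%:E <= (256 * Num.sqrt L)%:E)%E.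
Proof.
move=> L0 a0.
have Lc (x : R) : x - L <= x + L by lra.
pose f (z : plane R) := inv32 (`|z - p| + a).
have cf : continuous f by apply: continuous_inv32 => // z; exact: continuous_norm_sub.
have f0 z : 0 <= f z by apply/ltW/inv32_gt0; rewrite ltr_wpDl.
pose g (x : R) := 32 * (Num.sqrt (`|x - p.1| + a))^-1.
have cg0 (x : R) : {for x, continuous (fun x => (Num.sqrt (`|x - p.1| + a))^-1)}.
  apply: (@continuous_comp _ _ _ (fun y => `|y - p.1|) (fun t => (Num.sqrt (t + a))^-1)).
    apply: (@continuous_comp _ _ _ (fun y => y - p.1) (fun x => `|x|)); last exact: norm_continuous.
    by apply: (@continuousB _ _ _ id (cst p.1)) => //; exact: cvg_cst.
  apply: cvgV; last exact: sqrt_shift_cont.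
  by rewrite gt_eqF// sqrtr_gt0 ltr_wpDl.
have mg0 : measurable_fun setT (fun x : R => (Num.sqrt (`|x - p.1| + a))^-1).
  by apply: continuous_measurable_fun.
apply: (@le_trans _ _ (\int[mu]_(x in `[(c.1 - L)%R, (c.1 + L)%R]) (g x)%:E)%E).
  apply: tonelli_le => //; first exact: measurable_plane_fun.
    by apply: measurable_funM => //; exact: measurable_cst.
  move=> x _.
  have xa : 0 < `|x - p.1| + a by rewrite ltr_wpDl.
  (* The sup norm is at least the mean of the two coordinate distances; a quarter of their sum is
     used, and [inv32] turns it into the factor 8. *)
  have q y : (f (x, y) <= 8 * inv32 (`|y - p.2| + (`|x - p.1| + a))).
    have t0 : 0 < `|y - p.2| + (`|x - p.1| + a) by rewrite ltr_wpDl.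
    rewrite -inv32_quarter//; apply: inv32_le; first by rewrite divr_gt0.
    have := norm1_le ((x, y) - p); have := norm2_le ((x, y) - p) => /= h2 h1.
    have := normr_ge0 (x - p.1); have := normr_ge0 (y - p.2).
    move: h1 h2; move: `|(x, y) - p| => n; lra.
  have cq : continuous (fun y : R => inv32 (`|y - p.2| + (`|x - p.1| + a))).
    move=> y; apply: (@radial_cont (fun t => inv32 (t + (`|x - p.1| + a)))) => t t0.
    have ta : 0 < t + (`|x - p.1| + a) by rewrite ltr_wpDl.
    apply: cvgV; first by rewrite mulf_neq0 ?gt_eqF ?sqrtr_gt0.
    apply: (@continuousM _ _ (fun t => t + _) (fun t => Num.sqrt (t + _))); last exact: sqrt_shift_cont.
    by apply: (@continuousD _ _ _ id (cst _)) => //; exact: cvg_cst.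
  have mq : measurable_fun setT (fun y : R => inv32 (`|y - p.2| + (`|x - p.1| + a))).
    exact: continuous_measurable_fun.
  have I2 := integral_inv32 p.2 xa (Lc c.2).
  apply: (@le_trans _ _ (8%:E * \int[mu]_(y in `[(c.2 - L)%R, (c.2 + L)%R])
      (inv32 (`|y - p.2| + (`|x - p.1| + a)))%:E)%E).
    rewrite -ge0_integralZl_EFin//; last 2 first.
    - by move=> y _; rewrite lee_fin; apply/ltW/inv32_gt0; rewrite ltr_wpDl.
    - by apply/measurable_EFinP; exact: measurable_funTS.
    apply: ge0_le_integral => //.
    - by move=> y _; rewrite lee_fin; exact: f0.
    - apply/measurable_EFinP; apply: measurable_funTS; apply: continuous_measurable_fun => y.
      by apply: (@continuous_comp _ _ _ (fun y => (x, y)) f); [exact: pair_contr|exact: cf].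
    - by apply/measurable_EFinP; apply: measurable_funM => //; apply: measurable_funTS.
    - by move=> y _; rewrite -EFinM lee_fin; exact: q.
  apply: (le_trans (lee_wpmul2l _ I2)); first by rewrite lee_fin.
  by rewrite -EFinM lee_fin /g mulrA -natrM.
rewrite /g; under eq_integral do rewrite EFinM.
rewrite ge0_integralZl_EFin//; last first.
  by apply/measurable_EFinP; exact: measurable_funTS.
apply: (le_trans (lee_wpmul2l _ (integral_inv_sqrt p.1 a0 (Lc c.1)))); first by rewrite lee_fin.
rewrite -EFinM lee_fin mulrA -natrM.
have -> : c.1 + L - (c.1 - L) = 2 * L by ring.
rewrite sqrtrM//; have s2 := sqrt2_le2.
rewrite mulrA ler_wpM2r ?sqrtr_ge0//.
apply: (le_trans (ler_wpM2l _ s2)) => //.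
by rewrite -natrM ler_nat.
Qed.

Definition disk_gap (z : plane R) : R := 1 - Num.sqrt (nsq z).

Definition udisk : set (plane R) := [set z | 0 < 1 - nsq z].

Lemma continuous_nsq : continuous (nsq : plane R -> R).
Proof.
have := @Ck_continuous R 0 _ (Ck_nsq 0 0).
by under eq_fun do rewrite subr0.
Qed.

Lemma open_udisk : open udisk.
Proof.
apply: open_gt0 => z; have h1 : {for z, continuous (fun _ : plane R => 1 : R)} by exact: cvg_cst.
exact: (continuousB h1 (continuous_nsq (x:=z))).
Qed.

Lemma disk_gap_gt0 z : udisk z -> 0 < disk_gap z.
Proof.
rewrite /udisk /= !subr_gt0 => z1; rewrite -(ltr_pXn2r (_ : (0 < 2)%N)) ?nnegrE ?sqrtr_ge0//.
by rewrite expr1n sqr_sqrtr// addr_ge0 ?sqr_ge0.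
Qed.

Lemma continuous_disk_gap : continuous disk_gap.
Proof.
move=> z; have h1 : {for z, continuous (fun _ : plane R => 1 : R)} by exact: cvg_cst.
exact: (continuousB h1 (continuous_comp (continuous_nsq (x:=z)) (@sqrt_continuous R (nsq z)))).
Qed.

Lemma continuous_gapw (a : R) z : 0 < a -> udisk z ->
  {for z, continuous (fun z => (Num.sqrt (disk_gap z + a))^-1)}.
Proof.
move=> a0 /disk_gap_gt0 g0.
have h1 : {for z, continuous (fun _ : plane R => a)} by exact: cvg_cst.
have h2 := continuousD (continuous_disk_gap (x:=z)) h1.
apply: cvgV; first by rewrite gt_eqF// sqrtr_gt0 addr_gt0.
exact: (continuous_comp h2 (@sqrt_continuous R _)).
Qed.

(* On one of the two families of chords the distance to the circle is comparable with the
   distance to the end points of the chord. *)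
Definition chord_weight (a x y : R) : R :=
  (Num.sqrt (`|y - Num.sqrt (1 - x ^+ 2)| + a))^-1 +
  (Num.sqrt (`|y - - Num.sqrt (1 - x ^+ 2)| + a))^-1.

Lemma disk_gap_chord (a x y : R) : 0 < a -> nsq (x, y) < 1 -> x ^+ 2 <= 9 / 16 ->
  (Num.sqrt (disk_gap (x, y) + a))^-1 <= 2 * chord_weight a x y.
Proof.
move=> a0 d1 x9; set s := Num.sqrt (1 - x ^+ 2).
have sE : s ^+ 2 = 1 - x ^+ 2 by rewrite sqr_sqrtr//; lra.
have s0 : 0 <= s by exact: sqrtr_ge0.
have s12 : 1 / 2 <= s.
  by rewrite -(ler_pXn2r (_ : (0 < 2)%N)) ?nnegrE// sE; lra.
set q := Num.sqrt (nsq (x, y)).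
have q0 : 0 <= q by exact: sqrtr_ge0.
have nE : nsq (x, y) = x ^+ 2 + y ^+ 2 by [].
have qE : q ^+ 2 = x ^+ 2 + y ^+ 2 by rewrite sqr_sqrtr // nE addr_ge0 ?sqr_ge0.
have q1 : q < 1 by rewrite -(ltr_pXn2r (_ : (0 < 2)%N)) ?nnegrE// qE expr1n -nE.
have ys : `|y| < s.
  by rewrite -(ltr_pXn2r (_ : (0 < 2)%N)) ?nnegrE// sE real_normK ?num_real//; rewrite nE in d1; lra.
(* [s] is half the length of the chord at [x]. Both [(s - |y|) * (s + |y|)] and [(1 - q) * (1 + q)]
   equal [1 - q ^+ 2], with [s + |y| >= 1 / 2] and [1 + q <= 2]. *)
have gap : (s - `|y|) / 4 <= 1 - q.
  have y2 : `|y| ^+ 2 = y ^+ 2 by rewrite real_normK ?num_real.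
  have := normr_ge0 y; nra.
have ga : 0 < (s - `|y| + a) / 4 by rewrite divr_gt0//; lra.
have key (w : R) : 0 < w -> w <= s - `|y| + a -> (Num.sqrt (disk_gap (x, y) + a))^-1 <= 2 * (Num.sqrt w)^-1.
  move=> w0 ws; have h : w / 4 <= disk_gap (x, y) + a.
    by rewrite /disk_gap -/q; lra.
  have s4 : Num.sqrt (w / 4) = Num.sqrt w / 2.
    rewrite sqrtrM ?(ltW w0)//; congr (_ * _).
    by rewrite (_ : 4^-1 = 2^-1 ^+ 2) ?sqrtr_sqr ?gtr0_norm ?invr_gt0//; field.
  have -> : 2 * (Num.sqrt w)^-1 = (Num.sqrt (w / 4))^-1.
    by rewrite s4 invfM invrK mulrC.
  rewrite lef_pV2 ?posrE ?sqrtr_gt0 ?divr_gt0//; last by apply: lt_le_trans h; rewrite divr_gt0.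
  exact: ler_wsqrtr.
rewrite /chord_weight -/s.
have [y0|y0] := leP 0 y.
  apply: le_trans (key (`|y - s| + a) _ _) _.
  - by rewrite ltr_wpDl.
  - by rewrite distrC ger0_norm ?subr_ge0; move: ys; rewrite (ger0_norm y0) => ys; [|exact: ltW].
  by rewrite ler_pM2l// lerDl invr_ge0 sqrtr_ge0.
apply: le_trans (key (`|y - - s| + a) _ _) _.
- by rewrite ltr_wpDl.
- by move: ys; rewrite (ltr0_norm y0) opprK => ys; rewrite ger0_norm; lra.
by rewrite ler_pM2l// lerDr invr_ge0 sqrtr_ge0.
Qed.

Lemma chord_weight_ge0 a x y : 0 <= chord_weight a x y.
Proof. by rewrite addr_ge0// invr_ge0 sqrtr_ge0. Qed.

(** In the disk the squares of the coordinates cannot both exceed 9/16, so one family of chords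
    applies; the sum of both weights avoids splitting the domain. *)
Lemma disk_gap_weight (a : R) (z : plane R) : 0 < a -> nsq z < 1 ->
  (Num.sqrt (disk_gap z + a))^-1 <= 2 * chord_weight a z.1 z.2 + 2 * chord_weight a z.2 z.1.
Proof.
case: z => x y a0 d1 /=.
have c1 := chord_weight_ge0 a x y; have c2 := chord_weight_ge0 a y x.
have [x9|x9] := leP (x ^+ 2) (9 / 16).
  by apply: le_trans (disk_gap_chord a0 d1 x9) _; lra.
have nE : nsq (x, y) = nsq (y, x) by rewrite /nsq addrC.
have -> : disk_gap (x, y) = disk_gap (y, x) by rewrite /disk_gap nE.
rewrite nE in d1.
apply: le_trans (disk_gap_chord a0 d1 _) _; last by lra.
by move: d1; rewrite /nsq /=; lra.
Qed.

Lemma continuous_chord a : 0 < a -> continuous (fun z : plane R => chord_weight a z.1 z.2) /\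
  continuous (fun z : plane R => chord_weight a z.2 z.1).
Proof.
move=> a0.
have H (f g : plane R -> R) : continuous f -> continuous g ->
    continuous (fun z => (Num.sqrt (`|g z - f z| + a))^-1).
  move=> cf cg z.
  apply: (@continuous_comp _ _ _ (fun z => `|g z - f z|) (fun t => (Num.sqrt (t + a))^-1)).
    apply: (@continuous_comp _ _ _ (fun z => g z - f z) (fun x => `|x|)); last exact: norm_continuous.
    by apply: (@continuousB _ _ _ g f); [exact: cg|exact: cf].
  apply: cvgV; last exact: sqrt_shift_cont.
  by rewrite gt_eqF// sqrtr_gt0 ltr_wpDl.
have S (f : plane R -> R) : continuous f -> continuous (fun z => Num.sqrt (1 - f z ^+ 2)).
  move=> cf z; apply: (@continuous_comp _ _ _ (fun z => 1 - f z ^+ 2) Num.sqrt); last exact: sqrt_continuous.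
  have h1 : {for z, continuous (fun _ : plane R => 1 : R)} by exact: cvg_cst.
  exact: (continuousB h1 (continuousM (cf z) (cf z))).
have N (f : plane R -> R) : continuous f -> continuous (fun z => - f z).
  by move=> cf z; apply: continuousN; exact: cf.
have c1 : continuous (fst : plane R -> R) by move=> z; exact: cvg_fst.
have c2 : continuous (snd : plane R -> R) by move=> z; exact: cvg_snd.
split=> z.
  exact: (continuousD (H _ _ (S _ c1) c2 z) (H _ _ (N _ (S _ c1)) c2 z)).
exact: (continuousD (H _ _ (S _ c2) c1 z) (H _ _ (N _ (S _ c2)) c1 z)).
Qed.

Lemma integral_chord (a x u v : R) : 0 < a -> u <= v ->
  (\int[mu]_(y in `[u, v]) (chord_weight a x y)%:E <= (8 * Num.sqrt (v - u))%:E)%E.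
Proof.
move=> a0 uv.
have m (b : R) : measurable_fun `[u, v] (fun y => ((Num.sqrt (`|y - b| + a))^-1)%:E).
  apply/measurable_EFinP; apply: measurable_funTS; apply: continuous_measurable_fun.
  apply: (@radial_cont (fun t => (Num.sqrt (t + a))^-1)) => t t0.
  by apply: cvgV; [rewrite gt_eqF// sqrtr_gt0 ltr_wpDl|exact: sqrt_shift_cont].
rewrite /chord_weight; under eq_integral do rewrite EFinD.
rewrite ge0_integralD//; try exact: m; try by move=> y _; rewrite lee_fin invr_ge0 sqrtr_ge0.
have -> : 8 * Num.sqrt (v - u) = 4 * Num.sqrt (v - u) + 4 * Num.sqrt (v - u) by ring.
by rewrite EFinD; apply: leeD; exact: integral_inv_sqrt.
Qed.

(** On each chord the weight integrates to at most [16 * Num.sqrt L], and the chords fill a width of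
    [2 * L]. Two families with coefficient 2 give [4 * 32 = 128]. *)
Lemma integral_box_gap (c : plane R) (L a : R) (D : set (mplane R)) : 0 < L -> 0 < a ->
  measurable D -> D `<=` box c L -> (forall z, D z -> nsq z < 1) ->
  (\int[lambda2 R]_(z in D) ((Num.sqrt (disk_gap z + a))^-1)%:E <= (128 * L * Num.sqrt L)%:E)%E.
Proof.
move=> L0 a0 mD DL D1.
have Lc (x : R) : x - L <= x + L by lra.
have [c1 c2] := continuous_chord a0.
have m1 := measurable_plane_fun c1; have m2 := measurable_plane_fun c2.
have LE (x : R) : x + L - (x - L) = 2 * L by ring.
have s2 := sqrt2_le2.
have s2L : Num.sqrt (2 * L) <= 2 * Num.sqrt L.
  by rewrite sqrtrM// ler_wpM2r ?sqrtr_ge0.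
have cint (x k : R) : (\int[mu]_(y in `[(x - L)%R, (x + L)%R]) k%:E = (k * (2 * L))%:E)%E.
  have mI : measurable (`[x - L, x + L]%classic : set (measurableTypeR R)) by [].
  have := integral_cst (@lebesgue_measure R) mI k%:E.
  rewrite /cst => ->; rewrite EFinM; congr (_ * _)%E.
  have := @lebesgue_measure_itv R `[x - L, x + L]; rewrite /= lte_fin ifT; last by lra.
  by rewrite -EFinB LE.
have I1 : (\int[lambda2 R]_(z in box c L) (chord_weight a z.1 z.2)%:E <= (32 * L * Num.sqrt L)%:E)%E.
  apply: (@le_trans _ _ (\int[mu]_(x in `[(c.1 - L)%R, (c.1 + L)%R]) (16 * Num.sqrt L)%:E)%E).
    apply: (@tonelli_le (fun z => chord_weight a z.1 z.2) (fun=> 16 * Num.sqrt L)) => //.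
    - by move=> z; exact: chord_weight_ge0.
    - move=> x _; apply: (le_trans (integral_chord x a0 (Lc c.2))).
      by rewrite lee_fin LE; move: s2L; lra.
  by rewrite cint lee_fin; lra.
have I2 : (\int[lambda2 R]_(z in box c L) (chord_weight a z.2 z.1)%:E <= (32 * L * Num.sqrt L)%:E)%E.
  apply: (@le_trans _ _ (\int[mu]_(x in `[(c.2 - L)%R, (c.2 + L)%R]) (16 * Num.sqrt L)%:E)%E).
    apply: (@tonelli_le2 (fun z => chord_weight a z.2 z.1) (fun=> 16 * Num.sqrt L)) => //.
    - by move=> z; exact: chord_weight_ge0.
    - move=> x _; apply: (le_trans (integral_chord x a0 (Lc c.1))).
      by rewrite lee_fin LE; move: s2L; lra.
  by rewrite cint lee_fin; lra.
pose W (z : plane R) := 2 * chord_weight a z.1 z.2 + 2 * chord_weight a z.2 z.1.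
have mW : measurable_fun setT (W : mplane R -> R).
  by apply: measurable_funD; apply: measurable_funM => //; exact: measurable_cst.
have W0 z : 0 <= W z by rewrite addr_ge0// mulr_ge0// chord_weight_ge0.
apply: (@le_trans _ _ (\int[lambda2 R]_(z in D) (W z)%:E)%E).
  apply: ge0_le_integral => //.
  - apply/measurable_EFinP; apply: (@measurable_funS _ _ _ _ (udisk : set (mplane R))).
    + by apply: open_measurable_plane; exact: open_udisk.
    + by move=> z /D1; rewrite /udisk /= subr_gt0.
    + by apply: open_measurable_fun; [exact: open_udisk|move=> z; exact: continuous_gapw].
  - by apply/measurable_EFinP; exact: measurable_funTS.
  - by move=> z Dz; rewrite lee_fin; apply: disk_gap_weight => //; exact: D1.
apply: (@le_trans _ _ (\int[lambda2 R]_(z in box c L) (W z)%:E)%E).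
  apply: ge0_subset_integral => //; first exact: measurable_box.
    by apply/measurable_EFinP; exact: measurable_funTS.
  by move=> z _; rewrite lee_fin; exact: W0.
rewrite [leLHS](_ : _ = \int[lambda2 R]_(z in box c L)
   (2%:E * (chord_weight a z.1 z.2)%:E + 2%:E * (chord_weight a z.2 z.1)%:E))%E; last first.
  by apply: eq_integral => z _; rewrite -!EFinM -EFinD.
have mb := measurable_box c L.
have M1 : measurable_fun (box c L : set (mplane R)) (fun z : mplane R => (chord_weight a z.1 z.2)%:E).
  by apply/measurable_EFinP; exact: measurable_funTS.
have M2 : measurable_fun (box c L : set (mplane R)) (fun z : mplane R => (chord_weight a z.2 z.1)%:E).
  by apply/measurable_EFinP; exact: measurable_funTS.
rewrite ge0_integralD//; last 4 first.
- by move=> z _; rewrite -EFinM lee_fin mulr_ge0// chord_weight_ge0.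
- exact: measurable_funeM.
- by move=> z _; rewrite -EFinM lee_fin mulr_ge0// chord_weight_ge0.
- exact: measurable_funeM.
rewrite !ge0_integralZl_EFin//; try by move=> z _; rewrite lee_fin chord_weight_ge0.
pose k := 32 * L * Num.sqrt L.
apply: (@le_trans _ _ (2%:E * k%:E + 2%:E * k%:E)%E).
  by apply: leeD; apply: lee_wpmul2l => //; rewrite lee_fin.
by rewrite -!EFinM -EFinD lee_fin /k; lra.
Qed.

End SingularIntegrals.

(** * Equally spread poles in a connected set and their average *)

Section SpreadPoints.
Context {R : realType}.
Implicit Types (U : set (plane R)) (z p : plane R).

(** Intermediate values of the distance to [p0]. The shape of a hole enters the construction of the
    poles in this way only. *)
Lemma connected_reach U p0 p1 (t : R) : connected U -> U p0 -> U p1 ->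
  0 <= t -> t <= `|p1 - p0| -> exists2 p, U p & `|p - p0| = t.
Proof.
move=> cU U0 U1 t0 t1.
pose d (z : plane R) : R := `|z - p0|.
have cd : continuous d by exact: continuous_norm_sub.
have cI : connected (d @` U).
  by apply: connected_continuous_connected => //; exact: continuous_subspaceT.
have iI : is_interval (d @` U) by apply/connected_intervalP.
have [|||p Up dp] := iI (d p0) (d p1) _ _ t; [by exists p0|by exists p1| |by exists p].
by rewrite /d subrr normr0 t0 t1.
Qed.

Lemma ball_plane p (e : R) z : ball p e z <-> `|z - p| < e.
Proof. by rewrite -ball_normE /= distrC. Qed.

(** Compactness of [[0, l]] makes the clearance around the chosen points independent of the distance
    [t]. *)
Lemma uniform_reach U p0 (l : R) : open U -> 0 < l ->
  (forall t, 0 <= t -> t <= l -> exists2 p, U p & `|p - p0| = t) ->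
  exists2 e : R, 0 < e & forall t, 0 <= t -> t <= l ->
    exists2 p, `|p - p0| = t & forall z, `|z - p| < e -> U z.
Proof.
move=> oU l0 reach.
(* The absolute value gives a meaning to the negative parameters that belong to a neighbourhood of
   0. *)
pose P (e t : R) := exists2 p, `|p - p0| = `|t| & forall z, `|z - p| < e -> U z.
have cK : compact `[0, l] by exact: segment_compact.
have /compact_near_coveringP cov := cK.
suff eK : \forall e \near (0 : R)^'+, `[0, l] `<=` P e.
  have [e [e0 He]] := filter_ex (filterI (nbhs_right_gt (0 : R)) eK).
  exists e => // t t0 tl; have [|p] := He t; first by rewrite /= in_itv /= t0 tl.
  by rewrite (ger0_norm t0) => pE pU; exists p.
apply: cov => t.
rewrite /= in_itv /= => /andP[t0 tl].
have [p Up pE] := reach t t0 tl.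
have /nbhs_ballP[r /= r0 rU] := open_nbhs_nbhs (conj oU Up).
have r20 : 0 < r / 2 by rewrite divr_gt0.
near=> t' e.
have tt : `|t' - t| < r / 2.
  by rewrite distrC; near: t'; apply: nbhsx_ballx => //.
have er : e < r / 2 by near: e; apply: nbhs_right_lt.
(* A point at distance [t] is scaled about [p0] to distance [|t'|]; for [t = 0] there is no
   direction to scale along, and a horizontal shift is used. *)
have move_to : exists2 p', `|p' - p0| = `|t'| & `|p' - p| <= `|t' - t|.
  move: t0; rewrite le_eqVlt => /predU1P[tz|tp].
    exists (p0 + (t', 0)).
      by rewrite addrC addKr plane_norm /= normr0; apply/max_idPl.
    have -> : p = p0 by apply/eqP; rewrite -subr_eq0 -normr_eq0 pE -tz.
    by rewrite addrC addKr plane_norm /= normr0 -tz subr0 ge_max lexx normr_ge0.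
  exists (p0 + (`|t'| / t) *: (p - p0)).
    rewrite addrC addKr normrZ pE normrM normr_id normfV (gtr0_norm tp).
    by rewrite divfK ?gt_eqF.
  have -> : p0 + (`|t'| / t) *: (p - p0) - p = ((`|t'| - t) / t) *: (p - p0).
    rewrite mulrBl divff ?gt_eqF// scalerBl scale1r opprB addrA.
    by congr (_ - _); exact: addrC.
  rewrite normrZ pE normrM normfV (gtr0_norm tp) divfK ?gt_eqF//.
  by rewrite -{1}(gtr0_norm tp) ler_dist_dist.
have [p' p'E p'p] := move_to.
exists p' => // z zp'; apply: rU; apply/ball_plane.
have -> : z - p = (z - p') + (p' - p) by rewrite addrA subrK.
apply: le_lt_trans (ler_normD _ _) _; rewrite [r]splitr; apply: ltrD.
  exact: lt_trans er.
exact: le_lt_trans tt.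
Unshelve. all: by end_near. Qed.

(** The clearance equals the mesh [l / n]. Off [U] the mesh can therefore be added to a distance
    from a pole at the cost of a constant factor, which removes the singularity. This forces [n] to
    be large, depending on [U]. *)
Definition spread_points U p0 (l : R) (n : nat) (P : nat -> plane R) :=
  forall i, (i < n)%N -> [/\ U (P i), `|P i - p0| = i%:R * (l / n%:R) &
    forall z, ~ U z -> l / n%:R <= `|z - P i|].

Lemma exists_spread_points U p0 p1 (l : R) : open U -> connected U -> U p0 -> U p1 ->
  0 < l -> l <= `|p1 - p0| ->
  exists N, forall n, (N <= n)%N -> exists P, spread_points U p0 l n P.
Proof.
move=> oU cU U0 U1 l0 lp.
have [|e e0 He] := @uniform_reach U p0 l oU l0.
  by move=> t t0 tl; apply: connected_reach U1 t0 _ => //; exact: le_trans lp.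
pose N := (Num.truncn (l / e)).+1.
have Nle : l / e < N%:R by exact: truncnS_gt.
exists N => n Nn.
have n0 : 0 < n%:R :> R by rewrite ltr0n; exact: leq_trans Nn.
have le_e : l / n%:R <= e.
  rewrite ler_pdivrMr// mulrC -ler_pdivrMr//; apply/ltW/(lt_le_trans Nle).
  by rewrite ler_nat.
have pt (i : nat) : exists p, (i < n)%N ->
    `|p - p0| = i%:R * (l / n%:R) /\ forall z, `|z - p| < e -> U z.
  case: (ltnP i n) => [i_n|]; last by exists p0.
  have [||p p1' p2] := He (i%:R * (l / n%:R)).
  - by rewrite mulr_ge0// divr_ge0// ltW.
  - by rewrite mulrA ler_pdivrMr// mulrC ler_pM2l// ler_nat ltnW.
  by exists p.
have [P HP] := choice pt; exists P => i i_n.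
have [PE PU] := HP i i_n; split => //; first by apply: PU; rewrite subrr normr0.
move=> z Uz; apply: le_trans le_e _; rewrite leNgt; apply/negP => h.
exact: Uz (PU z h).
Qed.

(** A sum of squares weighted by [c i] is nonnegative; it is evaluated at the minimizer [U / C]. *)
Lemma cauchy_weighted (I : Type) (r : seq I) (u c : I -> R) :
  (forall i, 0 < c i) ->
  (\sum_(i <- r) u i) ^+ 2 <= (\sum_(i <- r) c i) * \sum_(i <- r) (u i ^+ 2 / c i).
Proof.
move=> c0; case: r => [|i0 r]; first by rewrite !big_nil mul0r expr0n.
set s := i0 :: r; set C := \sum_(i <- s) c i; set U := \sum_(i <- s) u i; set V := \sum_(i <- s) _.
have Cp : 0 < C by rewrite /C big_cons ltr_pwDl// sumr_ge0// => i _; exact: ltW.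
have Cn0 : C != 0 by rewrite gt_eqF.
have E lam : \sum_(i <- s) c i * (lam - u i / c i) ^+ 2 = lam ^+ 2 * C - 2 * lam * U + V.
  rewrite /C /U /V !mulr_sumr -sumrB -big_split /=; apply: eq_bigr => i _.
  by field; rewrite gt_eqF.
have : 0 <= \sum_(i <- s) c i * (U / C - u i / c i) ^+ 2.
  by apply: sumr_ge0 => i _; rewrite mulr_ge0 ?sqr_ge0// ltW.
rewrite E.
have -> : (U / C) ^+ 2 * C - 2 * (U / C) * U + V = (C * V - U ^+ 2) / C by field.
by rewrite pmulr_lge0 ?invr_gt0// subr_ge0.
Qed.

(* A primitive of [t |-> |t - x|^(-1/2)]. *)
Definition sgn_sqrt (x t : R) : R :=
  if x <= t then 2 * Num.sqrt (t - x) else - (2 * Num.sqrt (x - t)).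

Lemma sqrtD_le (a b : R) : 0 <= a -> 0 <= b -> Num.sqrt (a + b) <= Num.sqrt a + Num.sqrt b.
Proof.
move=> a0 b0; rewrite -(ler_pXn2r (_ : (0 < 2)%N)) ?nnegrE ?addr_ge0 ?sqrtr_ge0//.
rewrite sqrrD !sqr_sqrtr ?addr_ge0//.
have := mulr_ge0 (sqrtr_ge0 a) (sqrtr_ge0 b); lra.
Qed.

Lemma sqrt_incr (a h : R) : 0 <= a -> 0 < h ->
  h / Num.sqrt (a + h) <= 2 * Num.sqrt (a + h) - 2 * Num.sqrt a.
Proof.
move=> a0 h0; have s0 : 0 < Num.sqrt (a + h) by rewrite sqrtr_gt0 ltr_wpDl.
rewrite ler_pdivrMr//.
have E1 : Num.sqrt (a + h) * Num.sqrt (a + h) = a + h.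
  by rewrite -expr2 sqr_sqrtr// addr_ge0// ltW.
have E2 : Num.sqrt a * Num.sqrt a = a by rewrite -expr2 sqr_sqrtr.
have := sqr_ge0 (Num.sqrt (a + h) - Num.sqrt a).
rewrite expr2; nra.
Qed.

(** On [[a, a + h]] the integrand [|t - x|^(-1/2)] is at least its value at distance [|x - a| + h],
    so each term of the Riemann sum lies below an integral. *)
Lemma sgn_sqrt_incr (x a h : R) : 0 < h ->
  h / Num.sqrt (`|x - a| + h) <= sgn_sqrt x (a + h) - sgn_sqrt x a.
Proof.
move=> h0; rewrite /sgn_sqrt.
have [xa|ax] := leP x a.
  rewrite ifT; last by apply: le_trans xa _; rewrite lerDl ltW.
  rewrite distrC ger0_norm ?subr_ge0//.
  have -> : a + h - x = a - x + h by ring.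
  by apply: sqrt_incr => //; rewrite subr_ge0.
rewrite gtr0_norm ?subr_gt0// opprK.
have s0 : 0 < Num.sqrt (x - a + h) by rewrite sqrtr_gt0 addr_gt0// subr_gt0.
have [xh|hx] := leP x (a + h).
  have -> : 2 * Num.sqrt (a + h - x) + 2 * Num.sqrt (x - a) =
    2 * (Num.sqrt (a + h - x) + Num.sqrt (x - a)) by ring.
  have h1 : Num.sqrt h <= Num.sqrt (a + h - x) + Num.sqrt (x - a).
    apply: le_trans (sqrtD_le _ _); rewrite ?subr_ge0// ?(ltW ax)//.
    by have -> : a + h - x + (x - a) = h by ring.
  have h2 : h / Num.sqrt (x - a + h) <= Num.sqrt h.
    rewrite ler_pdivrMr// -{1}[h]sqr_sqrtr ?(ltW h0)// expr2 ler_pM2l ?sqrtr_gt0//.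
    by rewrite ler_wsqrtr// lerDr subr_ge0 ltW.
  by have := sqrtr_ge0 h; lra.
have xh : 0 <= x - (a + h) by rewrite subr_ge0 ltW.
have E : x - (a + h) + h = x - a by ring.
rewrite [leRHS]addrC; apply: (@le_trans _ _ (h / Num.sqrt (x - a))); last first.
  by have := sqrt_incr xh h0; rewrite E.
rewrite ler_pM2l// lef_pV2 ?posrE ?sqrtr_gt0 ?subr_gt0//; last by rewrite addr_gt0// subr_gt0.
by rewrite ler_wsqrtr// lerDl ltW.
Qed.

(** The increments of the primitive telescope, and the integral of [|t - x|^(-1/2)] over [[0, l]] is
    at most [4 * Num.sqrt l] for every [x], uniformly in [n]. *)
Lemma riemann_sqrt (x l : R) (n : nat) : 0 <= x -> 0 < l -> (0 < n)%N ->
  n%:R^-1 * \sum_(i < n) (Num.sqrt (`|x - i%:R * (l / n%:R)| + l / n%:R))^-1 <= 4 / Num.sqrt l.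
Proof.
move=> x0 l0 n0; have n0R : 0 < n%:R :> R by rewrite ltr0n.
set h := l / n%:R; have h0 : 0 < h by rewrite divr_gt0.
have sl : 0 < Num.sqrt l by rewrite sqrtr_gt0.
suff H : h * \sum_(i < n) (Num.sqrt (`|x - i%:R * h| + h))^-1 <= 4 * Num.sqrt l.
  rewrite ler_pdivlMr// -(ler_pM2r sl).
  have -> : 4 * Num.sqrt l = 4 * Num.sqrt l by [].
  apply: le_trans H; rewrite le_eqVlt; apply/orP; left; apply/eqP.
  rewrite -mulrA -expr2 sqr_sqrtr ?ltW// /h; ring.
apply: (@le_trans _ _ (\sum_(0 <= i < n) (sgn_sqrt x (i.+1%:R * h) - sgn_sqrt x (i%:R * h)))).
  rewrite mulr_sumr big_mkord; apply: ler_sum => i _.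
  by rewrite -natr1 mulrDl mul1r; exact: sgn_sqrt_incr.
rewrite telescope_sumr// mul0r.
have -> : n%:R * h = l by rewrite /h mulrC divfK// gt_eqF.
rewrite /sgn_sqrt; have [xl|lx] := leP x l.
  have -> : (if x <= 0 then 2 * Num.sqrt (0 - x) else - (2 * Num.sqrt (x - 0))) = - (2 * Num.sqrt x).
    case: (leP x 0) => xn; last by rewrite subr0.
    have -> : x = 0 by apply/eqP; rewrite eq_le xn.
    by rewrite subr0 sqrtr0 mulr0 oppr0.
  have h1 : Num.sqrt (l - x) <= Num.sqrt l by rewrite ler_wsqrtr// gerBl.
  have h2 : Num.sqrt x <= Num.sqrt l by rewrite ler_wsqrtr.
  lra.
rewrite ifF; last by apply/negbTE; rewrite -ltNge; exact: lt_trans lx.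
rewrite subr0 opprK.
have xl : 0 <= x - l by rewrite subr_ge0 ltW.
have := sqrtD_le xl (ltW l0); rewrite subrK.
have := sqrtr_ge0 l; lra.
Qed.

Definition avg_inv (n : nat) (P : nat -> plane R) z : R :=
  n%:R^-1 * \sum_(i < n) `|z - P i|^-1.

Lemma avg_inv_ge0 n P z : 0 <= avg_inv n P z.
Proof. by rewrite mulr_ge0// sumr_ge0// => i _; rewrite invr_ge0. Qed.

(** Cauchy-Schwarz with the weights [c i], which see [z] only through its distance [x] from [p0].
    Their mean is the Riemann sum above, and what remains is a mean of [inv32]. The constant is
    [4 * 16]. *)
Lemma avg_inv_sqr (p0 : plane R) (l : R) (n : nat) P z : (0 < n)%N -> 0 < l ->
  (forall i, (i < n)%N -> `|P i - p0| = i%:R * (l / n%:R) /\ l / n%:R <= `|z - P i|) ->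
  avg_inv n P z ^+ 2 <=
  64 / Num.sqrt l * (n%:R^-1 * \sum_(i < n) inv32 (`|z - P i| + l / n%:R)).
Proof.
move=> n0 l0 HP; have n0R : 0 < n%:R :> R by rewrite ltr0n.
set h := l / n%:R in HP *; have h0 : 0 < h by rewrite divr_gt0.
have d0 (i : 'I_n) : 0 < `|z - P i| by apply: lt_le_trans h0 _; case: (HP i (ltn_ord i)).
pose x := `|z - p0|; have x0 : 0 <= x by exact: normr_ge0.
pose c (i : 'I_n) := (Num.sqrt (`|x - i%:R * h| + h))^-1.
have w0 (i : 'I_n) : 0 < `|x - i%:R * h| + h by rewrite ltr_wpDl.
have c0 i : 0 < c i by rewrite invr_gt0 sqrtr_gt0.
(* By the reverse triangle inequality [|x - i%:R * h|] is at most the distance [d] to the pole, so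
   dividing by [c i] costs a multiple of [Num.sqrt d] and turns [d ^- 2] into [inv32 d]. Since
   [h <= d], the shift by [h] costs the factor 8. *)
have key (i : 'I_n) : `|z - P i|^-1 ^+ 2 / c i <= 16 * inv32 (`|z - P i| + h).
  have [PE hd] := HP i (ltn_ord i).
  set d := `|z - P i| in hd d0 *; have dp : 0 < d by exact: d0.
  have w2 : `|x - i%:R * h| + h <= 4 * d.
    have : `|x - i%:R * h| <= d.
      rewrite /x -PE; apply: le_trans (ler_dist_dist _ _) _.
      by rewrite /d opprB addrA subrK.
    lra.
  have s2 : Num.sqrt (`|x - i%:R * h| + h) <= 2 * Num.sqrt d.
    apply: le_trans (_ : Num.sqrt (4 * d) <= _); first exact: ler_wsqrtr.
    have -> : 4 = 2 ^+ 2 :> R by rewrite -natrX.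
    by rewrite sqrtrM ?sqr_ge0// sqrtr_sqr ger0_norm.
  rewrite /c invrK; apply: (@le_trans _ _ (2 * inv32 d)).
    have sn : Num.sqrt d != 0 by rewrite gt_eqF ?sqrtr_gt0.
    have -> : 2 * inv32 d = d^-1 ^+ 2 * (2 * Num.sqrt d).
      rewrite /inv32 -[in LHS](sqr_sqrtr (ltW dp)) -[in X in _ = X ^+ 2 * _](sqr_sqrtr (ltW dp)).
      by rewrite sqrtr_sqr ger0_norm ?sqrtr_ge0//; field.
    by rewrite ler_pM2l// exprn_gt0// invr_gt0.
  have -> : 16 * inv32 (d + h) = 2 * (8 * inv32 (d + h)) by ring.
  rewrite ler_pM2l// -inv32_quarter ?addr_gt0//; apply: inv32_le; first by rewrite divr_gt0 ?addr_gt0.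
  lra.
rewrite /avg_inv exprMn.
have CS := @cauchy_weighted _ (index_enum 'I_n) (fun i => `|z - P i|^-1) c c0.
have h1 : n%:R^-1 * \sum_(i < n) c i <= 4 / Num.sqrt l by exact: riemann_sqrt.
have h2 : \sum_(i < n) `|z - P i|^-1 ^+ 2 / c i <= 16 * \sum_(i < n) inv32 (`|z - P i| + h).
  by rewrite mulr_sumr; apply: ler_sum => i _; exact: key.
have n1 : 0 < n%:R^-1 :> R by rewrite invr_gt0.
have S0 : 0 <= \sum_(i < n) `|z - P i|^-1 ^+ 2 / c i.
  by apply: sumr_ge0 => i _; rewrite divr_ge0 ?sqr_ge0// ltW.
have C0 : 0 <= \sum_(i < n) c i by apply: sumr_ge0 => i _; exact: ltW.
apply: (@le_trans _ _ ((n%:R^-1 * \sum_(i < n) c i) * (n%:R^-1 * \sum_(i < n) `|z - P i|^-1 ^+ 2 / c i))).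
  have -> : (n%:R^-1 * \sum_(i < n) c i) * (n%:R^-1 * \sum_(i < n) `|z - P i|^-1 ^+ 2 / c i) =
     n%:R^-1 ^+ 2 * ((\sum_(i < n) c i) * \sum_(i < n) `|z - P i|^-1 ^+ 2 / c i) by ring.
  by rewrite ler_pM2l// exprn_gt0.
have -> : 64 / Num.sqrt l * (n%:R^-1 * \sum_(i < n) inv32 (`|z - P i| + h)) =
  4 / Num.sqrt l * (n%:R^-1 * (16 * \sum_(i < n) inv32 (`|z - P i| + h))) by ring.
apply: ler_pM => //; rewrite ?mulr_ge0 ?(ltW n1)//.
by rewrite ler_pM2l.
Qed.

(** 64 from [avg_inv_sqr], 256 from [integral_box_inv32]. *)
Definition spread_cst : R := 64 * 256.

(** The bound is invariant under scaling and free of [n]: it depends on the size [L] of the box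
    relative to the spread [l] of the poles. *)
Lemma avg_inv_energy (p0 c : plane R) (l L : R) (n : nat) P (D : set (mplane R)) :
  (0 < n)%N -> 0 < l -> 0 < L -> measurable D -> D `<=` box c L ->
  (forall i, (i < n)%N -> `|P i - p0| = i%:R * (l / n%:R) /\
     forall z, D z -> l / n%:R <= `|z - P i|) ->
  measurable_fun D (fun z : mplane R => (avg_inv n P z ^+ 2)%:E) ->
  (\int[lambda2 R]_(z in D) (avg_inv n P z ^+ 2)%:E <=
    (spread_cst * Num.sqrt L / Num.sqrt l)%:E)%E.
Proof.
move=> n0 l0 L0 mD DL HP mf; have n0R : 0 < n%:R :> R by rewrite ltr0n.
set h := l / n%:R in HP *; have h0 : 0 < h by rewrite divr_gt0.
have sl : 0 < Num.sqrt l by rewrite sqrtr_gt0.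
pose G (i : 'I_n) (z : plane R) := inv32 (`|z - P i| + h).
have G0 i z : 0 <= G i z by apply/ltW/inv32_gt0; rewrite ltr_wpDl.
have mG i : measurable_fun setT (G i : mplane R -> R).
  apply: measurable_plane_fun; apply: continuous_inv32 => // z; exact: continuous_norm_sub.
pose k := 64 / Num.sqrt l * n%:R^-1.
have k0 : 0 <= k by rewrite mulr_ge0 ?invr_ge0 ?divr_ge0 ?ltW.
have mS : measurable_fun setT (fun z : mplane R => \sum_(i < n) G i z).
  exact: measurable_sum.
apply: (@le_trans _ _ (\int[lambda2 R]_(z in D) (k%:E * (\sum_(i < n) G i z)%:E))%E).
  apply: ge0_le_integral => //.
  - by move=> z _; rewrite lee_fin sqr_ge0.
  - by apply: measurable_funeM; apply/measurable_EFinP; exact: measurable_funTS.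
  - move=> z Dz; rewrite -EFinM lee_fin [leRHS](_ : _ = 64 / Num.sqrt l * (n%:R^-1 * \sum_(i < n) G i z));
      last by rewrite /k !mulrA.
    apply: (@avg_inv_sqr p0) => // i i_n; have [? H] := HP i i_n; split => //; exact: H.
rewrite ge0_integralZl_EFin//; last 2 first.
- by move=> z _; rewrite lee_fin sumr_ge0.
- by apply/measurable_EFinP; exact: measurable_funTS.
have I (i : 'I_n) : (\int[lambda2 R]_(z in D) (G i z)%:E <= (256 * Num.sqrt L)%:E)%E.
  apply: le_trans (integral_box_inv32 c (P i) L0 h0).
  apply: ge0_subset_integral => //; first exact: measurable_box.
    by apply/measurable_EFinP; exact: measurable_funTS.
  by move=> z _; rewrite lee_fin; exact: G0.
apply: (@le_trans _ _ (k%:E * (n%:R * (256 * Num.sqrt L))%:E)%E); last first.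
  rewrite -EFinM lee_fin /k /spread_cst le_eqVlt; apply/orP; left; apply/eqP.
  by field; rewrite !gt_eqF.
apply: lee_wpmul2l; first by rewrite lee_fin.
under eq_integral do rewrite -sumEFin.
rewrite ge0_integral_sum//; last 2 first.
- by move=> i; apply/measurable_EFinP; exact: measurable_funTS.
- by move=> i z _; rewrite lee_fin; exact: G0.
apply: (@le_trans _ _ (\sum_(i < n) (256 * Num.sqrt L)%:E)%E).
  by apply: lee_sum => i _; exact: I.
by rewrite sumEFin lee_fin sumr_const card_ord [leRHS]mulr_natl lexx.
Qed.

End SpreadPoints.

(** * Smooth closed forms and averages of kernels *)

Section ClosedForms.
Context {R : realType}.
Implicit Types (V : set (plane R)) (omega : one_form R) (z p c : plane R).

Definition closed_form V omega :=
  [/\ forall m, Ck m V (fun z => (omega z).1), forall m, Ck m V (fun z => (omega z).2) &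
   forall z, V z -> partial_y (fun z => (omega z).1) z = partial_x (fun z => (omega z).2) z].

Lemma closed_formD V omega omega' : open V -> closed_form V omega -> closed_form V omega' ->
  closed_form V (fun z => ((omega z).1 + (omega' z).1, (omega z).2 + (omega' z).2)).
Proof.
move=> oV [f1 f2 fc] [g1 g2 gc]; split=> [m|m|z Vz].
- exact: (CkD oV (f1 m) (g1 m)).
- exact: (CkD oV (f2 m) (g2 m)).
- have E1 := partialD (Ck_diff (f1 0%N) Vz) (Ck_diff (g1 0%N) Vz).
  have E2 := partialD (Ck_diff (f2 0%N) Vz) (Ck_diff (g2 0%N) Vz).
  transitivity (partial_y (fun z => (omega z).1) z + partial_y (fun z => (omega' z).1) z).
    exact: E1.2.
  by rewrite fc// gc//; exact/esym/E2.1.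
Qed.

Lemma closed_formZ V omega (k : R) : open V -> closed_form V omega ->
  closed_form V (fun z => (k * (omega z).1, k * (omega z).2)).
Proof.
move=> oV [f1 f2 fc]; split=> [m|m|z Vz].
- exact: (CkZ k oV (f1 m)).
- exact: (CkZ k oV (f2 m)).
- have D1 (v : plane R) : derivable (fun z => (omega z).1) z v.
    by apply: diff_derivable; exact: (Ck_diff (f1 0%N)).
  have D2 (v : plane R) : derivable (fun z => (omega z).2) z v.
    by apply: diff_derivable; exact: (Ck_diff (f2 0%N)).
  transitivity (k * partial_y (fun z => (omega z).1) z).
    exact: (deriveZ k (D1 _)).
  by rewrite fc//; exact/esym/(deriveZ k (D2 _)).
Qed.

Lemma closed_form0 V : closed_form V (fun=> (0, 0)).
Proof.
split=> [m|m|z Vz]; [exact: Ck_cst|exact: Ck_cst|].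
by rewrite /partial_x /partial_y !derive_cst.
Qed.

Lemma closed_form_sum V (I : Type) (r : seq I) (F : I -> one_form R) : open V ->
  (forall i, closed_form V (F i)) ->
  closed_form V (fun z => (\sum_(i <- r) (F i z).1, \sum_(i <- r) (F i z).2)).
Proof.
move=> oV cF; elim: r => [|i r IH].
  rewrite (_ : (fun z => _) = fun=> (0, 0)); first exact: closed_form0.
  by apply/funext => z; rewrite !big_nil.
rewrite (_ : (fun z => _) = fun z => ((F i z).1 + \sum_(i <- r) (F i z).1,
   (F i z).2 + \sum_(i <- r) (F i z).2)); last by apply/funext => z; rewrite !big_cons.
exact: (closed_formD oV (cF i) IH).
Qed.

Lemma closed_form_ext V omega omega' : open V -> (forall z, V z -> omega z = omega' z) ->
  closed_form V omega -> closed_form V omega'.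
Proof.
move=> oV E [f1 f2 fc]; split=> [m|m|z Vz].
- by apply: Ck_ext (f1 m) => // z /E ->.
- by apply: Ck_ext (f2 m) => // z /E ->.
- have E1 w : V w -> (omega' w).1 = (omega w).1 by move=> /E ->.
  have E2 w : V w -> (omega' w).2 = (omega w).2 by move=> /E ->.
  by rewrite (partial_ext oV Vz E1) (partial_ext oV Vz E2) fc.
Qed.

Lemma closed_form_cover V (A : plane R -> set (plane R)) omega :
  (forall z, V z -> A z z /\ closed_form (A z) omega) -> closed_form V omega.
Proof.
move=> VA; split=> [m|m|z /VA[Az [_ _]]]; last exact.
  by apply: (Ck_cover (A := A)) => z /VA[Az [f1 _ _]].
by apply: (Ck_cover (A := A)) => z /VA[Az [_ f2 _]].
Qed.

Lemma closed_form_sub V V' omega : V `<=` V' -> closed_form V' omega -> closed_form V omega.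
Proof.
by move=> S [f1 f2 fc]; split=> [m|m|z /S]; [exact: Ck_sub (f1 m)|exact: Ck_sub (f2 m)|exact: fc].
Qed.

(** A mean of kernels with common [c] and [r]. If the winding numbers are the same for all [P i] and
    for all [Q i], its periods are those of a single kernel, while its size is governed by
    [avg_inv]. *)
Definition block n (P Q : nat -> plane R) c r : one_form R := fun z =>
  (n%:R^-1 * \sum_(i < n) (ker (P i) (Q i) c r z).1,
   n%:R^-1 * \sum_(i < n) (ker (P i) (Q i) c r z).2).

Section Block.
Variables (V : set (plane R)) (n : nat) (P Q : nat -> plane R) (c : plane R) (r : R).
Hypotheses (oV : open V) (n0 : (0 < n)%N) (r0 : 0 < r)
  (HP : forall i, (i < n)%N -> `|P i - c| <= r /\ ~ V (P i))
  (HQ : forall i, (i < n)%N -> `|Q i - c| <= r /\ ~ V (Q i)).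

Let n0R : 0 < n%:R :> R. Proof. by rewrite ltr0n. Qed.

Let neqP (i : 'I_n) z : V z -> z != P i.
Proof. by move=> Vz; apply/eqP => E; apply: (HP (ltn_ord i)).2; rewrite -E. Qed.

Let neqQ (i : 'I_n) z : V z -> z != Q i.
Proof. by move=> Vz; apply/eqP => E; apply: (HQ (ltn_ord i)).2; rewrite -E. Qed.

Lemma block_closed : closed_form V (block n P Q c r).
Proof.
have KC (i : 'I_n) : closed_form V (ker (P i) (Q i) c r).
  have [Pc _] := HP (ltn_ord i); have [Qc _] := HQ (ltn_ord i).
  have S : V `<=` punct (P i) `&` punct (Q i).
    by move=> z Vz; split; apply/punctE; [exact: neqP|exact: neqQ].
  split=> [m|m|z Vz].
  - by have [K1 _] := ker_smooth r0 Pc Qc m; exact: Ck_sub K1.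
  - by have [_ K2] := ker_smooth r0 Pc Qc m; exact: Ck_sub K2.
  - by apply: ker_closed => //; [exact: neqP|exact: neqQ].
have KS := closed_form_sum (index_enum 'I_n) oV KC.
exact: (closed_formZ n%:R^-1 oV KS).
Qed.

Lemma block_support z : 6 * r < `|z - c| -> block n P Q c r z = (0, 0).
Proof.
move=> zr; have K (i : 'I_n) : ker (P i) (Q i) c r z = (0, 0).
  have [Pc _] := HP (ltn_ord i); have [Qc _] := HQ (ltn_ord i); exact: ker_support.
rewrite /block; under eq_bigr do rewrite K.
by rewrite [X in (_, _ * X)](eq_bigr (fun=> 0)) => [|i _]; rewrite ?K// !big1_eq !mulr0.
Qed.

Lemma block_period gamma (a b : R) : smooth_closed_curve gamma -> (forall t, V (gamma t)) ->
  (forall i, (i < n)%N -> winding_number gamma (P i) = a) ->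
  (forall i, (i < n)%N -> winding_number gamma (Q i) = b) ->
  curve_cont gamma (block n P Q c r) /\ line_integral gamma (block n P Q c r) = a - b.
Proof.
move=> sg gV wP wQ.
have K (i : 'I_n) : curve_cont gamma (ker (P i) (Q i) c r) /\
    line_integral gamma (ker (P i) (Q i) c r) = a - b.
  have [Pc _] := HP (ltn_ord i); have [Qc _] := HQ (ltn_ord i).
  rewrite -(wP i (ltn_ord i)) -(wQ i (ltn_ord i)).
  by apply: ker_period => // t; [exact: neqP|exact: neqQ].
have [cS LS] := @line_integral_sum _ gamma _ (index_enum 'I_n) (fun i : 'I_n => ker (P i) (Q i) c r)
  sg (fun i => (K i).1).
split; first exact: (curve_contZ n%:R^-1 cS).
have -> := line_integralZ n%:R^-1 sg cS; rewrite LS.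
under eq_bigr do rewrite (K _).2.
by rewrite sumr_const card_ord -[X in _ * X]mulr_natl mulKf// gt_eqF.
Qed.

(** The factor 4 counts the two components and the inequality
    [(a + b) ^+ 2 <= 2 * (a ^+ 2 + b ^+ 2)]. *)
Lemma block_le z : V z ->
  (block n P Q c r z).1 ^+ 2 + (block n P Q c r z).2 ^+ 2 <=
  4 * @ker_cst R ^+ 2 * (avg_inv n P z ^+ 2 + avg_inv n Q z ^+ 2).
Proof.
move=> Vz.
have k0 : 0 <= @ker_cst R by rewrite /ker_cst; have := expR_gt0 (2 : R); lra.
pose s := ker_cst * (avg_inv n P z + avg_inv n Q z).
have bnd (f : plane R -> R) : (forall i : 'I_n, `|f (ker (P i) (Q i) c r z)| <=
    ker_cst * (`|z - P i|^-1 + `|z - Q i|^-1)) ->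
    `|n%:R^-1 * \sum_(i < n) f (ker (P i) (Q i) c r z)| <= s.
  move=> H; rewrite normrM ger0_norm ?invr_ge0// /s /avg_inv -mulrDr mulrCA ler_pM2l ?invr_gt0//.
  apply: le_trans (ler_norm_sum _ _ _) _; rewrite -big_split mulr_sumr.
  by apply: ler_sum => i _; exact: H.
have KL (i : 'I_n) := ker_le r0 (HP (ltn_ord i)).1 (HQ (ltn_ord i)).1 (neqP i Vz) (neqQ i Vz).
have b1 : `|(block n P Q c r z).1| <= s by apply: (bnd fst) => i; exact: (KL i).1.
have b2 : `|(block n P Q c r z).2| <= s by apply: (bnd snd) => i; exact: (KL i).2.
have sq (x : R) : `|x| <= s -> x ^+ 2 <= s ^+ 2.
  by move=> xs; rewrite -[x ^+ 2]sqr_norm lerXn2r ?nnegrE//; exact: le_trans xs.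
apply: le_trans (lerD (sq _ b1) (sq _ b2)) _.
rewrite /s exprMn; move: (avg_inv n P z) (avg_inv n Q z) => a b.
have : 0 <= @ker_cst R ^+ 2 by exact: sqr_ge0.
have : (a + b) ^+ 2 <= 2 * (a ^+ 2 + b ^+ 2) by have := sqr_ge0 (a - b); rewrite !expr2; lra.
move: (@ker_cst R ^+ 2) => k ab kp.
have := ler_wpM2l kp ab; lra.
Qed.

End Block.

Lemma measurable_avg_inv V n P : open V -> (forall i, (i < n)%N -> ~ V (P i)) ->
  measurable_fun (V : set (mplane R)) (fun z : mplane R => (avg_inv n P z ^+ 2)%:E).
Proof.
move=> oV HP; apply/measurable_EFinP; apply: open_measurable_fun => // z Vz.
have h (i : 'I_n) : {for z, continuous (fun z => `|z - P i|^-1)}.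
  apply: cvgV; last exact: continuous_norm_sub.
  rewrite normr_eq0 subr_eq0; apply/eqP => E; apply: (HP i (ltn_ord i)); by rewrite -E.
have hs : {for z, continuous (fun z => \sum_(i < n) `|z - P i|^-1)}.
  elim: (index_enum 'I_n) => [|i r IH].
    rewrite (_ : (fun w : plane R => _) = fun=> 0); first exact: cvg_cst.
    by apply/funext => w; rewrite big_nil.
  rewrite (_ : (fun w : plane R => _) = fun w => `|w - P i|^-1 + \sum_(i <- r) `|w - P i|^-1).
    exact: (continuousD (h i) IH).
  by apply/funext => w; rewrite big_cons.
have hk : {for z, continuous (fun _ : plane R => n%:R^-1 : R)} by exact: cvg_cst.
have ha := continuousM hk hs.
exact: (continuousM ha ha).
Qed.

End ClosedForms.

(** * Euclidean distance, sup norm and distance to the circle *)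

Section Geometry.
Context {R : realType}.
Implicit Types (z w p q : plane R) (A : set (plane R)).

Lemma nsq_ge0 z : 0 <= nsq z.
Proof. by rewrite addr_ge0 ?sqr_ge0. Qed.

Lemma nsqD_le z w : Num.sqrt (nsq (z + w)) <= Num.sqrt (nsq z) + Num.sqrt (nsq w).
Proof.
rewrite -(ler_pXn2r (_ : (0 < 2)%N)) ?nnegrE ?addr_ge0 ?sqrtr_ge0//.
rewrite sqrrD !sqr_sqrtr ?nsq_ge0//.
set a := Num.sqrt (nsq z); set b := Num.sqrt (nsq w).
have ab : z.1 * w.1 + z.2 * w.2 <= a * b.
  have [h|h] := leP (z.1 * w.1 + z.2 * w.2) 0.
    by apply: le_trans h _; rewrite mulr_ge0 ?sqrtr_ge0.
  rewrite -(ler_pXn2r (_ : (0 < 2)%N)) ?nnegrE ?mulr_ge0 ?sqrtr_ge0 ?(ltW h)//.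
  rewrite exprMn !sqr_sqrtr ?nsq_ge0// /nsq.
  have := sqr_ge0 (z.1 * w.2 - z.2 * w.1); nra.
by move: ab; rewrite /nsq /=; nra.
Qed.

Lemma eucl_distE z w : eucl_dist z w = Num.sqrt (nsq (z - w)).
Proof. by []. Qed.

Lemma sqrt_nsq_ge z : `|z| <= Num.sqrt (nsq z).
Proof.
by rewrite -(ler_pXn2r (_ : (0 < 2)%N)) ?nnegrE ?sqrtr_ge0// sqr_sqrtr ?nsq_ge ?nsq_ge0.
Qed.

Lemma sqrt_nsq_le z : Num.sqrt (nsq z) <= 2 * `|z|.
Proof.
rewrite -(ler_pXn2r (_ : (0 < 2)%N)) ?nnegrE ?sqrtr_ge0 ?mulr_ge0// sqr_sqrtr ?nsq_ge0//.
by apply: le_trans (nsq_le z) _; rewrite exprMn; have := sqr_ge0 `|z|; nra.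
Qed.

Lemma eucl_dist_ge z w : `|z - w| <= eucl_dist z w.
Proof. exact: sqrt_nsq_ge. Qed.

Lemma eucl_dist_le z w : eucl_dist z w <= 2 * `|z - w|.
Proof. exact: (sqrt_nsq_le (z - w)). Qed.

Lemma disk_gapE z : disk_gap z = 1 - eucl_dist z (0, 0).
Proof. by rewrite /disk_gap eucl_distE subr0. Qed.

Lemma diskE z : disk z <-> 0 < disk_gap z.
Proof. by rewrite disk_gapE subr_gt0. Qed.

Lemma disk_nsq z : disk z -> nsq z < 1.
Proof.
move=> /diskE; rewrite /disk_gap subr_gt0 -(ltr_pXn2r (_ : (0 < 2)%N)) ?nnegrE ?sqrtr_ge0//.
by rewrite expr1n sqr_sqrtr ?nsq_ge0.
Qed.

Lemma disk_udisk z : disk z -> udisk z.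
Proof. by move=> /disk_nsq; rewrite /udisk /= subr_gt0. Qed.

Lemma disk_gap_lip z w : disk_gap w - 2 * `|z - w| <= disk_gap z.
Proof.
have := nsqD_le w (z - w); rewrite addrC subrK => h.
by have := sqrt_nsq_le (z - w); rewrite /disk_gap; lra.
Qed.

Lemma gap_eucl z w : ~ disk w -> disk_gap z <= eucl_dist z w.
Proof.
move=> /diskE/negP; rewrite -leNgt => gw.
have := nsqD_le z (w - z); rewrite addrC subrK => h.
have -> : eucl_dist z w = Num.sqrt (nsq (w - z)).
  by rewrite eucl_distE; congr Num.sqrt; rewrite /nsq /=; ring.
by move: gw h; rewrite /disk_gap; lra.
Qed.

Lemma closed_norm_ball c (r : R) : compact [set z : plane R | `|z - c| <= r].
Proof.
rewrite (_ : [set z | _] = box c r).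
  by apply: compact_setX; exact: segment_compact.
by apply/seteqP; split => z /boxP.
Qed.

Lemma closed_gap_ge (e : R) : closed [set z : plane R | e <= disk_gap z].
Proof.
apply: (@closed_comp _ _ disk_gap [set x | e <= x]); last exact: closed_ge.
by move=> z _; exact: continuous_disk_gap.
Qed.

Lemma compact_gap_ge (e : R) : compact [set z : plane R | e <= disk_gap z].
Proof.
apply: (@subclosed_compact _ _ _ (@closed_gap_ge e) (@closed_norm_ball 0 (1 - e))).
move=> z /= h; rewrite subr0.
by apply: le_trans (sqrt_nsq_ge z) _; move: h; rewrite /disk_gap; lra.
Qed.

Lemma closure_approx A z (e : R) : closure A z -> 0 < e -> exists2 p, A p & `|p - z| < e.
Proof.
move=> Az e0; have [p [Ap pz]] := Az _ (nbhsx_ballx z e e0).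
by exists p => //; apply/ball_plane.
Qed.

(** The point lies on the ray through [z] at Euclidean norm [1 + d], where [d] is the gap of [z]. It
    is at distance [2 * d] from [z] and at least [d] from the disk; passing to the sup norm halves
    the latter. *)
Lemma exists_outside z : disk z -> exists q : plane R,
  [/\ 1 <= nsq q, `|q - z| <= 2 * disk_gap z & forall w, disk w -> disk_gap z / 2 <= `|w - q|].
Proof.
move=> dz; have g0 := (diskE z).1 dz; set d := disk_gap z in g0 *.
set e := Num.sqrt (nsq z).
have e0 : 0 <= e by exact: sqrtr_ge0.
have dE : e = 1 - d by rewrite /d /disk_gap /e; ring.
have eE : e ^+ 2 = nsq z by rewrite sqr_sqrtr ?nsq_ge0.
(* The direction of [z]; at the origin any unit vector will do. *)
have [u [u1 zu]] : exists u : plane R, nsq u = 1 /\ z = (e * u.1, e * u.2).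
  have [ez|en] := eqVneq e 0.
    exists (1, 0); split; first by rewrite /nsq /= expr1n expr0n addr0.
    have : `|z| <= 0 by apply: le_trans (sqrt_nsq_ge z) _; rewrite -/e ez.
    by rewrite normr_le0 => /eqP ->; rewrite ez !mul0r.
  exists (z.1 / e, z.2 / e); split.
    by rewrite /nsq /= !exprMn -mulrDl -/(nsq z) -eE exprVn divff// expf_neq0.
  by rewrite /= ![e * _]mulrC !divfK//; case: (z).
exists ((1 + d) * u.1, (1 + d) * u.2).
have nq : nsq ((1 + d) * u.1, (1 + d) * u.2) = (1 + d) ^+ 2.
  by rewrite /nsq /= !exprMn -mulrDr -/(nsq u) u1 mulr1.
split.
- by rewrite nq; nra.
- apply: le_trans (sqrt_nsq_ge _) _.
  have -> : nsq (((1 + d) * u.1, (1 + d) * u.2) - z) = (2 * d) ^+ 2.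
    rewrite zu dE /nsq /=.
    have -> : (1 + d) * u.1 - (1 - d) * u.1 = 2 * d * u.1 by ring.
    have -> : (1 + d) * u.2 - (1 - d) * u.2 = 2 * d * u.2 by ring.
    by rewrite ![(2 * d * _) ^+ 2]exprMn -mulrDr -/(nsq u) u1 mulr1.
  by rewrite sqrtr_sqr ger0_norm// mulr_ge0// ltW.
- move=> w dw; set q := (_, _).
  have sq : Num.sqrt (nsq q) = 1 + d by rewrite nq sqrtr_sqr ger0_norm// addr_ge0// ltW.
  have := nsqD_le w (q - w); rewrite addrC subrK sq => h.
  have := (diskE w).1 dw; rewrite /disk_gap => gw.
  have := sqrt_nsq_le (q - w); rewrite distrC => h2.
  by move: h h2 gw; lra.
Qed.

End Geometry.

(** * Consequences of regularity of the holes *)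

Section Holes.
Context {R : realType} {J : countType}.
Variable B : J -> set (plane R).
Hypothesis HB : regular_holes B.
Implicit Types (j k : J) (z w p q : plane R).

Let Omega := regular_domain B.

Lemma holes_closed j : closed (B j).
Proof.
have [+ _ _] := HB => /(_ j)[cB _ _ _ _]; apply: compact_closed cB.
exact: norm_hausdorff.
Qed.

Lemma holes_disk j z : B j z -> disk z.
Proof. by have [+ _ _] := HB => /(_ j)[_ + _ _ _]; exact. Qed.

Lemma hole_domain j : exists U : set (plane R),
  [/\ U !=set0, open U, connected U & B j = closure U].
Proof. by have [+ _ _] := HB => /(_ j)[_ _ _ _ [U [[U0 oU cU _] BU]]]; exists U. Qed.

Lemma holes_finite (e : R) : 0 < e ->
  finite_set [set j | exists2 z, B j z & e <= disk_gap z].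
Proof.
move=> e0; have [_ _ fin] := HB.
have sub : [set z : plane R | e <= disk_gap z] `<=` disk.
  by move=> z /= h; apply/diskE; exact: lt_le_trans h.
have := fin _ (@compact_gap_ge R e) sub.
by apply: sub_finite_set => j [z Bz ez]; exists z.
Qed.

Lemma Omega_disk z : Omega z -> disk z.
Proof. by case. Qed.

Lemma Omega_notin j z : Omega z -> ~ B j z.
Proof. by move=> [_ nB] Bz; apply: nB; exists j. Qed.

(** Holes accumulate only at the circle, so near a point of the disk only finitely many closed sets
    are removed. *)
Lemma open_Omega : open Omega.
Proof.
rewrite openE => z Oz; have dz := Omega_disk Oz.
have g0 := (diskE z).1 dz; pose e := disk_gap z / 2.
have e0 : 0 < e by rewrite divr_gt0.
have := holes_finite e0; set F := [set j | _] => finF.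
have oA : open [set w : plane R | e < disk_gap w].
  apply: (@open_comp _ _ disk_gap [set x | e < x]); last exact: open_gt.
  by move=> w _; exact: continuous_disk_gap.
have cF : closed (\bigcup_(j in F) B j).
  by apply: closed_bigcup => // j _; exact: holes_closed.
have oI := openI oA (closed_openC cF).
have zI : ([set w : plane R | e < disk_gap w] `&` ~` \bigcup_(j in F) B j) z.
  split; first by rewrite /e /= ltr_pdivrMr// ltr_pMr// ltr1n.
  by move=> [j _ Bz]; exact: Omega_notin Oz Bz.
apply: filterS (open_nbhs_nbhs (conj oI zI)).
move=> w [/= ew nF]; split; first by apply/diskE; exact: lt_trans ew.
by move=> [j _ Bw]; apply: nF; exists j => //; exists w => //; exact: ltW.
Qed.

Lemma diam_ub j z w : B j z -> B j w -> eucl_dist z w <= diam (B j).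
Proof.
move=> Bz Bw; apply: ub_le_sup; last by exists z => //; exists w.
exists 2 => _ [a Ba [b Bb <-]].
have := nsqD_le a (- b); have -> : nsq (- b) = nsq b by rewrite /nsq /= !sqrrN.
have := (diskE a).1 (holes_disk Ba); have := (diskE b).1 (holes_disk Bb).
by rewrite /disk_gap eucl_distE; lra.
Qed.

Lemma hole_dist j z w : B j z -> B j w -> `|z - w| <= diam (B j).
Proof. by move=> Bz Bw; apply: le_trans (eucl_dist_ge _ _) (diam_ub Bz Bw). Qed.

Lemma diam_gt0 j : 0 < diam (B j).
Proof.
have [U [[p Up] oU cU BU]] := hole_domain j.
have /nbhs_ballP[e /= e0 eU] := open_nbhs_nbhs (conj oU Up).
have sU : U `<=` B j by rewrite BU; exact: subset_closure.
have e2 : 0 < e / 2 by rewrite divr_gt0.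
have nE : `|(p + (e / 2, 0)) - p| = e / 2.
  by rewrite addrC addKr plane_norm /= normr0 (gtr0_norm e2); apply/max_idPl/ltW.
have Uq : U (p + (e / 2, 0)).
  by apply: eU; apply/ball_plane; rewrite nE; lra.
by have := hole_dist (sU _ Uq) (sU _ Up); rewrite nE; apply: lt_le_trans.
Qed.

(** Two points of the hole have Euclidean distance above [3 / 4 * d], hence sup distance above
    [3 / 8 * d], and one of them is at least [3 / 16 * d] away from [p0]. Moving it into [U] loses
    [d / 16]. *)
Lemma hole_far_point j U p0 (d : R) : open U -> B j = closure U -> U p0 -> 0 < d ->
  d <= diam (B j) -> exists2 p1, U p1 & d / 8 <= `|p1 - p0|.
Proof.
move=> oU BU Up0 d0 dj.
have sU : U `<=` B j by rewrite BU; exact: subset_closure.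
have ne : [set eucl_dist z w | z in B j & w in B j] !=set0.
  by exists (eucl_dist p0 p0); exists p0; [exact: sU|exists p0 => //; exact: sU].
have dl : 3 / 4 * d < diam (B j) by apply: lt_le_trans dj; lra.
have [x [z Bz [w Bw zw]] dx] := sup_gt ne dl.
have zw' : 3 / 8 * d < `|z - w| by have := eucl_dist_le z w; rewrite zw; lra.
have far v : B j v -> 3 / 16 * d <= `|v - p0| -> exists2 p1, U p1 & d / 8 <= `|p1 - p0|.
  rewrite BU => cv vd; have d16 : 0 < d / 16 by rewrite divr_gt0.
  have [p Up pv] := closure_approx cv d16; exists p => //.
  have := ler_normD (v - p) (p - p0); rewrite addrA subrK [`|v - p|]distrC; lra.
have [h|h] := leP (3 / 16 * d) `|z - p0|; first exact: far h.
apply: (far w) => //.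
have := ler_normD (z - p0) (p0 - w); rewrite addrA subrK [`|p0 - w|]distrC; lra.
Qed.

(** The spread length is tied to a chosen [d] and not to the diameter: next to a much smaller hole
    only a part of a large one is used, which keeps all poles close to [y]. The base point is moved
    from [y] into the open domain, where clearance is available. *)
Lemma hole_spread j y (d e : R) : B j y -> 0 < d -> d <= diam (B j) -> 0 < e ->
  exists p0, [/\ B j p0, `|p0 - y| < e & exists N, forall n, (N <= n)%N ->
   exists P, forall i, (i < n)%N -> [/\ B j (P i), `|P i - p0| = i%:R * (d / 8 / n%:R) &
     forall z, Omega z -> d / 8 / n%:R <= `|z - P i| ] ].
Proof.
move=> By d0 dj e0; have [U [U0 oU cU BU]] := hole_domain j.
have sU : U `<=` B j by rewrite BU; exact: subset_closure.
have [p0 Up0 p0y] : exists2 p, U p & `|p - y| < e by apply: closure_approx; rewrite -?BU.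
have [p1 Up1 p1d] := hole_far_point oU BU Up0 d0 dj.
have d8 : 0 < d / 8 by rewrite divr_gt0.
have [N HN] := exists_spread_points oU cU Up0 Up1 d8 p1d.
exists p0; split => //; first exact: sU.
exists N => n /HN[P HP]; exists P => i /HP[UP PE Pz]; split => //; first exact: sU.
by move=> z Oz; apply: Pz => /sU Bz; exact: Omega_notin Oz Bz.
Qed.

Lemma edge_near S j k (d : R) : 0 < d -> set_dist (B j) (B k) <= S * d ->
  exists y w, [/\ B j y, B k w & `|y - w| < (S + 1 / 2) * d].
Proof.
move=> d0 sd.
have [Uj [[a Ua] _ _ Bj]] := hole_domain j; have [Uk [[b Ub] _ _ Bk]] := hole_domain k.
have ja : B j a by rewrite Bj; exact: subset_closure.
have kb : B k b by rewrite Bk; exact: subset_closure.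
have ne : [set eucl_dist z w | z in B j & w in B k] !=set0.
  by exists (eucl_dist a b); exists a => //; exists b.
have lt : set_dist (B j) (B k) < (S + 1 / 2) * d.
  by apply: le_lt_trans sd _; rewrite mulrDl ltrDl; lra.
have [x [y By [w Bw yw]] xd] := inf_lt ne lt.
by exists y, w; split => //; apply: le_lt_trans (eucl_dist_ge _ _) _; rewrite yw.
Qed.

Lemma set_dist_disk j (e : R) : (forall z, B j z -> e <= disk_gap z) ->
  e <= set_dist (B j) (~` disk).
Proof.
move=> H; apply: lb_le_inf.
  have [U [[a Ua] _ _ Bj]] := hole_domain j.
  exists (eucl_dist a (2, 0)); exists a; first by rewrite Bj; exact: subset_closure.
  exists (2, 0) => // /disk_nsq; rewrite /nsq /= expr0n addr0 -natrX ltrn1.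
  by [].
move=> _ [z Bz [w dw <-]]; apply: le_trans (H z Bz) _; exact: gap_eucl.
Qed.

End Holes.

(** * Forms with prescribed periods attached to an edge or to an exit *)

Section LocalForms.
Context {R : realType} {J : countType}.
Variables (B : J -> set (plane R)) (gamma : J -> R -> plane R).
Hypotheses (HB : regular_holes B) (Hg : period_curves B gamma).
Implicit Types (j k l : J) (z w p q c : plane R) (tau : one_form R).

Let Omega := regular_domain B.
Let oO : open Omega := @open_Omega R J B HB.
Let mO : measurable (Omega : set (mplane R)) := open_measurable_plane oO.

Definition sqn tau z : R := (tau z).1 ^+ 2 + (tau z).2 ^+ 2.

Lemma sqn_ge0 tau z : 0 <= sqn tau z.
Proof. by rewrite addr_ge0 ?sqr_ge0. Qed.

(** The shift by [eta] keeps the weight bounded up to the circle. Energy bounds are uniform in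
    [eta], and where the gap is at least [eta] the shift costs a constant factor. *)
Definition gapw (eta : R) z : R := (Num.sqrt (disk_gap z + eta))^-1.

Lemma gapw_ge0 eta z : 0 <= gapw eta z.
Proof. by rewrite invr_ge0 sqrtr_ge0. Qed.

Lemma gapw_cont eta : 0 < eta -> forall z, Omega z -> {for z, continuous (gapw eta)}.
Proof. by move=> e0 z Oz; apply: continuous_gapw => //; apply: disk_udisk; case: Oz. Qed.

Lemma sqn_cont tau : closed_form Omega tau -> forall z, Omega z -> {for z, continuous (sqn tau)}.
Proof.
move=> [f1 f2 _] z Oz.
have c1 := differentiable_continuous (Ck_diff (f1 0%N) Oz).
have c2 := differentiable_continuous (Ck_diff (f2 0%N) Oz).
exact: (continuousD (continuousM c1 c1) (continuousM c2 c2)).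
Qed.

Lemma measurable_gapw eta : 0 < eta ->
  measurable_fun (Omega : set (mplane R)) (fun z : mplane R => (gapw eta z)%:E).
Proof.
by move=> e0; apply/measurable_EFinP; apply: open_measurable_fun => //; exact: gapw_cont.
Qed.

Lemma measurable_wsqn eta tau : 0 < eta -> closed_form Omega tau ->
  measurable_fun (Omega : set (mplane R)) (fun z : mplane R => (gapw eta z * sqn tau z)%:E).
Proof.
move=> e0 ct; apply/measurable_EFinP; apply: open_measurable_fun => // z Oz.
exact: (continuousM (gapw_cont e0 Oz) (sqn_cont ct Oz)).
Qed.

Definition wenergy (eta : R) tau : \bar R :=
  (\int[lambda2 R]_(z in Omega) (gapw eta z * sqn tau z)%:E)%E.

(* The weight is the one that Cauchy-Schwarz produces when the forms of all holes are added. *)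
Definition hole_form c (del E : R) (per : J -> R) tau :=
  [/\ closed_form Omega tau,
      forall l, curve_cont (gamma l) tau /\ line_integral (gamma l) tau = per l,
      forall z, Omega z -> 24 * del < `|z - c| -> tau z = (0, 0) &
      forall eta, 0 < eta -> (wenergy eta tau <= (E / Num.sqrt del)%:E)%E].

Lemma gamma_smooth l : smooth_closed_curve (gamma l).
Proof. by have [] := Hg l. Qed.

Lemma gamma_Omega l t : Omega (gamma l t).
Proof. by have [_ + _ _] := Hg l; exact. Qed.

Lemma winding_hole l j p : B j p -> winding_number (gamma l) p = (l == j)%:R.
Proof.
move=> Bp; have [_ _ w1 w0] := Hg l; have [lj|lj] := eqVneq l j.
  by rewrite w1// lj.
by rewrite (w0 j)// => E; move: lj; rewrite E eqxx.
Qed.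

Lemma sqnD tau tau' z :
  sqn (fun z => ((tau z).1 + (tau' z).1, (tau z).2 + (tau' z).2)) z <= 2 * sqn tau z + 2 * sqn tau' z.
Proof.
rewrite /sqn /=; have := sqr_ge0 ((tau z).1 - (tau' z).1).
have := sqr_ge0 ((tau z).2 - (tau' z).2); rewrite !expr2; lra.
Qed.

Lemma hole_formD c (del E E' : R) per per' tau tau' :
  hole_form c del E per tau -> hole_form c del E' per' tau' ->
  hole_form c del (2 * E + 2 * E') (fun l => per l + per' l)
    (fun z => ((tau z).1 + (tau' z).1, (tau z).2 + (tau' z).2)).
Proof.
move=> [c1 p1 s1 e1] [c2 p2 s2 e2]; have cs := closed_formD oO c1 c2; split => //.
- move=> l; have [C1 L1] := p1 l; have [C2 L2] := p2 l; split; first exact: (curve_contD C1 C2).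
  by have := line_integralD (gamma_smooth l) C1 C2; rewrite L1 L2.
- by move=> z Oz h; rewrite s1 ?s2//= addr0.
- move=> eta e0; rewrite /wenergy.
  have m1 := measurable_wsqn e0 c1; have m2 := measurable_wsqn e0 c2.
  apply: (@le_trans _ _ (\int[lambda2 R]_(z in Omega)
     (2%:E * (gapw eta z * sqn tau z)%:E + 2%:E * (gapw eta z * sqn tau' z)%:E))%E).
    apply: ge0_le_integral => //.
    + by move=> z _; rewrite lee_fin mulr_ge0 ?gapw_ge0 ?sqn_ge0.
    + exact: measurable_wsqn.
    + by apply: emeasurable_funD; apply: measurable_funeM.
    + move=> z _; rewrite -!EFinM -EFinD lee_fin.
      apply: le_trans (ler_wpM2l (gapw_ge0 _ _) (sqnD tau tau' z)) _.
      rewrite le_eqVlt; apply/orP; left; apply/eqP; ring.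
  have n1 z : (0 <= (gapw eta z * sqn tau z)%:E)%E by rewrite lee_fin mulr_ge0 ?gapw_ge0 ?sqn_ge0.
  have n2 z : (0 <= (gapw eta z * sqn tau' z)%:E)%E by rewrite lee_fin mulr_ge0 ?gapw_ge0 ?sqn_ge0.
  rewrite ge0_integralD//; last 4 first.
  + by move=> z _; apply: mule_ge0.
  + exact: measurable_funeM.
  + by move=> z _; apply: mule_ge0.
  + exact: measurable_funeM.
  rewrite !ge0_integralZl_EFin//.
  have -> : ((2 * E + 2 * E') / Num.sqrt del)%:E =
     (2%:E * (E / Num.sqrt del)%:E + 2%:E * (E' / Num.sqrt del)%:E)%E.
    by rewrite -!EFinM -EFinD; congr EFin; ring.
  by apply: leeD; apply: lee_wpmul2l => //; [exact: e1|exact: e2].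
Qed.

Lemma wenergy_box c (L eta : R) tau : closed_form Omega tau ->
  (forall z, Omega z -> L < `|z - c| -> tau z = (0, 0)) ->
  wenergy eta tau = (\int[lambda2 R]_(z in (Omega `&` box c L : set (mplane R)))
    (gapw eta z * sqn tau z)%:E)%E.
Proof.
move=> ct sup; rewrite /wenergy [RHS]integral_mkcondr; apply: eq_integral => z.
rewrite inE => Oz; rewrite patchE; case: ifPn => // /negP zb.
have h : L < `|z - c| by rewrite ltNge; apply/negP => /boxP h; apply: zb; rewrite inE.
by rewrite /sqn (sup z Oz h) /= !expr0n addr0 mulr0.
Qed.

(** The gap is 2-Lipschitz, so within 3/8 of the gap of [c] it remains at least a quarter of it. *)
Lemma gap_weight c (eta : R) z : 0 < eta -> disk c -> `|z - c| <= 3 / 8 * disk_gap c ->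
  gapw eta z <= 2 / Num.sqrt (disk_gap c).
Proof.
move=> e0 /diskE; set del := disk_gap c => d0 zc.
have g : del / 4 <= disk_gap z + eta.
  by have := disk_gap_lip z c; rewrite -/del; lra.
have -> : 2 / Num.sqrt del = (Num.sqrt (del / 4))^-1.
  have -> : del / 4 = (2^-1) ^+ 2 * del by rewrite exprVn mulrC -natrX.
  rewrite sqrtrM ?sqr_ge0// sqrtr_sqr ger0_norm ?invr_ge0//.
  by rewrite invfM invrK.
rewrite lef_pV2 ?posrE ?sqrtr_gt0 ?divr_gt0//; last by apply: lt_le_trans g; rewrite divr_gt0.
exact: ler_wsqrtr.
Qed.

Definition K2 : R := 4 * @ker_cst R ^+ 2.

Lemma K2_ge0 : 0 <= K2.
Proof. by rewrite mulr_ge0// sqr_ge0. Qed.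

(** [48 * (S + 2)] is the ratio of the support radius [6 * (S + 2) * d] to the spread [d / 8]. The
    factor 4 is 2 from the weight times 2 for the two families of poles. *)
Definition edge_energy (S : R) : R := 4 * spread_cst * K2 * Num.sqrt (48 * (S + 2)).

(** The support is so small compared with the gap of [c] that the weight is essentially constant on
    it, which leaves the unweighted energy of two averages. The nearby points of the two holes are
    returned as well, to control how far a walk drifts. *)
Lemma edge_form S j k c (d : R) : 0 < S -> j != k -> 0 < d -> d <= diam (B j) -> d <= diam (B k) ->
  set_dist (B j) (B k) <= S * d -> disk c -> (forall z, B j z -> `|z - c| <= disk_gap c / 8) ->
  6 * (S + 2) * d <= disk_gap c / 16 ->
  (exists y w, [/\ B j y, B k w & `|y - w| <= (S + 1) * d]) /\
  exists tau, hole_form c (disk_gap c) (edge_energy S) (fun l => (l == j)%:R - (l == k)%:R) tau.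
Proof.
move=> S0 jk d0 dj dk jkd dc Bc small; set del := disk_gap c in Bc small *.
have del0 : 0 < del by exact/diskE.
have [y [w [By Bw yw]]] := edge_near HB d0 jkd.
split; first by exists y, w; split => //; apply: le_trans (ltW yw) _; rewrite ler_pM2r//; lra.
have d16 : 0 < d / 16 by rewrite divr_gt0.
have [p0 [Bp0 p0y [N1 HN1]]] := hole_spread HB By d0 dj d16.
have [q0 [Bq0 q0w [N2 HN2]]] := hole_spread HB Bw d0 dk d16.
pose n := (maxn N1 N2).+1.
have [P HP] := HN1 n (leqW (leq_maxl _ _)); have [Q HQ] := HN2 n (leqW (leq_maxr _ _)).
have n0 : (0 < n)%N by [].
have n0R : 0 < n%:R :> R by rewrite ltr0n.
(* Room for both families of poles around [p0]: the [Q i] are reached by at most [d / 8 + d / 16 +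
   (S + 1 / 2) * d + d / 16]. *)
pose r := (S + 2) * d; have r0 : 0 < r by rewrite mulr_gt0// addr_gt0.
have il i : (i < n)%N -> i%:R * (d / 8 / n%:R) <= d / 8.
  move=> i_n; rewrite mulrCA ler_piMr ?divr_ge0 ?(ltW d0)//.
  by rewrite ler_pdivrMr// mul1r ler_nat ltnW.
have PV i : (i < n)%N -> `|P i - p0| <= r /\ ~ Omega (P i).
  move=> i_n; have [BP PE _] := HP i i_n; split; last by move=> OP; exact: (Omega_notin OP BP).
  by rewrite PE; apply: le_trans (il _ i_n) _; rewrite /r; nra.
have QV i : (i < n)%N -> `|Q i - p0| <= r /\ ~ Omega (Q i).
  move=> i_n; have [BQ QE _] := HQ i i_n; split; last by move=> OP; exact: (Omega_notin OP BQ).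
  have h1 := il _ i_n; rewrite -QE in h1.
  have -> : Q i - p0 = ((Q i - q0) + (q0 - w)) + ((w - y) + (y - p0)).
    by rewrite !addrA !subrK.
  have t1 := ler_normD ((Q i - q0) + (q0 - w)) ((w - y) + (y - p0)).
  have t2 := ler_normD (Q i - q0) (q0 - w); have t3 := ler_normD (w - y) (y - p0).
  rewrite [`|w - y|]distrC [`|y - p0|]distrC in t3.
  apply: le_trans t1 _; rewrite /r mulrDl in yw *.
  have e1 : (S + 2) * d = S * d + 2 * d by ring.
  by move: t2 t3 h1 q0w p0y yw; rewrite ?e1; lra.
set tau := block n P Q p0 r.
have ct : closed_form Omega tau by exact: block_closed.
have sup z : 6 * r < `|z - p0| -> tau z = (0, 0) by move=> h; exact: (block_support r0 PV QV h).
have r6 : 6 * r = 6 * (S + 2) * d by rewrite /r mulrA.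
have p0c : `|p0 - c| <= del / 8 by exact: Bc.
exists tau; split => //.
- move=> l; apply: (@block_period R Omega n P Q p0 r n0 r0 PV QV); first exact: gamma_smooth.
  + by move=> t; exact: gamma_Omega.
  + by move=> i i_n; apply: winding_hole; case: (HP i i_n).
  + by move=> i i_n; apply: winding_hole; case: (HQ i i_n).
- move=> z _ far; apply: sup; rewrite r6.
  have := ler_normD (z - p0) (p0 - c); rewrite addrA subrK; lra.
- move=> eta e0; have supO z : Omega z -> 6 * r < `|z - p0| -> tau z = (0, 0) by move=> _; exact: sup.
  rewrite (wenergy_box eta ct supO); set D := (_ `&` _).
  have r60 : 0 < 6 * r by rewrite mulr_gt0.
  have mD : measurable (D : set (mplane R)) by apply: measurableI => //; exact: measurable_box.
  have DO : D `<=` Omega by move=> z [].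
  have DL : D `<=` box p0 (6 * r) by move=> z [].
  have mP : measurable_fun (D : set (mplane R)) (fun z : mplane R => (avg_inv n P z ^+ 2)%:E).
    apply: (measurable_funS mO DO); apply: measurable_avg_inv => // i i_n; by case: (PV i i_n).
  have mQ : measurable_fun (D : set (mplane R)) (fun z : mplane R => (avg_inv n Q z ^+ 2)%:E).
    apply: (measurable_funS mO DO); apply: measurable_avg_inv => // i i_n; by case: (QV i i_n).
  pose a := 2 / Num.sqrt del * K2.
  have a0 : 0 <= a by rewrite mulr_ge0 ?K2_ge0// divr_ge0 ?sqrtr_ge0.
  have d8 : 0 < d / 8 by rewrite divr_gt0.
  pose X := spread_cst * Num.sqrt (6 * r) / Num.sqrt (d / 8).
  have IP : (\int[lambda2 R]_(z in D) (avg_inv n P z ^+ 2)%:E <= X%:E)%E.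
    apply: (@avg_inv_energy R p0 p0) => // i i_n; have [_ PE Pz] := HP i i_n.
    by split => // z [Oz _]; exact: Pz.
  have IQ : (\int[lambda2 R]_(z in D) (avg_inv n Q z ^+ 2)%:E <= X%:E)%E.
    apply: (@avg_inv_energy R q0 p0) => // i i_n; have [_ PE Pz] := HQ i i_n.
    by split => // z [Oz _]; exact: Pz.
  have nP z : (0 <= (avg_inv n P z ^+ 2)%:E)%E by rewrite lee_fin sqr_ge0.
  have nQ z : (0 <= (avg_inv n Q z ^+ 2)%:E)%E by rewrite lee_fin sqr_ge0.
  apply: (@le_trans _ _ (\int[lambda2 R]_(z in D)
     (a%:E * ((avg_inv n P z ^+ 2)%:E + (avg_inv n Q z ^+ 2)%:E)))%E).
    apply: ge0_le_integral => //.
    + by move=> z _; rewrite lee_fin mulr_ge0 ?gapw_ge0 ?sqn_ge0.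
    + by apply: (measurable_funS mO DO); exact: measurable_wsqn.
    + by apply: measurable_funeM; exact: emeasurable_funD.
    + move=> z [Oz /boxP zb]; rewrite -EFinD -EFinM lee_fin.
      rewrite [leRHS](esym (mulrA (2 / Num.sqrt del) K2 _)).
      apply: ler_pM; rewrite ?gapw_ge0 ?sqn_ge0//; last exact: (block_le n0 r0 PV QV Oz).
      apply: gap_weight => //; rewrite -/del.
      have := ler_normD (z - p0) (p0 - c); rewrite addrA subrK; move: zb; rewrite r6; lra.
  rewrite ge0_integralZl_EFin//; last 2 first.
  + by move=> z _; exact: adde_ge0.
  + exact: emeasurable_funD.
  rewrite ge0_integralD//; apply: (@le_trans _ _ (a%:E * (X%:E + X%:E))%E).
    by apply: lee_wpmul2l; [rewrite lee_fin|exact: leeD].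
  rewrite -EFinD -EFinM lee_fin /a /X /edge_energy r6.
  have -> : 6 * (S + 2) * d = 48 * (S + 2) * (d / 8) by field.
  rewrite sqrtrM ?mulr_ge0 ?addr_ge0 ?(ltW S0)//.
  have s8 : Num.sqrt (d / 8) != 0 by rewrite gt_eqF ?sqrtr_gt0.
  rewrite le_eqVlt; apply/orP; left; apply/eqP.
  by field; rewrite s8 gt_eqF ?sqrtr_gt0.
Qed.

Lemma invr_le_div (k del t : R) : 0 < k -> 0 < del -> del / k <= t -> t^-1 <= k / del.
Proof.
move=> k0 d0 h; have dk : 0 < del / k by rewrite divr_gt0.
by rewrite -[k / del]invf_div lef_pV2 ?posrE// (lt_le_trans dk).
Qed.

(** The first term is the averaged pole at support radius [24 * del] and spread [kap * del / 8]. In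
    the second, [68 = 8 ^+ 2 + 2 ^+ 2] bounds the kernels away from the poles in units of
    [del ^- 2], and the rest is the integral of the weight. Powers of [del] reduce to its inverse
    square root. *)
Definition exit_energy (kap : R) : R :=
  K2 * (2 * spread_cst * (Num.sqrt 24 / Num.sqrt (kap / 8)) + 68 * (128 * 24 * Num.sqrt 24)).

(** The support may reach the circle, where the weight blows up. The singularities do not meet: near
    [c] the weight is bounded and the average is square integrable, and away from [c] the average is
    bounded and the weight is integrable. *)
Lemma exit_form k y c (kap : R) : 0 < kap -> kap <= 1 -> B k y -> disk c ->
  `|y - c| <= disk_gap c / 16 -> kap * disk_gap c <= diam (B k) ->
  exists tau, hole_form c (disk_gap c) (exit_energy kap) (fun l => (l == k)%:R) tau.
Proof.
move=> k0 k1 By dc yc dk; set del := disk_gap c in yc dk *.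
have del0 : 0 < del by exact/diskE.
pose d := kap * del; have d0 : 0 < d by rewrite mulr_gt0.
have d_del : d <= del by rewrite /d ler_piMl// ltW.
have e16 : 0 < del / 16 by rewrite divr_gt0.
have [p0 [Bp0 p0y [N HN]]] := hole_spread HB By d0 dk e16.
have [P HP] := HN N.+1 (leqnSn N); set n := N.+1 in HP.
have n0 : (0 < n)%N by [].
have n0R : 0 < n%:R :> R by rewrite ltr0n.
have [q [q1 qc qd]] := exists_outside dc; rewrite -/del in qc qd.
have il i : (i < n)%N -> i%:R * (d / 8 / n%:R) <= d / 8.
  move=> i_n; rewrite mulrCA ler_piMr ?divr_ge0 ?(ltW d0)//.
  by rewrite ler_pdivrMr// mul1r ler_nat ltnW.
have p0c : `|p0 - c| <= del / 8.
  by have := ler_normD (p0 - y) (y - c); rewrite addrA subrK; lra.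
have Pc i : (i < n)%N -> `|P i - c| <= del / 4.
  move=> i_n; have [_ PE _] := HP i i_n; have := il i i_n; rewrite -PE.
  have := ler_normD (P i - p0) (p0 - c); rewrite addrA subrK; lra.
(* Large enough for [q], at distance at most [2 * del]; the support radius becomes
   [6 * r = 24 * del]. *)
pose r := 4 * del; have r0 : 0 < r by rewrite mulr_gt0.
have PV i : (i < n)%N -> `|P i - c| <= r /\ ~ Omega (P i).
  move=> i_n; have [BP _ _] := HP i i_n; split; last by move=> OP; exact: (Omega_notin OP BP).
  by apply: le_trans (Pc i i_n) _; rewrite /r; lra.
(* A single exterior pole suffices: it stays at distance at least [del / 2] from the disk, and no
   period curve winds around it. *)
pose Q (i : nat) := q.
have QV i : (i < n)%N -> `|Q i - c| <= r /\ ~ Omega (Q i).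
  move=> _; split; first by rewrite /r /Q; lra.
  by move=> [/disk_nsq + _]; rewrite ltNge q1.
set tau := block n P Q c r.
have ct : closed_form Omega tau by exact: block_closed.
have r6 : 6 * r = 24 * del by rewrite /r; ring.
have sup z : 24 * del < `|z - c| -> tau z = (0, 0) by rewrite -r6 => h; exact: (block_support r0 PV QV h).
exists tau; split => //.
- move=> l; rewrite -[X in _ = X]subr0; apply: (@block_period R Omega n P Q c r n0 r0 PV QV); first exact: gamma_smooth.
  + by move=> t; exact: gamma_Omega.
  + by move=> i i_n; apply: winding_hole; case: (HP i i_n).
  + move=> i _; apply: winding_outside => //; first exact: gamma_smooth.
    by move=> t; apply: disk_nsq; case: (gamma_Omega l t).
- by move=> z _; exact: sup.
- move=> eta e0; have supO z : Omega z -> 24 * del < `|z - c| -> tau z = (0, 0) by move=> _; exact: sup.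
  rewrite (wenergy_box eta ct supO); set D := (_ `&` _).
  have L0 : 0 < 24 * del by rewrite mulr_gt0.
  have mD : measurable (D : set (mplane R)) by apply: measurableI => //; exact: measurable_box.
  have DO : D `<=` Omega by move=> z [].
  have DL : D `<=` box c (24 * del) by move=> z [].
  have mP : measurable_fun (D : set (mplane R)) (fun z : mplane R => (avg_inv n P z ^+ 2)%:E).
    apply: (measurable_funS mO DO); apply: measurable_avg_inv => // i i_n; by case: (PV i i_n).
  have mw : measurable_fun (D : set (mplane R)) (fun z : mplane R => (gapw eta z)%:E).
    by apply: (measurable_funS mO DO); exact: measurable_gapw.
  have sdel : 0 < Num.sqrt del by rewrite sqrtr_gt0.
  have sdelE : Num.sqrt del * Num.sqrt del = del by rewrite -expr2 sqr_sqrtr// ltW.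
  pose a := K2 * (2 / Num.sqrt del); pose b := K2 * (68 / del ^+ 2).
  have a0 : 0 <= a by rewrite mulr_ge0 ?K2_ge0// divr_ge0 ?sqrtr_ge0.
  have b0 : 0 <= b by rewrite mulr_ge0 ?K2_ge0// divr_ge0 ?sqr_ge0.
  have d8 : 0 < d / 8 by rewrite divr_gt0.
  pose X := spread_cst * Num.sqrt (24 * del) / Num.sqrt (d / 8).
  pose Y := 128 * (24 * del) * Num.sqrt (24 * del).
  have IP : (\int[lambda2 R]_(z in D) (avg_inv n P z ^+ 2)%:E <= X%:E)%E.
    apply: (@avg_inv_energy R p0 c) => // i i_n; have [_ PE Pz] := HP i i_n.
    by split => // z [Oz _]; exact: Pz.
  have Iw : (\int[lambda2 R]_(z in D) (gapw eta z)%:E <= Y%:E)%E.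
    by apply: (integral_box_gap L0 e0 mD DL) => z [[dz _] _]; exact: disk_nsq.
  have nP z : (0 <= (avg_inv n P z ^+ 2)%:E)%E by rewrite lee_fin sqr_ge0.
  have nw z : (0 <= (gapw eta z)%:E)%E by rewrite lee_fin gapw_ge0.
  apply: (@le_trans _ _ (\int[lambda2 R]_(z in D)
     (a%:E * (avg_inv n P z ^+ 2)%:E + b%:E * (gapw eta z)%:E))%E).
    apply: ge0_le_integral => //.
    + by move=> z _; rewrite lee_fin mulr_ge0 ?gapw_ge0 ?sqn_ge0.
    + by apply: (measurable_funS mO DO); exact: measurable_wsqn.
    + by apply: emeasurable_funD; exact: measurable_funeM.
    + move=> z [Oz _]; rewrite -!EFinM -EFinD lee_fin.
      have tz : sqn tau z <= K2 * (avg_inv n P z ^+ 2 + avg_inv n Q z ^+ 2) by exact: (block_le n0 r0 PV QV Oz).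
      have fQ : avg_inv n Q z <= 2 / del.
        have -> : avg_inv n Q z = `|z - q|^-1.
          by rewrite /avg_inv (eq_bigr (fun=> `|z - q|^-1))// sumr_const card_ord -[X in _ * X]mulr_natl mulKf// gt_eqF.
        exact: (invr_le_div _ del0 (qd z (Omega_disk Oz))).
      have fQ2 : avg_inv n Q z ^+ 2 <= 4 / del ^+ 2.
        have -> : 4 = 2 ^+ 2 :> R by rewrite -natrX.
        by rewrite -exprVn -exprMn lerXn2r ?nnegrE ?avg_inv_ge0// divr_ge0// ltW.
      apply: le_trans (ler_wpM2l (gapw_ge0 _ _) tz) _.
      rewrite [leLHS](_ : _ = K2 * (gapw eta z * (avg_inv n P z ^+ 2 + avg_inv n Q z ^+ 2)));
        last by ring.
      rewrite [leRHS](_ : _ = K2 * (2 / Num.sqrt del * avg_inv n P z ^+ 2 +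
        68 / del ^+ 2 * gapw eta z)); last by rewrite /a /b; ring.
      apply: ler_wpM2l; first exact: K2_ge0.
      have wz0 := gapw_ge0 eta z.
      (* The radius 3/8 is the range of [gap_weight], and it exceeds by [del / 8] the distance
         [del / 4] within which the poles lie. *)
      have [near|far] := leP `|z - c| (3 / 8 * del).
        have wz : gapw eta z <= 2 / Num.sqrt del by exact: gap_weight.
        rewrite mulrDr; apply: lerD.
          by apply: ler_wpM2r => //; exact: sqr_ge0.
        rewrite [leRHS]mulrC; apply: ler_wpM2l => //; apply: le_trans fQ2 _.
        by rewrite ler_pM2r ?invr_gt0 ?exprn_gt0// ler_nat.
      have fP : avg_inv n P z <= 8 / del.
        rewrite /avg_inv mulrC ler_pdivrMr// (_ : 8 / del * n%:R = \sum_(i < n) 8 / del); last first.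
          by rewrite sumr_const card_ord mulr_natr.
        apply: ler_sum => i _.
        apply: (invr_le_div (k := 8)) => //.
        have := ler_normD (z - P i) (P i - c); rewrite addrA subrK.
        have := Pc i (ltn_ord i); lra.
      have fP2 : avg_inv n P z ^+ 2 <= 64 / del ^+ 2.
        have -> : 64 = 8 ^+ 2 :> R by rewrite -natrX.
        by rewrite -exprVn -exprMn lerXn2r ?nnegrE ?avg_inv_ge0// divr_ge0// ltW.
      apply: (@le_trans _ _ (gapw eta z * (68 / del ^+ 2))).
        apply: ler_wpM2l => //.
        have -> : 68 / del ^+ 2 = 64 / del ^+ 2 + 4 / del ^+ 2 by rewrite -mulrDl -natrD.
        exact: lerD.
      have : 0 <= 2 / Num.sqrt del * avg_inv n P z ^+ 2.
        by rewrite mulr_ge0 ?sqr_ge0// divr_ge0// ltW.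
      by rewrite mulrA [gapw eta z * _]mulrC mulrA => h; rewrite lerDr.
  rewrite ge0_integralD//; last 4 first.
  + by move=> z _; exact: mule_ge0.
  + exact: measurable_funeM.
  + by move=> z _; exact: mule_ge0.
  + exact: measurable_funeM.
  rewrite !ge0_integralZl_EFin//; apply: (@le_trans _ _ (a%:E * X%:E + b%:E * Y%:E)%E).
    by apply: leeD; apply: lee_wpmul2l => //; rewrite lee_fin.
  rewrite -!EFinM -EFinD lee_fin /a /b /X /Y /exit_energy.
  have -> : d / 8 = kap / 8 * del by rewrite /d; field.
  have k80 : 0 <= kap / 8 by rewrite divr_ge0 ?ltW.
  rewrite (sqrtrM del k80) (sqrtrM del (ler0n R 24)).
  have s8 : Num.sqrt (kap / 8) != 0 by rewrite gt_eqF// sqrtr_gt0 divr_gt0.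
  rewrite le_eqVlt; apply/orP; left; apply/eqP.
  rewrite -[in del ^+ 2]sdelE -[in 24 * del]sdelE.
  move: (Num.sqrt del) (Num.sqrt (kap / 8)) (Num.sqrt 24) sdel s8 => sd sk s24 sd0 sk0.
  by field; rewrite sk0 gt_eqF.
Qed.

End LocalForms.

(** * Forms with a single unit period, built along walks in the graph *)

Section Chains.
Context {R : realType} {J : countType}.
Variables (B : J -> set (plane R)) (gamma : J -> R -> plane R).
Hypotheses (HB : regular_holes B) (Hg : period_curves B gamma).
Implicit Types (j k l : J) (z w p q c : plane R) (tau : one_form R).

Lemma hole_form_ext c (del E E' : R) per per' tau : E <= E' -> (forall l, per l = per' l) ->
  hole_form B gamma c del E per tau -> hole_form B gamma c del E' per' tau.
Proof.
move=> EE pp [ct pt st et]; split => //.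
  by move=> l; rewrite -pp.
move=> eta e0; apply: le_trans (et eta e0) _; rewrite lee_fin.
by apply: ler_wpM2r => //; rewrite invr_ge0 sqrtr_ge0.
Qed.

Lemma spread_cst_ge0 : 0 <= spread_cst :> R.
Proof. by apply: mulr_ge0; exact: ler0n. Qed.

Lemma edge_energy_ge0 S : 0 <= edge_energy S :> R.
Proof. apply: mulr_ge0; [apply: mulr_ge0; [apply: mulr_ge0|]|]; rewrite ?ler0n ?spread_cst_ge0 ?K2_ge0 ?sqrtr_ge0//. Qed.

Lemma exit_energy_ge0 kap : 0 <= exit_energy kap :> R.
Proof.
apply: mulr_ge0; [exact: K2_ge0|apply: addr_ge0].
  apply: mulr_ge0; last by apply: divr_ge0; exact: sqrtr_ge0.
  by apply: mulr_ge0; rewrite ?ler0n ?spread_cst_ge0.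
by apply: mulr_ge0; rewrite ?ler0n.
Qed.

(** Below this ratio of diameter to gap a hole counts as small. One step over small holes moves by
    at most [(S + 2) * ratio S M] gaps, so [M] steps stay within 1/96 of the gap. *)
Definition ratio (S : R) (M : nat) : R := (96 * (S + 2) * M.+1%:R)^-1.

(* Follow the walk until a hole whose size is comparable with the gap of [c]; the holes met
   before are so small that the walk stays close to [c]. *)
Lemma chain_form S (M : nat) c : 0 < S -> disk c ->
  forall (p : seq (option J)) k y, (size p <= M)%N -> path (edge B S) (Some k) p ->
    last (Some k) p = None -> B k y ->
    `|y - c| <= (M - size p)%:R * (S + 2) * ratio S M * disk_gap c ->
  exists tau, hole_form B gamma c (disk_gap c)
    (8 ^+ size p * (edge_energy S + exit_energy (ratio S M))) (fun l => (l == k)%:R) tau.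
Proof.
move=> S0 dc; set del := disk_gap c; set kap := ratio S M.
have del0 : 0 < del by exact/diskE.
have M0 : 0 < M.+1%:R :> R by rewrite ltr0n.
have S2 : 0 < S + 2 by rewrite addr_gt0.
have k0 : 0 < kap by rewrite invr_gt0 !mulr_gt0.
have kE : kap * (S + 2) * M.+1%:R = 96^-1.
  rewrite /kap /ratio; field; rewrite !gt_eqF//.
have kS : kap * (S + 2) <= 96^-1.
  rewrite -kE -[leLHS]mulr1 ler_pM2l ?mulr_gt0//; by rewrite ler1n.
have kS1 : kap * S + kap * 2 <= 96^-1 by rewrite -mulrDr.
have kS0 : 0 < kap * S by rewrite mulr_gt0.
have k1 : kap <= 192^-1 by lra.
have kS' : kap * S <= 96^-1 by lra.
have kd : 0 < kap * del by rewrite mulr_gt0.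
have kdel : kap * del <= 192^-1 * del by rewrite ler_pM2r.
have E0 := edge_energy_ge0 S; have E1 := exit_energy_ge0 kap.
set E := edge_energy S + exit_energy kap.
have EE : 0 <= E by rewrite addr_ge0.
have driftM n : (n <= M)%N -> n%:R * (S + 2) * kap * del <= 96^-1 * del.
  move=> nM; rewrite ler_pM2r// -kE.
  have -> : n%:R * (S + 2) * kap = kap * (S + 2) * n%:R by ring.
  by rewrite ler_pM2l ?mulr_gt0// ler_nat leqW.
elim=> [|v p IH] k y /= sp; first by [].
move=> /andP[ekv pp] lp By yc.
(* Here [M - size p] bounds the number of edges already walked, each of which adds at most
   [(S + 2) * kap * del] to the drift. *)
have yc' : `|y - c| <= 96^-1 * del by apply: le_trans yc _; apply: driftM; exact: leq_subr.
have e8 : 1 <= 8 ^+ (size p).+1 :> R by rewrite exprn_ege1// ler1n.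
have [big|small] := leP (kap * del) (diam (B k)).
  have yc16 : `|y - c| <= del / 16 by lra.
  have k1' : kap <= 1 by lra.
  have [tau Htau] := exit_form HB Hg k0 k1' By dc yc16 big.
  exists tau; apply: hole_form_ext Htau => //.
  apply: (@le_trans _ _ E); first by rewrite lerDr.
  by rewrite -[leLHS]mul1r ler_wpM2r.
have Bc z : B k z -> `|z - c| <= 64^-1 * del.
  move=> Bz; have := hole_dist HB Bz By; have := ler_normD (z - y) (y - c).
  rewrite addrA subrK; lra.
case: v ekv pp lp => [k'|] ekv pp lp; last first.
  (* A small hole near [c] has no edge to the circle: its distance from the circle is at least
     [del / 2], while such an edge allows at most [del / 96]. *)
  exfalso; have := asboolW ekv; rewrite /adjacent => h.
  have : del / 2 <= set_dist (B k) (~` disk).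
    apply: (set_dist_disk HB) => z Bz.
    have := disk_gap_lip z c; have := Bc z Bz; rewrite -/del; lra.
  have : S * diam (B k) <= S * (kap * del) by rewrite ler_pM2l// ltW.
  have : S * (kap * del) <= 96^-1 * del by rewrite mulrA ler_pM2r// mulrC.
  move: h => /=; lra.
have := asboolW ekv; rewrite /adjacent => -[kk' dist].
set d := Num.min _ _ in dist.
have d0 : 0 < d by rewrite lt_min !(diam_gt0 HB).
have dk : d <= diam (B k) by rewrite ge_min lexx.
have dk' : d <= diam (B k') by rewrite ge_min lexx orbT.
have dkd : d <= kap * del by apply: le_trans dk (ltW small).
have neq : k != k' by apply/eqP.
have Bc8 z : B k z -> `|z - c| <= disk_gap c / 8 by move=> /Bc; rewrite -/del; lra.
have sml : 6 * (S + 2) * d <= disk_gap c / 16.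
  have : (S + 2) * d <= (S + 2) * (kap * del) by rewrite ler_pM2l.
  have : (S + 2) * (kap * del) <= 96^-1 * del by rewrite mulrA ler_pM2r// mulrC.
  rewrite -/del -mulrA; lra.
have [[y0 [w [By0 Bw y0w]]] [tau Htau]] := edge_form HB Hg S0 neq d0 dk dk' dist dc Bc8 sml.
(* One more step: crossing the hole costs its diameter, at most [kap * del], and the edge costs
   [(S + 1) * d]. *)
have wc : `|w - c| <= (M - size p)%:R * (S + 2) * kap * del.
  have -> : (M - size p)%N = (M - (size p).+1).+1 by rewrite subnSK.
  rewrite -natr1; set n : R := (M - (size p).+1)%:R.
  have -> : (n + 1) * (S + 2) * kap * del =
    n * (S + 2) * kap * del + ((S + 1) * (kap * del) + kap * del) by ring.
  have t1 := ler_normD (w - y0) ((y0 - y) + (y - c)).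
  have t2 := ler_normD (y0 - y) (y - c).
  have tE : (w - y0) + ((y0 - y) + (y - c)) = w - c by rewrite !addrA !subrK.
  rewrite tE (distrC w y0) in t1.
  have h1 := hole_dist HB By0 By.
  have h2 : (S + 1) * d <= (S + 1) * (kap * del) by rewrite ler_pM2l// addr_gt0.
  move: yc; rewrite -/n; move: (n * (S + 2) * kap * del) => drift yc; lra.
have [tau' Htau'] := IH k' w (ltnW sp) pp lp Bw wc.
exists (fun z => ((tau z).1 + (tau' z).1, (tau z).2 + (tau' z).2)).
apply: hole_form_ext (hole_formD HB Hg Htau Htau') => [|l]; last by rewrite subrK.
(* Adding two forms doubles both energies, and twice the edge energy plus twice the energy of the
   rest is within the factor 8 allowed per edge. *)
rewrite exprS; have h8 : 1 <= 8 ^+ size p :> R by rewrite exprn_ege1// ler1n.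
have : E <= 8 ^+ size p * E by rewrite -[leLHS]mul1r ler_wpM2r.
have : edge_energy S <= E by rewrite lerDl.
rewrite -mulrA; move: (8 ^+ size p * E) => X; lra.
Qed.

Definition hole_energy (S : R) (M : nat) : R :=
  8 ^+ M * (edge_energy S + exit_energy (ratio S M)).

Lemma hole_energy_ge0 S M : 0 <= hole_energy S M.
Proof. by rewrite mulr_ge0 ?exprn_ge0// addr_ge0 ?edge_energy_ge0 ?exit_energy_ge0. Qed.

(** An infimum of at most [M] lies below [M.+1], so some walk has fewer than [M.+1] edges;
    attainment of the infimum is not involved. *)
Lemma exists_walk S (M : nat) j : (graph_dist B S (Some j) None <= M%:R%:E)%E ->
  exists p : seq (option J), [/\ (size p <= M)%N, path (edge B S) (Some j) p & last (Some j) p = None].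
Proof.
move=> gd; have : (graph_dist B S (Some j) None < M.+1%:R%:E)%E.
  by apply: le_lt_trans gd _; rewrite lte_fin ltr_nat.
move=> /ereal_inf_lt[_ [p [pp lp] <-]]; rewrite lte_fin ltr_nat ltnS => sp.
by exists p.
Qed.

Lemma exists_hole_form S (M : nat) j c : 0 < S -> B j c ->
  (graph_dist B S (Some j) None <= M%:R%:E)%E ->
  exists tau, hole_form B gamma c (disk_gap c) (hole_energy S M) (fun l => (l == j)%:R) tau.
Proof.
move=> S0 Bc /exists_walk[p [sp pp lp]]; have dc := holes_disk HB Bc.
have del0 := (diskE c).1 dc.
have r0 : 0 <= ratio S M by rewrite invr_ge0 !mulr_ge0// addr_ge0// ltW.
have [|tau Htau] := chain_form S0 dc sp pp lp Bc.
  by rewrite subrr normr0 !mulr_ge0 ?(ltW del0)// addr_ge0// ltW.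
exists tau; apply: hole_form_ext Htau => //.
rewrite ler_wpM2r ?addr_ge0 ?edge_energy_ge0 ?exit_energy_ge0//.
by rewrite ler_weXn2l// ler1n.
Qed.

End Chains.

(** * Local finiteness turned into a bound for the sum over scales *)

Section Counting.
Context {R : realType} {J : countType}.
Variables (B : J -> set (plane R)) (N : nat).
Hypotheses (HB : regular_holes B) (HN : hyp_disks_meet_at_most B N).
Implicit Types (z w x : plane R).

(** The modulus of [1 - a * b^*] is at least the gap of [z], so the pseudohyperbolic distance is at
    most 1/2. The logarithm is then taken of a number at most 3, and [3 < expR 2]. *)
Lemma hdist_lt1 z w : disk z -> disk w -> 2 * Num.sqrt (nsq (z - w)) <= disk_gap z -> hdist z w < 1.
Proof.
move=> dz dw zw; have gz := (diskE z).1 dz.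
set a := to_complex z; set b := to_complex w.
have na : Normc.normc (a - b) = Num.sqrt (nsq (z - w)) by [].
have den : disk_gap z <= Normc.normc (1 - a * b^*)%C.
  have -> : Normc.normc (1 - a * b^*)%C =
      Num.sqrt (nsq ((1, 0) - (z.1 * w.1 + z.2 * w.2, z.2 * w.1 - z.1 * w.2))).
    rewrite /nsq /a /b /to_complex /=; congr Num.sqrt; ring.
  set v := (_, _) in |- *; set u := (z.1 * w.1 + z.2 * w.2, _).
  have := nsqD_le (v - u) u; rewrite subrK.
  have -> : Num.sqrt (nsq v) = 1 by rewrite /nsq /= expr1n expr0n addr0 sqrtr1.
  have : Num.sqrt (nsq u) <= Num.sqrt (nsq z).
    rewrite ler_sqrt ?nsq_ge0//.
    have -> : nsq u = nsq z * nsq w by rewrite /nsq /=; ring.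
    by rewrite ler_piMr ?nsq_ge0// ltW// disk_nsq.
  rewrite /disk_gap; lra.
have den0 : 0 < Normc.normc (1 - a * b^*)%C by exact: lt_le_trans den.
set t := Normc.normc ((a - b) / (1 - a * b^*))%C.
have tE : t = Num.sqrt (nsq (z - w)) / Normc.normc (1 - a * b^*)%C.
  by rewrite /t Normc.normcM Normc.normcV.
have t0 : 0 <= t by rewrite tE divr_ge0 ?sqrtr_ge0// ltW.
have t2 : t <= 1 / 2 by rewrite tE ler_pdivrMr//; lra.
rewrite /hdist -/a -/b -/t /artanh.
rewrite ltr_pdivrMr// mul1r -ltr_expR lnK ?posrE; last by rewrite divr_gt0; lra.
have e2 : 4 <= expR (2 : R).
  have -> : (2 : R) = 1 + 1 by ring.
  rewrite expRD; have := expR_ge1Dx (1 : R); nra.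
apply: lt_le_trans e2; rewrite ltr_pdivrMr; lra.
Qed.

Variable c : J -> plane R.
Local Notation sqrt_gap j := (Num.sqrt (disk_gap (c j))).
Hypothesis Bc : forall j, B j (c j).

(** A sup distance of a quarter of the gap is a Euclidean distance of at most half the gap, hence
    hyperbolic distance below 1: all these holes meet one hyperbolic disk of radius 1. *)
Lemma close_holes (s : seq J) x : uniq s -> disk x ->
  {in s, forall j, `|x - c j| <= disk_gap x / 4} -> (size s <= N)%N.
Proof.
move=> us dx Hs; have /pcard_leP[f] := HN dx.
have S j : j \in s -> (B j `&` hdisk x 1) !=set0.
  move=> js; exists (c j); split; first exact: Bc.
  have dj := holes_disk HB (Bc j); split => //; apply: hdist_lt1 => //.
  have := sqrt_nsq_le (x - c j); have := Hs j js; lra.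
rewrite -(size_map f); apply: (@leq_trans (size (iota 0 N))); last by rewrite size_iota.
apply: uniq_leq_size.
  rewrite map_inj_in_uniq// => i j /S Si /S Sj; apply: (inj (f := f)); by rewrite inE.
move=> _ /mapP[j js ->]; rewrite mem_iota add0n /=.
exact: (@funS _ _ _ _ f j (S j js)).
Qed.

(* Enough cells of side [t / 8] to cover an interval of length [192 t]. *)
Definition grid : nat := 2048.

Lemma scale_exists (s d : R) : 0 < s -> s <= d -> exists m : nat, 4 ^+ m * s <= d < 4 ^+ m.+1 * s.
Proof.
move=> s0 sd.
have ex : exists m : nat, d < 4 ^+ m.+1 * s.
  exists (Num.truncn (d / s)); rewrite -ltr_pdivrMr//.
  apply: lt_le_trans (truncnS_gt _) _; set n := (_).+1.
  rewrite -natrX ler_nat; apply: ltnW; exact: ltn_expl.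
case: (ex_minnP ex) => m dm mmin; exists m; rewrite dm andbT.
case: m dm mmin => [|m] dm mmin; first by rewrite expr0 mul1r.
by rewrite leNgt; apply/negP => /mmin; rewrite ltnn.
Qed.

(** All [c j] lie within [96 * t] of [x]. Two of them in the same cell of side [t / 8] are within a
    quarter of the gap of either, so a cell holds at most [N]. *)
Lemma count_scale (s : seq J) x (t : R) : uniq s -> 0 < t ->
  {in s, forall j, `|x - c j| <= 24 * disk_gap (c j) /\ t <= disk_gap (c j) < 4 * t} ->
  (size s <= N * (grid * grid))%N.
Proof.
move=> us t0 Hs.
pose cell (u v : R) : nat := Num.truncn ((u - v + 96 * t) / (t / 8)).
have t8 : 0 < t / 8 by rewrite divr_gt0.
have bnd j (u v : R) : j \in s -> `|v - u| <= `|x - c j| ->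
    0 <= (u - v + 96 * t) / (t / 8) /\ (cell u v < grid.-1.+1)%N.
  move=> js uv; have [h1 /andP[h2 h3]] := Hs j js.
  have uv96 : `|u - v| <= 96 * t by rewrite distrC; apply: le_trans uv _; lra.
  have /andP[u1 u2] : - (96 * t) <= u - v <= 96 * t by rewrite -ler_norml.
  have p0 : 0 <= (u - v + 96 * t) / (t / 8) by rewrite divr_ge0 ?(ltW t8)//; lra.
  split => //; rewrite /cell truncn_lt_nat//; rewrite ltr_pdivrMr//.
  have -> : grid.-1.+1%:R = 2048 :> R by [].
  lra.
pose f j : 'I_grid.-1.+1 * 'I_grid.-1.+1 := (inord (cell (c j).1 x.1), inord (cell (c j).2 x.2)).
have sum1 : size s = \sum_(i : 'I_grid.-1.+1 * 'I_grid.-1.+1) count (fun j => f j == i) s.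
  rewrite -sum1_size (partition_big f xpredT)//=; apply: eq_bigr => i _.
  by rewrite sum1_count.
have cnt i : (count (fun j => f j == i) s <= N)%N.
  rewrite -size_filter; case E : [seq j <- s | f j == i] => [//|j0 s'].
  rewrite -E.
  have j0s : j0 \in [seq j <- s | f j == i] by rewrite E mem_head.
  move: j0s; rewrite mem_filter => /andP[/eqP f0 j0s].
  have dj0 := holes_disk HB (Bc j0).
  (* The hyperbolic disk is centred at one of the points of the cell, not at [x], whose gap may be
     far below [t]. *)
  apply: (@close_holes _ (c j0)) => //; first exact: filter_uniq.
  move=> j; rewrite mem_filter => /andP[/eqP fj js].
  have [_ /andP[td0 _]] := Hs j0 j0s.
  have close (u u' v : R) : `|v - u| <= `|x - c j0| -> `|v - u'| <= `|x - c j| ->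
      cell u v = cell u' v -> `|u - u'| <= disk_gap (c j0) / 4.
    move=> h h' ce; have [p q] := bnd j0 u v j0s h; have [p' q'] := bnd j u' v js h'.
    have /andP[a1 a2] := truncn_itv p; have /andP[b1 b2] := truncn_itv p'.
    rewrite -/(cell u v) in a1 a2; rewrite -/(cell u' v) -ce in b1 b2.
    rewrite ler_pdivlMr// in a1; rewrite ler_pdivlMr// in b1.
    rewrite ltr_pdivrMr// -[(cell u v).+1%:R]natr1 in a2.
    rewrite ltr_pdivrMr// -[(cell u v).+1%:R]natr1 in b2.
    move: ((cell u v)%:R : R) a1 a2 b1 b2 => n a1 a2 b1 b2.
    by rewrite ler_norml; apply/andP; split; lra.
  have e1 : cell (c j0).1 x.1 = cell (c j).1 x.1.
    have /(congr1 (fun p => val p.1)) : f j0 = f j by rewrite f0 fj.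
    by rewrite /= !inordK //; [apply: (bnd j _ _ js _).2|apply: (bnd j0 _ _ j0s _).2];
      exact: (norm1_le (x - c _)).
  have e2 : cell (c j0).2 x.2 = cell (c j).2 x.2.
    have /(congr1 (fun p => val p.2)) : f j0 = f j by rewrite f0 fj.
    by rewrite /= !inordK //; [apply: (bnd j _ _ js _).2|apply: (bnd j0 _ _ j0s _).2];
      exact: (norm2_le (x - c _)).
  rewrite plane_norm ge_max; apply/andP; split.
    by apply: (close _ _ x.1) => //; exact: (norm1_le (x - c _)).
  by apply: (close _ _ x.2) => //; exact: (norm2_le (x - c _)).
rewrite sum1; apply: (@leq_trans (\sum_(i : 'I_grid.-1.+1 * 'I_grid.-1.+1) N)%N).
  by apply: leq_sum => i _; exact: cnt.
by rewrite sum_nat_const card_prod !card_ord mulnC.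
Qed.

(** 2 is the geometric sum of ratio 1/2, the middle factor is the count for one scale, and 7 is the
    square root of 49. *)
Definition count_cst : R := 2 * (N * (grid * grid))%:R * 7.

(* Boundedly many points have gap of order [4 ^ m * s0], so the sum is dominated by a
   geometric one. *)
Lemma sum_inv_sqrt_gap (s : seq J) x : uniq s -> disk x ->
  {in s, forall j, `|x - c j| <= 24 * disk_gap (c j)} ->
  \sum_(j <- s) (sqrt_gap j)^-1 <= count_cst / Num.sqrt (disk_gap x).
Proof.
move=> us dx Hs; have gx := (diskE x).1 dx.
(* The smallest scale that can occur: the gap at [x] exceeds that at [c j] by at most [2 * 24] gaps
   of [c j]. *)
pose s0 := disk_gap x / 49; have s00 : 0 < s0 by rewrite divr_gt0.
have low j : j \in s -> s0 <= disk_gap (c j).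
  move=> js; have := Hs j js; have := disk_gap_lip (c j) x; rewrite distrC /s0; lra.
have [m Hm] : exists m : J -> nat, forall j, j \in s -> 4 ^+ m j * s0 <= disk_gap (c j) < 4 ^+ (m j).+1 * s0.
  have pt j : exists n : nat, j \in s -> 4 ^+ n * s0 <= disk_gap (c j) < 4 ^+ n.+1 * s0.
    have [js|js] := boolP (j \in s); last by exists 0%N.
    by have [n Hn] := scale_exists s00 (low j js); exists n.
  by have [m Hm] := boolp.choice pt; exists m.
pose X := (\max_(j <- s) m j).+1.
pose K : R := (N * (grid * grid))%:R.
have sq0 : 0 < Num.sqrt s0 by rewrite sqrtr_gt0.
(* Scales are powers of 4, so the inverse square root halves from one layer to the next while the
   count stays bounded. *)
have layer (i : nat) : \sum_(j <- s | m j == i) (sqrt_gap j)^-1 <=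
    K * (Num.sqrt s0)^-1 * 2^-1 ^+ i.
  have t0 : 0 < 4 ^+ i * s0 by rewrite mulr_gt0// exprn_gt0.
  have H2 : Num.sqrt (4 ^+ i * s0) = 2 ^+ i * Num.sqrt s0.
    rewrite sqrtrM ?exprn_ge0//; congr (_ * _).
    have -> : 4 ^+ i = (2 ^+ i) ^+ 2 :> R by rewrite exprAC; congr (_ ^+ _); ring.
    by rewrite sqrtr_sqr ger0_norm ?exprn_ge0.
  apply: (@le_trans _ _ (\sum_(j <- s | m j == i) (Num.sqrt s0)^-1 * 2^-1 ^+ i)).
    rewrite big_seq_cond [leRHS]big_seq_cond; apply: ler_sum => j /andP[js /eqP mi].
    have /andP[lo hi] := Hm j js; rewrite mi in lo.
    rewrite exprVn -invfM mulrC -H2 lef_pV2 ?posrE ?sqrtr_gt0//; last exact: lt_le_trans lo.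
    exact: ler_wsqrtr.
  rewrite -big_filter big_const_seq count_predT iter_addr_0 -mulrA -[leLHS]mulr_natl; apply: ler_wpM2r.
    by rewrite mulr_ge0 ?exprn_ge0 ?invr_ge0// ltW.
  rewrite ler_nat; apply: (@count_scale _ x (4 ^+ i * s0)) => //; first exact: filter_uniq.
  move=> j; rewrite mem_filter => /andP[/eqP mi js]; split; first exact: Hs.
  by have := Hm j js; rewrite mi exprS mulrA.
have E : \sum_(j <- s) (sqrt_gap j)^-1 =
   \sum_(i < X) \sum_(j <- s | m j == i) (sqrt_gap j)^-1.
  rewrite big_seq (partition_big (fun j => inord (m j) : 'I_X) xpredT)//=.
  apply: eq_bigr => i _; rewrite [RHS]big_seq_cond; apply: eq_bigl => j.
  have [js|//] := boolP (j \in s).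
  have mX : (m j < X)%N by rewrite ltnS; apply: leq_bigmax_seq.
  by rewrite /= -(inj_eq val_inj) /= inordK.
rewrite E; apply: (@le_trans _ _ (\sum_(i < X) K * (Num.sqrt s0)^-1 * 2^-1 ^+ i)).
  by apply: ler_sum => i _; exact: layer.
rewrite -mulr_sumr.
have geo (n : nat) : \sum_(i < n) 2^-1 ^+ i <= 2 - 2 * 2^-1 ^+ n :> R.
  elim: n => [|n IH]; first by rewrite big_ord0 expr0 mulr1 subrr.
  rewrite big_ord_recr /= exprS; lra.
have geo2 : \sum_(i < X) 2^-1 ^+ i <= 2 :> R.
  by apply: le_trans (geo X) _; rewrite gerBl mulr_ge0// exprn_ge0// invr_ge0.
have sE : Num.sqrt s0 = Num.sqrt (disk_gap x) / 7.
  rewrite /s0 sqrtrM ?(ltW gx)//; congr (_ * _).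
  by rewrite (_ : 49^-1 = 7^-1 ^+ 2) ?sqrtr_sqr ?ger0_norm ?invr_ge0//; field.
apply: (@le_trans _ _ (K * (Num.sqrt s0)^-1 * 2)).
  by apply: ler_wpM2l => //; rewrite mulr_ge0 ?invr_ge0 ?(ltW sq0).
have gn : Num.sqrt (disk_gap x) != 0 by rewrite gt_eqF ?sqrtr_gt0.
by rewrite sE /count_cst -/K le_eqVlt; apply/orP; left; apply/eqP; field.
Qed.

End Counting.

Lemma big_uniq_sub {V : nmodType} {I : eqType} (s t : seq I) (F : I -> V) :
  uniq s -> uniq t -> {subset t <= s} -> {in s, forall i, i \notin t -> F i = 0} ->
  \sum_(i <- s) F i = \sum_(i <- t) F i.
Proof.
move=> us ut ts F0; rewrite (bigID (mem t)) /= [X in _ + X]big_seq_cond.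
rewrite [X in _ + X]big1 ?addr0 => [|i /andP[]]; last exact: F0.
rewrite -big_filter; apply: perm_big; apply: uniq_perm => //; first exact: filter_uniq.
by move=> i; rewrite mem_filter; apply/andP/idP => [[]//|ti]; split => //; exact: ts.
Qed.

(** * The locally finite sum of the forms of all holes *)

Section Superposition.
Context {R : realType} {J : countType}.
Variables (B : J -> set (plane R)) (gamma : J -> R -> plane R) (N : nat) (E : R).
Hypotheses (HB : regular_holes B) (Hg : period_curves B gamma) (HN : hyp_disks_meet_at_most B N).
Variables (c : J -> plane R) (tau : J -> one_form R).
Hypotheses (E0 : 0 <= E) (Bc : forall j, B j (c j)).
Hypothesis Htau : forall j,
  hole_form B gamma (c j) (disk_gap (c j)) E (fun l => (l == j)%:R) (tau j).
Variable a : J -> R.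
Hypothesis Ha : (l2_sqnorm a < +oo)%E.

Local Notation sqrt_gap j := (Num.sqrt (disk_gap (c j))).
Let Omega := regular_domain B.
Let oO : open Omega := @open_Omega R J B HB.
Let mO : measurable (Omega : set (mplane R)) := open_measurable_plane oO.

(** [act e] lists all holes whose form can be nonzero somewhere with gap at least [e]; the list is
    finite because the holes accumulate only at the circle. For [e <= 0] its content is
    irrelevant. *)
Lemma exists_active : exists act : R -> seq J, forall e,
  uniq (act e) /\ (0 < e -> forall j, (j \in act e) = (e <= 49 * disk_gap (c j))).
Proof.
suff H e : exists s : seq J, uniq s /\ (0 < e -> forall j, (j \in s) = (e <= 49 * disk_gap (c j))).
  by have [act Hact] := boolp.choice H; exists act.
have [e0|e0] := ltP 0 e; last by exists [::].
have fin : finite_set [set j | e <= 49 * disk_gap (c j)].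
  have e49 : 0 < e / 49 by rewrite divr_gt0.
  apply: sub_finite_set (holes_finite HB e49) => j /= h; exists (c j); first exact: Bc.
  rewrite ler_pdivrMr//; lra.
have [s sE] := (finite_seqP _).1 fin.
exists (undup s); split => [|_ j]; first exact: undup_uniq.
rewrite mem_undup; apply/idP/idP => h.
  have : [set` s] j by [].
  by rewrite -sE.
have : [set j | e <= 49 * disk_gap (c j)] j by [].
by rewrite sE.
Qed.

Let act : R -> seq J := sval (cid exists_active).
Let act_uniq e : uniq (act e). Proof. exact: (svalP (cid exists_active) e).1. Qed.
Let mem_act e j : 0 < e -> (j \in act e) = (e <= 49 * disk_gap (c j)).
Proof. by move=> e0; have [_ ->] := svalP (cid exists_active) e. Qed.

Definition partial_form e : one_form R := fun z =>
  (\sum_(j <- act e) a j * (tau j z).1, \sum_(j <- act e) a j * (tau j z).2).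

(* Near a given point only finitely many of the [tau j] do not vanish. *)
Definition superposition : one_form R := fun z => partial_form (disk_gap z) z.

(* 49 = 2 * 24 + 1, since [disk_gap] is 2-Lipschitz for the sup norm. *)
Lemma tau_far j z : Omega z -> 49 * disk_gap (c j) < disk_gap z -> tau j z = (0, 0).
Proof.
move=> Oz h; have [_ _ st _] := Htau j; apply: st => //.
have := disk_gap_lip (c j) z; rewrite distrC; lra.
Qed.

(** Lowering the threshold below the gap of [z] only adds forms that vanish at [z]. A threshold
    varying with the point may thus be replaced by a fixed one. *)
Lemma superpositionE e z : Omega z -> 0 < e -> e <= disk_gap z ->
  superposition z = partial_form e z.
Proof.
move=> Oz e0 ez; have g0 : 0 < disk_gap z by exact: lt_le_trans ez.
have S : {subset act (disk_gap z) <= act e}.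
  by move=> j; rewrite !mem_act//; exact: le_trans.
have Z : {in act e, forall j, j \notin act (disk_gap z) -> tau j z = (0, 0)}.
  by move=> j _; rewrite mem_act// -ltNge => h; exact: tau_far.
rewrite /superposition /partial_form; congr pair; symmetry; apply: big_uniq_sub => // j js h;
  by rewrite (Z j js h) mulr0.
Qed.

Lemma partial_form_closed e : closed_form Omega (partial_form e).
Proof.
have cF (j : J) : closed_form Omega (fun z => (a j * (tau j z).1, a j * (tau j z).2)).
  by have [ct _ _ _] := Htau j; exact: (closed_formZ (a j) oO ct).
exact: (closed_form_sum (act e) oO cF).
Qed.

(** Around [z] the fixed threshold [disk_gap z / 2] is valid on an open set, where the superposition
    is a finite sum of closed forms. *)
Lemma superposition_closed : closed_form Omega superposition.
Proof.
pose A z : set (plane R) := Omega `&` [set w | disk_gap z / 2 < disk_gap w].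
have oA z : open (A z).
  apply: openI; first exact: oO.
  apply: (open_comp (f := disk_gap) (D := [set x | disk_gap z / 2 < x])); last exact: open_gt.
  by move=> w _; exact: continuous_disk_gap.
apply: (closed_form_cover (A := A)) => z Oz.
have g0 : 0 < disk_gap z by apply/diskE; exact: (Omega_disk Oz).
split; first by split => //=; lra.
apply: (@closed_form_ext _ _ (partial_form (disk_gap z / 2))); first exact: oA.
  by move=> w [Ow /ltW h]; rewrite (@superpositionE (disk_gap z / 2))// divr_gt0.
by apply: closed_form_sub (partial_form_closed _) => w [].
Qed.

(** The gap has a positive minimum along the curve, so one finite partial sum represents the
    superposition on the whole curve. *)
Lemma superposition_period l : line_integral (gamma l) superposition = a l.
Proof.
have sg := gamma_smooth Hg l; have cg := curve_cont_smooth sg.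
have cgap : continuous (fun t => disk_gap (gamma l t)).
  by move=> t; exact: (continuous_comp (cg t) (@continuous_disk_gap R (gamma l t))).
have [t0 _ tmin] := EVT_min (@ler01 R) (continuous_subspaceT cgap).
have dl : forall t, 0 < disk_gap (gamma l t).
  by move=> t; apply/diskE; apply: (Omega_disk (B := B)); exact: gamma_Omega.
set g := disk_gap (gamma l t0) in tmin; have g0 : 0 < g := dl t0.
have -> : line_integral (gamma l) superposition = line_integral (gamma l) (partial_form g).
  apply: eq_Rintegral => t; rewrite inE => t01.
  by rewrite (superpositionE (gamma_Omega Hg l t) g0 (tmin t t01)).
pose F j : one_form R := fun z => (a j * (tau j z).1, a j * (tau j z).2).
have per j : curve_cont (gamma l) (F j) /\ line_integral (gamma l) (F j) = a j * (l == j)%:R.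
  have [_ pt _ _] := Htau j; have [ct <-] := pt l; split; first exact: (curve_contZ (a j) ct).
  exact: (line_integralZ (a j) sg ct).
have [_ ->] := line_integral_sum (act g) sg (fun j => (per j).1).
(* If [l] were absent, [tau l] would vanish along [gamma l], against its period 1. *)
have lact : l \in act g.
  rewrite mem_act// leNgt; apply/negP => lg.
  have [_ pt _ _] := Htau l; have [_] := pt l; rewrite eqxx.
  have -> : line_integral (gamma l) (tau l) = line_integral (gamma l) (fun=> (0, 0)).
    apply: eq_Rintegral => t; rewrite inE => t01.
    rewrite (tau_far (gamma_Omega Hg l t))//; exact: lt_le_trans (tmin t t01).
  by rewrite line_integral0 => /eqP; rewrite eq_sym oner_eq0.
rewrite (bigD1_seq l)//= (per l).2 eqxx mulr1 big1 ?addr0// => j jl.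
by rewrite (per j).2 eq_sym (negbTE jl) mulr0.
Qed.

(** Cauchy-Schwarz is applied to each component with weights [(sqrt_gap j)^-1] over the forms alive
    at [z], whose sum was bounded above. The coefficients are chosen to cancel the factor
    [E / sqrt_gap j] of the energies. *)
Lemma superposition_le eta z : 0 < eta -> Omega z -> eta <= disk_gap z ->
  sqn superposition z <= \sum_(j <- act eta)
    (2 * count_cst N * a j ^+ 2 * sqrt_gap j) * (gapw eta z * sqn (tau j) z).
Proof.
move=> e0 Oz ez; have g0 : 0 < disk_gap z by exact: lt_le_trans ez.
pose P j := `|z - c j| <= 24 * disk_gap (c j).
pose s := [seq j <- act eta | P j].
have cj0 j : 0 < sqrt_gap j.
  by rewrite sqrtr_gt0; apply/diskE; exact: holes_disk (Bc j).
have icj0 j : 0 < (sqrt_gap j)^-1 by rewrite invr_gt0.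
have T0 j : ~~ P j -> tau j z = (0, 0).
  by rewrite -ltNge => h; have [_ _ st _] := Htau j; exact: st.
have cnt : \sum_(j <- s) (sqrt_gap j)^-1 <= count_cst N / Num.sqrt (disk_gap z).
  apply: (sum_inv_sqrt_gap HB HN Bc); first exact: filter_uniq.
    exact: (Omega_disk Oz).
  by move=> j; rewrite mem_filter => /andP[].
have cst0 : 0 <= @count_cst R N by rewrite /count_cst !mulr_ge0.
have restr (u : J -> R) : (forall j, ~~ P j -> u j = 0) ->
    \sum_(j <- act eta) u j = \sum_(j <- s) u j.
  by move=> u0; rewrite big_filter [RHS]big_mkcond; apply: eq_bigr => j _; case: ifPn => // /u0.
have half (u : J -> R) : (forall j, ~~ P j -> u j = 0) ->
    (\sum_(j <- act eta) a j * u j) ^+ 2 <= count_cst N / Num.sqrt (disk_gap z) *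
      \sum_(j <- s) (a j ^+ 2 * sqrt_gap j * u j ^+ 2).
  move=> u0; rewrite restr; last by move=> j /u0 ->; rewrite mulr0.
  apply: le_trans (cauchy_weighted s (fun j => a j * u j) icj0) _.
  have -> : \sum_(j <- s) (a j * u j) ^+ 2 / (sqrt_gap j)^-1 =
      \sum_(j <- s) (a j ^+ 2 * sqrt_gap j * u j ^+ 2).
    by apply: eq_bigr => j _; rewrite invrK exprMn mulrAC.
  apply: ler_wpM2r => //; apply: sumr_ge0 => j _.
  by rewrite mulr_ge0 ?sqr_ge0// mulr_ge0 ?sqr_ge0 ?sqrtr_ge0.
(* Since [eta <= disk_gap z], the shift at most doubles the argument of the square root. *)
have gw : (Num.sqrt (disk_gap z))^-1 <= 2 * gapw eta z.
  have h1 : 0 < Num.sqrt (disk_gap z) by rewrite sqrtr_gt0.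
  have ge0 : 0 < disk_gap z + eta by exact: addr_gt0 g0 e0.
  have h2 : 0 < Num.sqrt (disk_gap z + eta) by rewrite sqrtr_gt0.
  rewrite /gapw -[2]invrK -invfM lef_pV2 ?posrE//; last by rewrite mulr_gt0.
  rewrite mulrC ler_pdivrMr// -(ler_pXn2r (_ : (0 < 2)%N)) ?nnegrE ?(ltW h2)//.
  rewrite exprMn !sqr_sqrtr ?(ltW g0) ?(ltW ge0)//; lra.
rewrite {1}/sqn (superpositionE Oz e0 ez) /partial_form /=.
have h1 := half (fun j => (tau j z).1) (fun j h => congr1 fst (T0 j h)).
have h2 := half (fun j => (tau j z).2) (fun j h => congr1 snd (T0 j h)).
apply: le_trans (lerD h1 h2) _; rewrite -mulrDr -big_split /=.
rewrite restr; last by move=> j /T0 h; rewrite /sqn h /= !expr0n addr0 !mulr0.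
set X := \sum_(j <- s) _.
have X0 : 0 <= X.
  by apply: sumr_ge0 => j _; rewrite addr_ge0// mulr_ge0 ?sqr_ge0// mulr_ge0 ?sqr_ge0 ?sqrtr_ge0.
apply: (@le_trans _ _ (count_cst N * (2 * gapw eta z) * X)).
  by apply: ler_wpM2r => //; apply: ler_wpM2l.
rewrite /X mulr_sumr le_eqVlt; apply/orP; left; apply/eqP.
by apply: eq_bigr => j _; rewrite /sqn; ring.
Qed.

Lemma sum_sqr_le (s : seq J) : uniq s -> \sum_(j <- s) a j ^+ 2 <= fine (l2_sqnorm a).
Proof.
move=> us; have l0 : (0 <= l2_sqnorm a)%E by apply: esum_ge0 => j _; rewrite lee_fin sqr_ge0.
rewrite -lee_fin fineK ?ge0_fin_numE// -sumEFin.
apply: esum_ge; exists [set` s]; first by split => //; exact: finite_seq.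
by rewrite fsbig_seq.
Qed.

(** Where the gap is at least [eta n], a fixed finite list of forms suffices and the sum can be
    exchanged with the integral. The bound does not depend on [n], and monotone convergence exhausts
    the domain. *)
Lemma superposition_energy :
  (form_sqnorm Omega superposition <= (2 * count_cst N * E * fine (l2_sqnorm a))%:E)%E.
Proof.
have cl := superposition_closed.
have cst0 : 0 <= @count_cst R N by rewrite /count_cst !mulr_ge0.
pose eta (n : nat) : R := n.+1%:R^-1.
have eta0 n : 0 < eta n by rewrite invr_gt0.
pose A n : set (mplane R) := Omega `&` [set z | eta n <= disk_gap z].
have mA n : measurable (A n).
  apply: measurableI; first exact: mO.
  rewrite -[X in measurable X]setCK; apply: measurableC; apply: open_measurable_plane.
  exact: (closed_openC (@closed_gap_ge R (eta n))).
have msq tau' : closed_form Omega tau' ->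
    measurable_fun (Omega : set (mplane R)) (fun z : mplane R => (sqn tau' z)%:E).
  move=> ct; apply/measurable_EFinP; apply: open_measurable_fun => // z Oz.
  exact: (sqn_cont ct Oz).
have UA : \bigcup_n A n = Omega.
  apply/seteqP; split => [z [n _ []]//|z Oz].
  have g0 : 0 < disk_gap z by apply/diskE; exact: (Omega_disk Oz).
  exists (Num.truncn (disk_gap z)^-1) => //; split => //=.
  rewrite /eta invf_ple ?posrE//; exact: (ltW (truncnS_gt _)).
have step n : (\int[lambda2 R]_(z in A n) (sqn superposition z)%:E <=
    (2 * count_cst N * E * fine (l2_sqnorm a))%:E)%E.
  set k := fun j => 2 * count_cst N * a j ^+ 2 * sqrt_gap j.
  have k0 j : 0 <= k j by rewrite /k mulr_ge0 ?sqrtr_ge0// mulr_ge0 ?sqr_ge0// mulr_ge0.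
  pose f j z : \bar R := (k j * (gapw (eta n) z * sqn (tau j) z))%:E.
  have f0 j z : (0 <= f j z)%E by rewrite lee_fin mulr_ge0 ?k0// mulr_ge0 ?gapw_ge0 ?sqn_ge0.
  have mw j : measurable_fun (Omega : set (mplane R))
      (fun z : mplane R => (gapw (eta n) z * sqn (tau j) z)%:E).
    by have [ct _ _ _] := Htau j; exact: (measurable_wsqn HB (eta0 n) ct).
  have mf j : measurable_fun (Omega : set (mplane R)) (f j : mplane R -> \bar R).
    by have := measurable_funeM (k j)%:E (mw j).
  have AO : A n `<=` Omega by move=> z [].
  apply: (@le_trans _ _ (\int[lambda2 R]_(z in A n) \sum_(j <- act (eta n)) f j z)%E).
    apply: ge0_le_integral => //.
    - by move=> z _; rewrite lee_fin sqn_ge0.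
    - exact: (measurable_funS mO AO (msq _ cl)).
    - by apply: emeasurable_sum => j; exact: (measurable_funS mO AO (mf j)).
    - by move=> z [Oz ez]; rewrite /f sumEFin lee_fin; exact: superposition_le.
  apply: (@le_trans _ _ (\int[lambda2 R]_(z in Omega) \sum_(j <- act (eta n)) f j z)%E).
    apply: ge0_subset_integral => //; first exact: emeasurable_sum.
    by move=> z _; apply: sume_ge0.
  rewrite ge0_integral_sum//.
  apply: (@le_trans _ _ (\sum_(j <- act (eta n)) (2 * count_cst N * E * a j ^+ 2)%:E)%E).
    apply: lee_sum => j _; rewrite /f.
    under eq_integral do rewrite EFinM.
    rewrite ge0_integralZl_EFin//; last by move=> z _; rewrite lee_fin mulr_ge0 ?gapw_ge0 ?sqn_ge0.
    have [_ _ _ et] := Htau j.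
    have s0 : sqrt_gap j != 0.
      by rewrite gt_eqF// sqrtr_gt0; apply/diskE; exact: holes_disk (Bc j).
    have -> : (2 * count_cst N * E * a j ^+ 2)%:E =
        ((k j)%:E * (E / sqrt_gap j)%:E)%E.
      by rewrite -EFinM; congr EFin; rewrite /k; field.
    by apply: lee_wpmul2l; [rewrite lee_fin|exact: et].
  rewrite sumEFin lee_fin -mulr_sumr; apply: ler_wpM2l; first by rewrite !mulr_ge0.
  exact: sum_sqr_le.
have nd : {homo A : n m / (n <= m)%N >-> (n <= m)%O}.
  move=> n m nm; apply/subsetPset => z [Oz h]; split => //=; apply: le_trans h.
  by rewrite /eta lef_pV2 ?posrE// ler_nat.
have mAs n : measurable_fun (A n) (fun z : mplane R => (sqn superposition z)%:E).
  by apply: (measurable_funS mO _ (msq _ cl)) => z [].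
have As0 n (z : mplane R) : A n z -> (0 <= (sqn superposition z)%:E)%E by rewrite lee_fin sqn_ge0.
have cv := ge0_nondecreasing_set_cvg_integral (mu := lambda2 R) nd mA mAs As0.
rewrite /form_sqnorm -[X in (\int[_]_(z in X) _ <= _)%E]UA.
rewrite -(cvg_lim (@ereal_hausdorff R) cv); apply: lime_le; first exact: (cvgP _ cv).
by apply: nearW => n; exact: step.
Qed.

Lemma superposition_L21c : L21c Omega superposition.
Proof.
have [f1 f2 fc] := superposition_closed; split.
- exact: (Ck_measurable oO (f1 0%N)).
- exact: (Ck_measurable oO (f2 0%N)).
- exact: le_lt_trans superposition_energy (ltry _).
- exact: (smooth_weakly_closed oO (f1 1%N) (f2 1%N) fc).
Qed.

(** The superposition is itself smooth, so the constant sequence serves as approximation in the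
    definition of the extended period. *)
Lemma superposition_Per l : period B gamma l superposition (a l).
Proof.
exists (fun=> superposition); split => [n||].
- have [f1 f2 _] := superposition_closed; split; first exact: superposition_L21c.
  by split; apply/CkP.
- have -> : superposition \- superposition = fun=> (0, 0).
    by apply/funext => z; rewrite /= subrr.
  rewrite /form_norm /form_sqnorm integral0_eq => [|z _ /=]; last by rewrite expr0n addr0.
  by rewrite sqrtr0; exact: cvg_cst.
- by rewrite superposition_period; exact: cvg_cst.
Qed.

Lemma superposition_norm :
  form_norm Omega superposition <= Num.sqrt (2 * count_cst N * E) * l2_norm a.
Proof.
have cst0 : 0 <= @count_cst R N by rewrite /count_cst !mulr_ge0.
have s0 : (0 <= form_sqnorm Omega superposition)%E.
  by apply: integral_ge0 => z _; rewrite lee_fin addr_ge0 ?sqr_ge0.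
rewrite /form_norm /l2_norm -sqrtrM ?mulr_ge0//; apply: ler_wsqrtr.
rewrite -lee_fin fineK; first exact: superposition_energy.
by rewrite ge0_fin_numE//; exact: le_lt_trans superposition_energy (ltry _).
Qed.

End Superposition.

(** * The interpolation constant *)

Lemma N_holesP {R : realType} {J : countType} (B : J -> set (plane R)) :
  uniformly_locally_finite B -> hyp_disks_meet_at_most B (N_holes B).
Proof.
move=> [N0 HN0].
suff : [set N | hyp_disks_meet_at_most B N /\
    forall N', hyp_disks_meet_at_most B N' -> (N <= N')%N] (N_holes B) by case.
apply: xgetPex.
have ex : exists N, `[< hyp_disks_meet_at_most B N >] by exists N0; apply/asboolP.
have [N /asboolP HN Nmin] := ex_minnP ex.
by exists N; split => // N' HN'; apply: Nmin; apply/asboolP.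
Qed.

Theorem theorem5p5 (R : realType) :
  exists K : R -> nat -> nat -> R,
    forall (J : countType) (B : J -> set (plane R)) (gamma : J -> R -> plane R)
           (S : R) (M : nat),
      regular_holes B ->
      period_curves B gamma ->
      uniformly_locally_finite B ->
      0 < S ->
      graph_connected B S ->
      (forall j : J, (graph_dist B S (Some j) None <= M%:R%:E)%E) ->
      interpolation_property B gamma /\ C_I B gamma <= K S M (N_holes B).
Proof.
(* The square root of the energy bound per unit of squared norm of the data; only [S], [M] and [N]
   enter. *)
exists (fun S M N => Num.sqrt (2 * count_cst N * hole_energy S M)).
move=> J B gamma S M HB Hg /N_holesP HN S0 _ HM.
have /boolp.choice[c Bc] : forall j, exists z, B j z.
  move=> j; have [U [[z Uz] _ _ ->]] := hole_domain HB j; exists z; exact: subset_closure.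
have /boolp.choice[tau Htau] : forall j, exists tau,
    hole_form B gamma (c j) (disk_gap (c j)) (hole_energy S M) (fun l => (l == j)%:R) tau.
  by move=> j; exact: (exists_hole_form HB Hg S0 (Bc j) (HM j)).
have E0 := hole_energy_ge0 S M.
set C := Num.sqrt _.
have IC : interpolation_constant B gamma C.
  split; first exact: sqrtr_ge0.
  move=> a Ha; exists (superposition HB tau Bc a); split.
  - exact: (superposition_L21c HB HN E0 Bc Htau Ha).
  - by move=> l; exact: (superposition_Per HB Hg HN E0 Bc Htau Ha).
  - exact: (superposition_norm HB HN E0 Bc Htau Ha).
split; first by exists C.
(* Admissible constants are nonnegative by definition, so the infimum is taken over a set bounded
   below. *)
by apply: ge_inf => //; exists 0 => x [].
Qed.
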